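(* Let $g \in L^2(\mathbb{R}^d)$, let $\Lambda \subseteq \mathbb{R}^d$ be a lattice and $S \in \mathrm{Sp}_{2d}(\mathbb{R})$. For a sequence $\{c_\lambda\}_{\lambda\in\Lambda}\subseteq\mathbb{C}$ put $f = \sum_{\lambda\in\Lambda} c_\lambda T_\lambda^S \mathcal{R}g$ and $f_\times = \sum_{\lambda\in\Lambda} \overline{c_\lambda} T_\lambda^S \mathcal{R}g$. Then: (1) If $\{ c_\lambda \} \in c_{00}(\Lambda)$, then $|V_gf(z)| = |V_g f_\times(z)|$ for all $z \in S(\mathbb{R}^d \times \Lambda^* )$. (2) If $\mathfrak{p}_{\Lambda^*}[\mu(S)^{-1}\mathcal{R}g] \in L^\infty(\mathcal{P}(\Lambda^* ))$ and $\{ c_\lambda \} \in \ell^2(\Lambda)$ (so that both series converge in $L^2(\mathbb{R}^d)$), then $|V_gf(z)| = |V_g f_\times(z)|$ for all $z \in S(\mathbb{R}^d \times \Lambda^* )$.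
   Context: $V_gf(x,\omega)=\int f(t)\overline{g(t-x)}e^{-2\pi i\omega\cdot t}dt$. $T_\lambda h(t)=h(t-\lambda)$, $\mathcal{R}h(t)=h(-t)$. $\mathrm{Sp}_{2d}(\mathbb{R})=\{S:S^T\mathcal{J}S=\mathcal{J}\}$, $\mathcal{J}=\begin{pmatrix}0&-I_d\\ I_d&0\end{pmatrix}$. $\mu(S)$ is the metaplectic operator associated to $S$ (unitary on $L^2(\mathbb{R}^d)$, determined up to sign), and $T_\lambda^S=\mu(S)T_\lambda\mu(S)^{-1}$. $c_{00}(\Lambda)$ is the set of sequences indexed by $\Lambda$ with finitely many nonzero entries. For $\Lambda=A\mathbb{Z}^d$: $\Lambda^*=A^{-T}\mathbb{Z}^d$, $\mathcal{P}(\Lambda^* )=A^{-T}[0,1]^d$; $\mathfrak{p}_\Gamma[\psi](t)=\sum_{\gamma\in\Gamma}|\mathcal{F}\psi(t+\gamma)|^2$ with $\mathcal{F}h(\omega)=\int h(t)e^{-2\pi i\omega\cdot t}dt$. $S(\mathbb{R}^d\times\Lambda^* )=\{S(x,\lambda):x\in\mathbb{R}^d,\lambda\in\Lambda^*\}$. *)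

(* Defs.v *)
From HB Require Import structures.
From mathcomp Require Import all_boot all_order all_algebra.
From mathcomp Require Import all_classical all_reals all_analysis.
From mathcomp Require Import Rstruct Rstruct_topology.
From mathcomp.real_closed Require Import complex.
Import Order.TTheory GRing.Theory Num.Theory.
Import numFieldNormedType.Exports.
Set Implicit Arguments. Unset Strict Implicit. Unset Printing Implicit Defensive.
Local Open Scope classical_set_scope.
Local Open Scope ring_scope.

Notation RR := Rdefinitions.R.
Notation CC := (RR[i]).

(* Points of R^d are column vectors 'cV[RR]_d; the phase space R^{2d} is
   'cV[RR]_(d + d), z = col_mx x omega. *)
Definition dotp (d : nat) (x y : 'cV[RR]_d) : RR := \sum_(i < d) x i 0 * y i 0.

Definition expi (t : RR) : CC := Complex (cos t) (sin t).

Definition ReC (z : CC) : RR := complex.Re z.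
Definition ImC (z : CC) : RR := complex.Im z.
Definition conjC (z : CC) : CC := Complex (ReC z) (- ImC z).
Definition abs2 (z : CC) : RR := ReC z ^+ 2 + ImC z ^+ 2.
Definition Cof (r : RR) : CC := Complex r 0.

Definition borelRd (d : nat) : set (set 'cV[RR]_d) := <<s [set: 'cV[RR]_d], open >>.
Definition borel_fun (d : nat) (f : 'cV[RR]_d -> CC) : Prop :=
  forall U : set RR, open U ->
    borelRd ((ReC \o f) @^-1` U) /\ borelRd ((ImC \o f) @^-1` U).

(* Lebesgue integral on R^d of a nonnegative function, as the iterated
   one-dimensional Lebesgue integral (Tonelli); it is only used for Borel
   measurable functions, for which it coincides with the integral w.r.t.
   the d-dimensional Lebesgue measure. *)
Fixpoint intRd (d : nat) : ('cV[RR]_d -> \bar RR) -> \bar RR :=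
  match d with
  | 0 => fun h => h 0
  | n.+1 => fun h =>
      (\int[@lebesgue_measure RR]_x
          intRd (fun y : 'cV[RR]_n => h (col_mx (const_mx x : 'cV[RR]_1) y)))%E
  end.

Definition intR (d : nat) (u : 'cV[RR]_d -> RR) : RR :=
  fine (intRd (fun x => (Num.max (u x) 0)%:E)) -
  fine (intRd (fun x => (Num.max (- u x) 0)%:E)).
Definition intC (d : nat) (h : 'cV[RR]_d -> CC) : CC :=
  Complex (intR (ReC \o h)) (intR (ImC \o h)).

Definition nrm2 (d : nat) (f : 'cV[RR]_d -> CC) : \bar RR :=
  intRd (fun x => (abs2 (f x))%:E).
Definition L2 (d : nat) (f : 'cV[RR]_d -> CC) : Prop :=
  borel_fun f /\ (nrm2 f < +oo)%E.
Definition ae_eq (d : nat) (f g : 'cV[RR]_d -> CC) : Prop :=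
  nrm2 (fun t => f t - g t) = 0%E.

Definition transl (d : nat) (a : 'cV[RR]_d) (h : 'cV[RR]_d -> CC) :=
  fun t => h (t - a).
Definition reflect_op (d : nat) (h : 'cV[RR]_d -> CC) := fun t : 'cV[RR]_d => h (- t).
Definition rho (d : nat) (z : 'cV[RR]_(d + d)) (h : 'cV[RR]_d -> CC) :=
  fun t : 'cV[RR]_d =>
    expi (- pi * dotp (usubmx z) (dsubmx z)) *
    expi (2 * pi * dotp (dsubmx z) t) * h (t - usubmx z).

Definition STFT (d : nat) (g f : 'cV[RR]_d -> CC) (x w : 'cV[RR]_d) : CC :=
  intC (fun t => f t * conjC (g (t - x)) * expi (- (2 * pi * dotp w t))).

(* Fourier transform on L^1 and its Plancherel extension on L^2:
   Phi is (a representative of) F psi iff the Fourier transforms of the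
   truncations psi * 1_{|t| <= n} converge to Phi in L^2. *)
Definition fourierL1 (d : nat) (h : 'cV[RR]_d -> CC) (w : 'cV[RR]_d) : CC :=
  intC (fun t => h t * expi (- (2 * pi * dotp w t))).
Definition is_fourierL2 (d : nat) (psi Phi : 'cV[RR]_d -> CC) : Prop :=
  L2 Phi /\
  forall eps : RR, 0 < eps -> exists N : nat, forall n : nat, (N <= n)%N ->
    (nrm2 (fun w => (Phi w - fourierL1
       (fun t => Cof (\1_[set s : 'cV[RR]_d | `|s| <= n%:R] t) * psi t) w)%R)
     < eps%:E)%E.

Definition Jmx (d : nat) : 'M[RR]_(d + d) := block_mx 0 (- 1%:M) 1%:M 0.
Definition symplectic (d : nat) (S : 'M[RR]_(d + d)) : Prop :=
  S^T *m Jmx d *m S = Jmx d.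

(* U is a metaplectic operator associated to S, with inverse Uinv:
   a unitary operator on L^2(R^d) (well defined on a.e.-classes, linear,
   isometric, with inverse Uinv) such that U rho(z) U^{-1} = rho(S z). *)
Definition metaplectic (d : nat) (S : 'M[RR]_(d + d))
    (U Uinv : ('cV[RR]_d -> CC) -> ('cV[RR]_d -> CC)) : Prop :=
  (forall h, L2 h -> L2 (U h) /\ L2 (Uinv h)) /\
  (forall h h', L2 h -> L2 h' -> ae_eq h h' ->
     ae_eq (U h) (U h') /\ ae_eq (Uinv h) (Uinv h')) /\
  (forall (a : CC) h h', L2 h -> L2 h' ->
     ae_eq (U (fun t => a * h t + h' t)) (fun t => a * U h t + U h' t)) /\
  (forall h, L2 h -> nrm2 (U h) = nrm2 h) /\
  (forall h, L2 h -> ae_eq (U (Uinv h)) h /\ ae_eq (Uinv (U h)) h) /\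
  (forall z h, L2 h -> ae_eq (U (rho z h)) (rho (S *m z) (U h))).

(* the lattice Lambda = A Z^d (A invertible) is indexed by k in Z^d via
   lambda = A k; the dual lattice Lambda^* = A^{-T} Z^d *)
Definition intvec (d : nat) (k : 'cV[int]_d) : 'cV[RR]_d := map_mx (fun n : int => n%:~R) k.
Definition latpt (d : nat) (A : 'M[RR]_d) (k : 'cV[int]_d) : 'cV[RR]_d := A *m intvec k.
Definition duallatpt (d : nat) (A : 'M[RR]_d) (k : 'cV[int]_d) : 'cV[RR]_d :=
  (invmx A)^T *m intvec k.
Definition fundP (d : nat) (A : 'M[RR]_d) : set 'cV[RR]_d :=
  [set t | exists u : 'cV[RR]_d, (forall i, 0 <= u i 0 <= 1) /\ t = (invmx A)^T *m u].

(* periodization p_{Lambda^*}[psi](t) = sum_{gamma in Lambda^*} |F psi (t+gamma)|^2,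
   with Phi a representative of F psi *)
Definition periodization (d : nat) (A : 'M[RR]_d) (Phi : 'cV[RR]_d -> CC)
    (t : 'cV[RR]_d) : \bar RR :=
  (\esum_(k in [set: 'cV[int]_d]) (abs2 (Phi (t + duallatpt A k)))%:E)%E.

Definition ess_bdd_on (d : nat) (P : set 'cV[RR]_d) (p : 'cV[RR]_d -> \bar RR) : Prop :=
  exists M : RR, intRd (fun t => (\1_[set s | P s /\ (M%:E < p s)%E] t)%:E) = 0%E.

Definition c00 (d : nat) (c : 'cV[int]_d -> CC) : Prop :=
  exists s : seq 'cV[int]_d, forall k, k \notin s -> c k = 0.
Definition ell2 (d : nat) (c : 'cV[int]_d -> CC) : Prop :=
  (\esum_(k in [set: 'cV[int]_d]) (abs2 (c k))%:E < +oo)%E.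

Definition has_sumL2 (d : nat) (c : 'cV[int]_d -> CC)
    (phi : 'cV[int]_d -> 'cV[RR]_d -> CC) (f : 'cV[RR]_d -> CC) : Prop :=
  L2 f /\
  forall eps : RR, 0 < eps -> exists s0 : seq 'cV[int]_d,
    forall s : seq 'cV[int]_d, uniq s -> {subset s0 <= s} ->
      (nrm2 (fun t => (f t - \sum_(k <- s) c k * phi k t)%R) < eps%:E)%E.

(* T^S_lambda R g, with T^S_lambda = mu(S) T_lambda mu(S)^{-1} *)
Definition TSRg (d : nat) (A : 'M[RR]_d)
    (U Uinv : ('cV[RR]_d -> CC) -> ('cV[RR]_d -> CC)) (g : 'cV[RR]_d -> CC)
    (k : 'cV[int]_d) : 'cV[RR]_d -> CC :=
  U (transl (latpt A k) (Uinv (reflect_op g))).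

(* Main.v *)
(** Write [z = S (x, lambda-star) = (y, w)] and let [B_k] be the STFT at [z] of the
    [k]-th translate. Up to a null set this translate is the time-frequency shift
    [rho (S (lambda_k, 0))] of the reflected window, and the substitution
    [t -> a + y - t] in the integral shows that [B_k] is the conjugate of [B_k] times
    [e^(-2 pi i w.y)] and [e^(2 pi i sigma)], where [sigma] is the symplectic form of
    [S (lambda_k, 0)] and [S (x, lambda-star)]. As [S] is symplectic, [sigma] is the
    integer [lambda_k . lambda-star]. So [B_k = u * conj B_k] with a unimodular [u]
    that does not depend on [k], whence the modulus of [sum c_k B_k] equals that of
    [sum conj(c_k) B_k].

    The series converge in the second part because of the Bessel inequality
    [||sum c_k phi(. - lambda_k)||^2 <= C sum |c_k|^2]. On the Fourier side it follows
    by unfolding the integral over a fundamental domain of the dual lattice, where the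
    periodization is bounded and the characters are orthogonal. To return from the
    Fourier side it is enough that [||h|| <= C ||F h||] for [h] in L2 with bounded
    support. For step functions this is an identity up to a constant: the Gram matrix
    of the Fourier transforms of intervals is a multiple of that of the intervals,
    since the integral of [(1 - cos (2 pi v x)) / (2 pi v)^2] over [v] is proportional
    to [|x|]. The general case follows by density and Fatou's lemma. *)

Require Import Defs.
From HB Require Import structures.
From mathcomp Require Import all_boot all_order all_algebra.
From mathcomp Require Import Rstruct Rstruct_topology.
From mathcomp.real_closed Require Import complex.
From mathcomp Require Import all_classical all_reals all_analysis.
From mathcomp Require Import measurable_realfun.
From mathcomp Require Import ring lra.
Import Order.TTheory GRing.Theory Num.Theory.
Import numFieldNormedType.Exports.
Set Implicit Arguments. Unset Strict Implicit. Unset Printing Implicit Defensive.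
Local Open Scope classical_set_scope.
Local Open Scope ring_scope.

(** * Lebesgue measure on the space of column vectors *)

(** [intRd] is only an iterated one-dimensional integral. A measure [leb] is therefore built from it
    and the two integrals are identified, so that limit theorems become available. Translations and
    reflections are transported coordinate by coordinate; general linear changes of variables are
    avoided, which is why the dual lattice is treated by a tile and translations alone. A
    metaplectic operator is known only up to null sets, whereas the STFT is evaluated at points. The
    two meet because the STFT at one point is a pairing with a fixed L2 function, which ignores null
    sets and is continuous in L2. The Fourier transform on L2 is given only as a limit over
    truncations. The Bessel inequality is thus proved for finite sums of truncated translates, whose
    transform is a trigonometric polynomial times that of the truncation, and passed to the limit by
    Fatou's lemma. The sum of a series must be an actual Borel function, so its partial sums are
    first set to zero on a null set, off which they converge. *)

HB.instance Definition _ := Measurable.copy RR (measurableTypeR RR).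

(** Taking [borelRd] itself as the sigma-algebra makes [borel_fun] equivalent to measurability of
    both components, as [borel_funP] records. *)
HB.instance Definition _ d := @isMeasurable.Build
  (sigma_display (@open 'cV[RR]_d)) 'cV[RR]_d (@borelRd d)
  (@sigma_algebra0 _ _ _) (@sigma_algebraC _ _) (@sigma_algebra_bigcup _ _ _).

Definition leb1 : {sigma_finite_measure set RR -> \bar RR} :=
  @lebesgue_measure RR.

Lemma leb1_itvoc (a b : RR) : a <= b -> leb1 `]a, b]%classic = (b - a)%:E.
Proof.
move=> ab; rewrite /leb1 [LHS]lebesgue_measure_itv/= lte_fin; case: ltP => // ba.
by rewrite (@le_anti _ _ a b) ?subrr// ab.
Qed.

(** An open set is a countable union of max-norm balls with rational centre and radius, and the
    preimage of such a ball is a finite intersection of preimages under the coordinates. *)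
Lemma measurable_fun_cV d (X : measurableType d) n (phi : X -> 'cV[RR]_n) :
  (forall i, measurable_fun setT (fun x => phi x i 0)) ->
  measurable_fun setT phi.
Proof.
move=> mphi; apply: (@measurability _ _ _ _ _ _ (@open 'cV[RR]_n)) => //.
move=> _ [B oB <-]; rewrite setTI.
pose J := [set p : 'cV[rat]_n * rat |
  0 < ratr p.2 :> RR /\ ball (map_mx ratr p.1 : 'cV[RR]_n) (ratr p.2) `<=` B].
have -> : phi @^-1` B = \bigcup_(p in J)
    phi @^-1` (ball (map_mx ratr p.1 : 'cV[RR]_n) (ratr p.2)).
  apply/seteqP; split=> x /=; last first.
    by move=> [p [_ pB]] /= xp; exact: pB.
  move=> Bx; have /nbhs_ballP[e /= e0 eB] : nbhs (phi x) B.
    by apply: open_nbhs_nbhs; split.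
  (* Half of [e], because a ball of radius [r] that contains [phi x] lies within distance [2 r] of
     [phi x]. *)
  have [r] : exists r : rat, 0 < (ratr r : RR) < e / 2.
    have := @rat_in_itvoo RR 0 (e / 2).
    by rewrite divr_gt0// => /(_ isT)[r]; rewrite in_itv/=; exists r.
  move=> /andP[r0 re].
  have H (i : 'I_n) : {q : rat | phi x i 0 - ratr r < ratr q < phi x i 0 + ratr r}.
    apply/cid; have := @rat_in_itvoo RR (phi x i 0 - ratr r) (phi x i 0 + ratr r).
    rewrite ltrBlDr -addrA ltrDl addr_gt0// => /(_ isT)[q].
    by rewrite in_itv/=; exists q.
  pose q : 'cV[rat]_n := \col_i sval (H i).
  have qx : ball (map_mx ratr q : 'cV[RR]_n) (ratr r) (phi x).
    split=> // i j; rewrite (ord1 j) !mxE /ball /= ltr_distlC.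
    case: (H i) => s /= /andP[s1 s2].
    by rewrite ltrBlDr s2 /= -ltrBlDr s1.
  exists (q, r) => //; split => // y /= qy; apply: eB.
  apply: (@le_ball _ _ _ (ratr r + ratr r)).
    by rewrite [e]splitr lerD// ltW.
  exact: ball_triangle (ball_sym qx) qy.
rewrite bigcup_mkcond.
have cJ : countable [set: 'cV[rat]_n * rat] by exact: countableP.
apply: countable_bigcupT_measurable => // -[q r].
case: ifP => // /set_mem [/= r0 _].
have -> : phi @^-1` ball (map_mx ratr q : 'cV[RR]_n) (ratr r) =
    \bigcap_(i in [set: 'I_n]) ((fun x => phi x i 0) @^-1`
       (ball (ratr (q i 0) : RR) (ratr r))).
  apply/seteqP; split => x /=.
    by move=> [_ xq] i _; have := xq i 0; rewrite mxE.
  by move=> xq; split => // i j; rewrite (ord1 j) mxE; exact: xq.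
apply: fin_bigcap_measurable => // i _.
rewrite -[X in measurable X]setTI; apply: mphi => //.
by apply: open_measurable; exact: ball_open.
Qed.

Lemma measurable_coord n (i : 'I_n) :
  measurable_fun setT (fun x : 'cV[RR]_n => x i 0).
Proof.
apply: (@measurability _ _ _ _ _ _ (@RGenOpens.G RR)).
  exact: RGenOpens.measurableE.
move=> _ [_ [a [b ->]] <-]; rewrite setTI; apply: sub_sigma_algebra.
by apply: open_comp; [move=> + _; exact: coord_continuous|exact: interval_open].
Qed.

Lemma continuous_measurable_fun_cV n (f : 'cV[RR]_n -> RR) :
  continuous f -> measurable_fun setT f.
Proof.
move=> cf; apply: (@measurability _ _ _ _ _ _ (@RGenOpens.G RR)).
  exact: RGenOpens.measurableE.
move=> _ [_ [a [b ->]] <-]; rewrite setTI; apply: sub_sigma_algebra.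
by apply: open_comp; [move=> + _; exact: cf|exact: interval_open].
Qed.

(** A name for the column that [intRd] assembles in its recursive step; inductions on the dimension
    go through it. *)
Definition ccons n (x : RR) (y : 'cV[RR]_n) : 'cV[RR]_n.+1 :=
  col_mx (const_mx x : 'cV[RR]_1) y.

Lemma ccons0 n x (y : 'cV[RR]_n) : ccons x y ord0 0 = x.
Proof.
rewrite /ccons (_ : ord0 = lshift n (ord0 : 'I_1)); last exact: val_inj.
by apply: etrans (col_mxEu (const_mx x : 'cV_1) y ord0 0) _; rewrite mxE.
Qed.

Lemma cconsS n x (y : 'cV[RR]_n) i : ccons x y (lift ord0 i) 0 = y i 0.
Proof.
rewrite /ccons (_ : lift ord0 i = rshift 1 i); last exact: val_inj.
exact: (col_mxEd (const_mx x : 'cV_1) y i 0).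
Qed.

Lemma measurable_fun_ccons n d (X : measurableType d) (a : X -> RR)
    (v : X -> 'cV[RR]_n) :
  measurable_fun setT a -> measurable_fun setT v ->
  measurable_fun setT (fun x => ccons (a x) (v x)).
Proof.
move=> ma mv; apply: measurable_fun_cV => i; case: (unliftP ord0 i) => [j|] ->.
  rewrite (_ : (fun x => _) = (fun x => v x j 0)); last first.
    by apply/funext => p; exact: cconsS.
  exact: (measurableT_comp (measurable_coord j)).
by rewrite (_ : (fun x => _) = a)//; apply/funext => p; exact: ccons0.
Qed.

Lemma intRdS n (h : 'cV[RR]_n.+1 -> \bar RR) :
  intRd h = (\int[leb1]_x intRd (fun y => h (ccons x y)))%E.
Proof. by []. Qed.

Lemma intRd_ge0 n (h : 'cV[RR]_n -> \bar RR) :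
  (forall x, 0 <= h x)%E -> (0 <= intRd h)%E.
Proof.
elim: n h => [|n IH] h h0 /=; first exact: h0.
by apply: integral_ge0 => x _; apply: IH => y; exact: h0.
Qed.

(** The parameter space [X] is arbitrary so that the induction can move the outermost integration
    variable into it, after which the one-dimensional Fubini-Tonelli theorem applies. *)
Lemma measurable_intRd n d (X : measurableType d) (h : X * 'cV[RR]_n -> \bar RR) :
  (forall z, 0 <= h z)%E -> measurable_fun setT h ->
  measurable_fun setT (fun x => intRd (fun y => h (x, y))).
Proof.
elim: n d X h => [|n IH] d X h h0 mh /=.
  by apply: measurableT_comp => //; exact: pair2_measurable.
apply: (@measurable_fun_fubini_tonelli_F _ _ X RR RR leb1
  (fun p => intRd (fun y => h (p.1, ccons p.2 y)))); last first.
  by move=> p; apply: intRd_ge0.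
apply: (IH _ _ (fun q : (X * RR) * 'cV[RR]_n => h (q.1.1, ccons q.1.2 q.2))) => //.
apply: measurableT_comp => //.
apply: measurable_fun_pair.
  exact: measurableT_comp measurable_fst measurable_fst.
apply: measurable_fun_ccons => //.
exact: measurableT_comp measurable_snd measurable_fst.
Qed.

Lemma measurable_ccons_section n (h : 'cV[RR]_n.+1 -> \bar RR) x :
  measurable_fun setT h -> measurable_fun setT (fun y => h (ccons x y)).
Proof.
by move=> mh; apply: measurableT_comp => //; exact: measurable_fun_ccons.
Qed.

Lemma measurable_intRd_ccons n (h : 'cV[RR]_n.+1 -> \bar RR) :
  (forall z, 0 <= h z)%E -> measurable_fun setT h ->
  measurable_fun setT (fun x => intRd (fun y => h (ccons x y))).
Proof.
move=> h0 mh.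
apply: (measurable_intRd (h := fun p : RR * 'cV[RR]_n => h (ccons p.1 p.2))) => //.
by apply: measurableT_comp => //; exact: measurable_fun_ccons.
Qed.

(** Monotone convergence, one coordinate at a time; it is the source of the countable additivity of
    [leb]. *)
Lemma intRd_nneseries n (h : nat -> 'cV[RR]_n -> \bar RR) :
  (forall k z, 0 <= h k z)%E -> (forall k, measurable_fun setT (h k)) ->
  intRd (fun x => \sum_(k <oo) h k x)%E = (\sum_(k <oo) intRd (h k))%E.
Proof.
elim: n h => [|n IH] h h0 mh //.
rewrite intRdS -integral_nneseries //=.
- apply: eq_integral => x _.
  by rewrite (IH (fun k y => h k (ccons x y)))// => k; exact: measurable_ccons_section.
- by move=> k; exact: measurable_intRd_ccons.
- by move=> k x _; exact: intRd_ge0.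
Qed.

(** The measure is derived from [intRd], not the other way round, so that [integral_leb] can carry
    measure theory over to the integral of the statement. *)
Definition leb n (E : set 'cV[RR]_n) : \bar RR := intRd (fun x => (\1_E x)%:E).

Lemma intRd0 n : intRd (fun _ : 'cV[RR]_n => 0%E) = 0%E.
Proof. by elim: n => //= n IH; rewrite integral0_eq// => x _; exact: IH. Qed.

Lemma leb_set0 n : @leb n set0 = 0%E.
Proof. by rewrite /leb; under eq_fun do rewrite indic0; exact: intRd0. Qed.

Lemma leb_ge0 n (E : set 'cV[RR]_n) : (0 <= leb E)%E.
Proof. by apply: intRd_ge0 => x; rewrite lee_fin. Qed.

Lemma leb_semi_sigma_additive n : semi_sigma_additive (@leb n).
Proof.
move=> F mF tF mUF.
rewrite [X in _ --> X](_ : _ = \sum_(k <oo) leb (F k))%E.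
  by apply/cvg_closeP; split; [apply: is_cvg_nneseries => *; exact: leb_ge0|rewrite closeE].
rewrite /leb -intRd_nneseries.
- congr intRd; apply/funext => x.
  (* At a fixed [x] the claim is the countable additivity of the Dirac measure at [x]. *)
  apply/esym/cvg_lim => //.
  exact: (@measure_semi_sigma_additive _ _ RR (dirac x) F mF tF mUF).
- by move=> k z; rewrite lee_fin.
- by move=> k; apply/measurable_EFinP; exact: measurable_indic.
Qed.

HB.instance Definition _ n := isMeasure.Build _ _ _ (@leb n)
  (@leb_set0 n) (@leb_ge0 n) (@leb_semi_sigma_additive n).

Lemma intRdZl n (r : RR) (h : 'cV[RR]_n -> \bar RR) :
  0 <= r -> (forall x, 0 <= h x)%E -> measurable_fun setT h ->
  (intRd (fun x => r%:E * h x) = r%:E * intRd h)%E.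
Proof.
move=> r0; elim: n h => [|n IH] h h0 mh //.
rewrite !intRdS -ge0_integralZl_EFin//.
- by apply: eq_integral => x _; rewrite IH//; exact: measurable_ccons_section.
- by move=> x _; exact: intRd_ge0.
- exact: measurable_intRd_ccons.
Qed.

Lemma measurable_prod_coord n (f : 'I_n -> RR -> RR) :
  (forall i, measurable_fun setT (f i)) ->
  measurable_fun setT (fun x : 'cV[RR]_n => \prod_i f i (x i 0)).
Proof.
move=> mf; apply: measurable_prod => i _.
exact: measurableT_comp (mf i) (measurable_coord i).
Qed.

Lemma intRd_prod n (f : 'I_n -> RR -> RR) :
  (forall i x, 0 <= f i x) -> (forall i, measurable_fun setT (f i)) ->
  (intRd (fun x : 'cV[RR]_n => (\prod_i f i (x i 0))%:E) =
   \prod_i \int[leb1]_x (f i x)%:E)%E.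
Proof.
elim: n f => [|n IH] f f0 mf; first by rewrite /= !big_ord0.
rewrite intRdS big_ord_recl -ge0_integralZr//; last 3 first.
- by apply/measurable_EFinP; exact: mf.
- by move=> x _; rewrite lee_fin.
- by apply: prode_ge0 => i _; apply: integral_ge0 => x _; rewrite lee_fin.
apply: eq_integral => x _; rewrite -IH// -intRdZl//.
- congr intRd; apply/funext => y; rewrite big_ord_recl ccons0 EFinM.
  by congr (_ * (_)%:E)%E; apply: eq_bigr => i _; rewrite cconsS.
- by move=> y; rewrite lee_fin prodr_ge0.
- by apply/measurable_EFinP; apply: (measurable_prod_coord (f := fun i => f (lift ord0 i))).
Qed.

(** Half-open boxes are closed under intersection, which the Dynkin argument below requires. *)
Definition box n (a b : 'I_n -> RR) : set 'cV[RR]_n :=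
  [set x | forall i, a i < x i 0 <= b i].

Lemma indic_box n (a b : 'I_n -> RR) x :
  \1_(box a b) x = \prod_i (\1_(`]a i, b i]%classic) (x i 0) : RR).
Proof.
rewrite !indicE; case: (boolP (x \in box a b)) => xab.
  rewrite big1// => i _; rewrite indicE mem_set//=.
  by move/set_mem : xab => /(_ i); rewrite in_itv.
have : exists i, ~~ (a i < x i 0 <= b i).
  apply: contrapT => H; move/negP : xab; apply; apply/mem_set => i.
  by apply: contrapT => /negP Hi; apply: H; exists i.
move=> [i xi]; rewrite (bigD1 i)//= indicE memNset ?mul0r//=.
by rewrite in_itv/=; exact/negP.
Qed.

Lemma measurable_box n (a b : 'I_n -> RR) : measurable (box a b).
Proof.
rewrite (_ : box a b = \bigcap_(i in [set: 'I_n])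
  ((fun x => x i 0) @^-1` `]a i, b i]%classic)); last first.
  apply/seteqP; split=> x /= H i; first by move=> _; rewrite /= in_itv/=; exact: H.
  by have := H i Logic.I; rewrite /= in_itv.
apply: fin_bigcap_measurable => // i _.
rewrite -[X in measurable X]setTI; exact: measurable_coord.
Qed.

Lemma leb_box n (a b : 'I_n -> RR) : (forall i, a i <= b i) ->
  leb (box a b) = (\prod_i (b i - a i))%:E.
Proof.
move=> ab; rewrite /leb.
under eq_fun do rewrite indic_box.
rewrite (intRd_prod (f := fun i => \1_(`]a i, b i]%classic)))//.
rewrite -prodEFin/=; apply: eq_bigr => i _.
rewrite integral_indic// setIT.
exact: leb1_itvoc.
Qed.

Definition cube n (k : RR) : set 'cV[RR]_n := box (fun=> - k) (fun=> k).

Lemma leb_sigma_finite n : sigma_finite setT (@leb n).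
Proof.
exists (fun k => @cube n k%:R).
  apply/esym; apply/seteqP; split => // x _.
  pose M := \sum_i (`|x i 0| + 1).
  have M0 i : `|x i 0| < M.
    rewrite /M (bigD1 i)//= -addrA ltrDl ltr_pwDl//.
    by apply: sumr_ge0 => j _; rewrite addr_ge0.
  exists (Num.bound M) => // i; rewrite -ltrNl.
  have := M0 i; rewrite ltr_norml => /andP[H1 H2].
  have MB : M < (Num.bound M)%:R.
    by apply: archi_boundP; rewrite (le_trans _ (ltW (M0 i))).
  by rewrite (ltW (lt_trans H2 MB)) andbT ltrNl (lt_trans _ H1)// ltrN2.
move=> k; split; first exact: measurable_box.
by rewrite leb_box ?ltry// => i; rewrite (@le_trans _ _ 0)// oppr_le0.
Qed.

HB.instance Definition _ n := @Measure_isSigmaFinite.Build _ _ _ (@leb n)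
  (@leb_sigma_finite n).

Lemma leb_pushforward n (E : set 'cV[RR]_n.+1) : measurable E ->
  leb E = pushforward (leb1 \x (@leb n))%E (fun p : RR * 'cV[RR]_n => ccons p.1 p.2) E.
Proof.
move=> mE; rewrite /pushforward /product_measure1 /leb intRdS.
apply: eq_integral => x _ /=; congr intRd; apply/funext => y.
by rewrite /= !indicE mem_xsection.
Qed.

(** In dimension 0 the measure is a Dirac mass. In the inductive step [leb] is the image under
    [ccons] of a product measure, and Tonelli's theorem unrolls one integral. *)
Lemma integral_leb n (h : 'cV[RR]_n -> \bar RR) :
  (forall x, 0 <= h x)%E -> measurable_fun setT h ->
  (\int[@leb n]_x h x = intRd h)%E.
Proof.
elim: n h => [|n IH] h h0 mh.
  rewrite (eq_measure_integral (dirac (0 : 'cV[RR]_0))).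
    by rewrite integral_dirac// diracT mul1e.
  by move=> A mA _.
have mc : measurable_fun setT (fun p : RR * 'cV[RR]_n => ccons p.1 p.2).
  exact: measurable_fun_ccons.
pose m : {measure set (RR * 'cV[RR]_n)%type -> \bar RR} := (leb1 \x (@leb n))%E.
transitivity (\int[m]_p (h \o (fun p : RR * 'cV[RR]_n => ccons p.1 p.2)) p)%E.
  have E := ge0_integral_pushforward mc m measurableT mh (fun y _ => h0 y).
  rewrite preimage_setT in E; rewrite -E.
  by apply: eq_measure_integral => A mA _; exact: leb_pushforward.
rewrite fubini_tonelli1//=; last exact: measurableT_comp.
apply: eq_integral => x _; apply: (IH (fun y => h (ccons x y))) => //.
exact: measurable_ccons_section.
Qed.

(** The image of [leb1] under the shift agrees with it on half-open intervals, hence everywhere by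
    uniqueness of Lebesgue measure. *)
Lemma integral_leb1_shift (a : RR) (f : RR -> \bar RR) :
  (forall x, 0 <= f x)%E -> measurable_fun setT f ->
  (\int[leb1]_x f (x + a)%R = \int[leb1]_x f x)%E.
Proof.
move=> f0 mf.
have ms : measurable_fun setT (fun x : RR => x + a) by apply: measurable_funD.
have E := ge0_integral_pushforward ms leb1 measurableT mf (fun y _ => f0 y).
rewrite preimage_setT in E; apply: etrans (esym E) _.
apply: eq_measure_integral => A mA _.
apply/esym/(@lebesgue_measure_unique RR) => //= _ [[u v]] _ <-.
rewrite /pushforward (_ : _ @^-1` _ = `]u - a, v - a]%classic); last first.
  by apply/seteqP; split => x /=; rewrite !in_itv/= ltrBlDr lerBrDr.
rewrite lebesgue_measure_itv [RHS]lebesgue_measure_itv/= !lte_fin ltrD2r.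
by case: ifP => // _; congr (_%:E); lra.
Qed.

Lemma integral_leb1_opp (f : RR -> \bar RR) :
  (forall x, 0 <= f x)%E -> measurable_fun setT f ->
  (\int[leb1]_x f (- x)%R = \int[leb1]_x f x)%E.
Proof.
move=> f0 mf.
have ms : measurable_fun setT (fun x : RR => - x).
  exact: oppr_measurable.
have E := ge0_integral_pushforward ms leb1 measurableT mf (fun y _ => f0 y).
rewrite preimage_setT in E; apply: etrans (esym E) _.
apply: eq_measure_integral => A mA _; exact: lebesgue_measureN.
Qed.

Lemma ccons_eta n (x : 'cV[RR]_n.+1) :
  x = ccons (x ord0 0) (\col_i x (lift ord0 i) 0).
Proof.
apply/matrixP => i j; rewrite (ord1 j).
by case: (unliftP ord0 i) => [k|] ->; rewrite ?cconsS ?ccons0// mxE.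
Qed.

Lemma cconsD n a b (x y : 'cV[RR]_n) : ccons a x + ccons b y = ccons (a + b) (x + y).
Proof.
apply/matrixP => i j; rewrite (ord1 j) mxE.
by case: (unliftP ord0 i) => [k|] ->; rewrite ?cconsS ?ccons0// mxE.
Qed.

Lemma cconsN n a (x : 'cV[RR]_n) : - ccons a x = ccons (- a) (- x).
Proof.
apply/matrixP => i j; rewrite (ord1 j) mxE.
by case: (unliftP ord0 i) => [k|] ->; rewrite ?cconsS ?ccons0// mxE.
Qed.

Lemma measurable_cV_shift n (a : 'cV[RR]_n) :
  measurable_fun setT (fun x : 'cV[RR]_n => x + a).
Proof.
apply: measurable_fun_cV => i.
rewrite (_ : (fun x => _) = (fun x : 'cV[RR]_n => x i 0 + a i 0)).
  by apply: measurable_funD => //; exact: measurable_coord.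
by apply/funext => x; rewrite mxE.
Qed.

Lemma measurable_cV_opp n : measurable_fun setT (fun x : 'cV[RR]_n => - x).
Proof.
apply: measurable_fun_cV => i.
rewrite (_ : (fun x => _) = (fun x : 'cV[RR]_n => - x i 0)).
  by apply: measurableT_comp => //; exact: measurable_coord.
by apply/funext => x; rewrite mxE.
Qed.

Lemma integral_leb_shift n (a : 'cV[RR]_n) (h : 'cV[RR]_n -> \bar RR) :
  (forall x, 0 <= h x)%E -> measurable_fun setT h ->
  (\int[@leb n]_x h (x + a)%R = \int[@leb n]_x h x)%E.
Proof.
move=> h0 mh; rewrite !integral_leb//; last first.
  exact: measurableT_comp mh (measurable_cV_shift a).
elim: n a h h0 mh => [|n IH] a h h0 mh.
  by congr intRd; apply/funext => x; congr h; apply/matrixP => -[].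
rewrite !intRdS (ccons_eta a); set a0 := a ord0 0; set a1 := \col_i _.
have E x : intRd (fun y => h (ccons x y + ccons a0 a1)) =
    intRd (fun y => h (ccons (x + a0) y)).
  under eq_fun do rewrite cconsD.
  by apply: (IH a1 (fun y => h (ccons (x + a0) y))) => //; exact: measurable_ccons_section.
transitivity (\int[leb1]_x intRd (fun y => h (ccons (x + a0)%R y)))%E.
  by apply: eq_integral => x _; rewrite E.
apply: (integral_leb1_shift a0 (f := fun x => intRd (fun y => h (ccons x y)))).
  by move=> x; exact: intRd_ge0.
exact: measurable_intRd_ccons.
Qed.

Lemma integral_leb_opp n (h : 'cV[RR]_n -> \bar RR) :
  (forall x, 0 <= h x)%E -> measurable_fun setT h ->
  (\int[@leb n]_x h (- x)%R = \int[@leb n]_x h x)%E.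
Proof.
move=> h0 mh; rewrite !integral_leb//; last first.
  exact: measurableT_comp mh (@measurable_cV_opp n).
elim: n h h0 mh => [|n IH] h h0 mh.
  by congr intRd; apply/funext => x; congr h; apply/matrixP => -[].
have E x : intRd (fun y => h (- ccons x y)) =
    intRd (fun y => h (ccons (- x) y)).
  under eq_fun do rewrite cconsN.
  by apply: (IH (fun y => h (ccons (- x) y))) => //; exact: measurable_ccons_section.
rewrite !intRdS; transitivity (\int[leb1]_x intRd (fun y => h (ccons (- x)%R y)))%E.
  by apply: eq_integral => x _; rewrite E.
apply: (integral_leb1_opp (f := fun x => intRd (fun y => h (ccons x y)))).
  by move=> x; exact: intRd_ge0.
exact: measurable_intRd_ccons.
Qed.

Definition cmeas n (f : 'cV[RR]_n -> CC) :=
  measurable_fun setT (ReC \o f) /\ measurable_fun setT (ImC \o f).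

Lemma borel_funP n (f : 'cV[RR]_n -> CC) : borel_fun f <-> cmeas f.
Proof.
split=> [bf|[m1 m2] V oV]; last first.
  split; rewrite -[X in borelRd X]setTI; [apply: m1|apply: m2] => //; exact: open_measurable.
have H (u : 'cV[RR]_n -> RR) : (forall V : set RR, open V -> borelRd (u @^-1` V)) ->
    measurable_fun setT u.
  move=> hu; apply: (@measurability _ _ _ _ _ _ (@RGenOpens.G RR)).
    exact: RGenOpens.measurableE.
  by move=> _ [_ [a [b ->]] <-]; rewrite setTI; apply: hu; exact: interval_open.
by split; apply: H => V /bf[].
Qed.

(** * Complex-valued functions, L2 and integrals *)

Arguments ReC : simpl never.
Arguments ImC : simpl never.
Arguments conjC : simpl never.
Arguments abs2 : simpl never.
Arguments expi : simpl never.

Lemma ReCE (a b : RR) : ReC (Complex a b) = a. Proof. by []. Qed.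
Lemma ImCE (a b : RR) : ImC (Complex a b) = b. Proof. by []. Qed.
Lemma ReCD (x y : CC) : ReC (x + y) = ReC x + ReC y. Proof. by case: x; case: y. Qed.
Lemma ImCD (x y : CC) : ImC (x + y) = ImC x + ImC y. Proof. by case: x; case: y. Qed.
Lemma ReCN (x : CC) : ReC (- x) = - ReC x. Proof. by case: x. Qed.
Lemma ImCN (x : CC) : ImC (- x) = - ImC x. Proof. by case: x. Qed.
Lemma ReCM (x y : CC) : ReC (x * y) = ReC x * ReC y - ImC x * ImC y.
Proof. by case: x; case: y. Qed.
Lemma ImCM (x y : CC) : ImC (x * y) = ReC x * ImC y + ImC x * ReC y.
Proof. by case: x => a b; case: y => c e; rewrite /ImC /ReC /= . Qed.
Lemma CC_eqP (x y : CC) : ReC x = ReC y -> ImC x = ImC y -> x = y.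
Proof. by case: x => a b; case: y => c e; rewrite !(ReCE, ImCE) => -> ->. Qed.
Lemma ReC_conj x : ReC (conjC x) = ReC x. Proof. by []. Qed.
Lemma ImC_conj x : ImC (conjC x) = - ImC x. Proof. by []. Qed.
Lemma ReC_expi (t : RR) : ReC (expi t) = cos t. Proof. by []. Qed.
Lemma ImC_expi (t : RR) : ImC (expi t) = sin t. Proof. by []. Qed.
Definition CCE := (ReCE, ImCE, ReCD, ImCD, ReCN, ImCN, ReCM, ImCM, ReC_conj,
  ImC_conj, ReC_expi, ImC_expi).

Lemma conjCD x y : conjC (x + y) = conjC x + conjC y.
Proof. by apply: CC_eqP; rewrite !CCE //; ring. Qed.
Lemma conjCM x y : conjC (x * y) = conjC x * conjC y.
Proof. by apply: CC_eqP; rewrite !CCE //; ring. Qed.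
Lemma conjCCK x : conjC (conjC x) = x.
Proof. by apply: CC_eqP; rewrite !CCE ?opprK. Qed.
Lemma conjC0 : conjC 0 = 0. Proof. by apply: CC_eqP; rewrite !CCE ?oppr0. Qed.
Lemma conjC_sum I (s : seq I) (F : I -> CC) :
  conjC (\sum_(i <- s) F i) = \sum_(i <- s) conjC (F i).
Proof. exact: (big_morph conjC conjCD conjC0). Qed.
Lemma ReC_sum I (s : seq I) (F : I -> CC) :
  ReC (\sum_(i <- s) F i) = \sum_(i <- s) ReC (F i).
Proof. exact: (big_morph ReC ReCD). Qed.

Lemma abs2_ge0 x : 0 <= abs2 x. Proof. by rewrite addr_ge0// sqr_ge0. Qed.
Lemma abs2M x y : abs2 (x * y) = abs2 x * abs2 y.
Proof. by rewrite /abs2 !CCE; ring. Qed.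
Lemma abs2N x : abs2 (- x) = abs2 x.
Proof. by rewrite /abs2 !CCE !sqrrN. Qed.
Lemma abs2_conj x : abs2 (conjC x) = abs2 x.
Proof. by rewrite /abs2 !CCE sqrrN. Qed.
Lemma abs20 : abs2 0 = 0. Proof. by rewrite /abs2 /= expr0n addr0. Qed.
Lemma abs2_eq0 x : abs2 x = 0 -> x = 0.
Proof.
move/eqP; rewrite paddr_eq0 ?sqr_ge0// !sqrf_eq0 => /andP[/eqP a /eqP b].
exact: CC_eqP.
Qed.
(** This stands in for Minkowski's inequality: squared norms are compared throughout, and the
    numerical factors of the later bounds come from its factor 2. *)
Lemma abs2_le_add x y : abs2 (x + y) <= 2 * abs2 x + 2 * abs2 y.
Proof.
rewrite /abs2 !CCE.
have := sqr_ge0 (ReC x - ReC y); have := sqr_ge0 (ImC x - ImC y).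
by rewrite !expr2; nra.
Qed.
Lemma abs2E x : abs2 x = ReC (x * conjC x).
Proof. by rewrite /abs2 !CCE; ring. Qed.
Lemma normC_eq x y : abs2 x = abs2 y -> `|x| = `|y|.
Proof. by case: x => a b; case: y => c e H; rewrite !normc_def; congr (Num.sqrt _)%:C%C. Qed.

Lemma expiD (a b : RR) : expi (a + b) = expi a * expi b.
Proof. by apply: CC_eqP; rewrite !CCE ?cosD ?sinD //; ring. Qed.
Lemma expi0 : expi 0 = 1.
Proof. by apply: CC_eqP; rewrite !CCE ?cos0 ?sin0. Qed.
Lemma conj_expi (a : RR) : conjC (expi a) = expi (- a).
Proof. by apply: CC_eqP; rewrite !CCE ?cosN ?sinN. Qed.
Lemma abs2_expi (a : RR) : abs2 (expi a) = 1.
Proof. by rewrite /abs2 !CCE cos2Dsin2. Qed.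
Lemma expi_2pi_int (k : int) : expi (2 * pi * k%:~R) = 1.
Proof.
have H (m : nat) : expi (2 * pi * m%:R) = 1.
  move: (@cos2pi RR) (@sin2pi RR); move: (pi : RR) => p c2 s2.
  elim: m => [|m IH]; first by rewrite mulr0 expi0.
  have -> : 2 * p * m.+1%:R = 2 * p * m%:R + 2 * p by rewrite -natr1; ring.
  rewrite expiD IH mul1r.
  by apply: CC_eqP; rewrite !CCE mulr_natl ?c2 ?s2.
case: k => m; first exact: H.
rewrite NegzE rmorphN /= mulrN -conj_expi H.
by apply: CC_eqP; rewrite !CCE ?oppr0.
Qed.

Section cmeas.
Context (n : nat).
Implicit Types f g : 'cV[RR]_n -> CC.

Lemma cmeas_cst (c : CC) : cmeas (fun _ : 'cV[RR]_n => c).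
Proof. by split; exact: measurable_cst. Qed.

Lemma cmeasD f g : cmeas f -> cmeas g -> cmeas (fun x => f x + g x).
Proof.
move=> [f1 f2] [g1 g2]; split.
  rewrite (_ : _ \o _ = fun x => ReC (f x) + ReC (g x)); last by apply/funext => x; exact: ReCD.
  exact: measurable_funD.
rewrite (_ : _ \o _ = fun x => ImC (f x) + ImC (g x)); last by apply/funext => x; exact: ImCD.
  exact: measurable_funD.
Qed.

Lemma cmeasM f g : cmeas f -> cmeas g -> cmeas (fun x => f x * g x).
Proof.
move=> [f1 f2] [g1 g2]; split.
  rewrite (_ : _ \o _ = fun x => ReC (f x) * ReC (g x) - ImC (f x) * ImC (g x)); last by apply/funext => x; exact: ReCM.
  by apply: measurable_funB; exact: measurable_funM.
rewrite (_ : _ \o _ = fun x => ReC (f x) * ImC (g x) + ImC (f x) * ReC (g x)); last by apply/funext => x; exact: ImCM.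
by apply: measurable_funD; exact: measurable_funM.
Qed.

Lemma cmeasN f : cmeas f -> cmeas (fun x => - f x).
Proof.
move=> mf; rewrite (_ : (fun x => _) = (fun x => (-1) * f x)).
  by apply: cmeasM => //; exact: cmeas_cst.
by apply/funext => x; rewrite mulN1r.
Qed.

Lemma cmeasB f g : cmeas f -> cmeas g -> cmeas (fun x => f x - g x).
Proof. by move=> mf mg; apply: cmeasD => //; exact: cmeasN. Qed.

Lemma cmeas_conj f : cmeas f -> cmeas (fun x => conjC (f x)).
Proof.
move=> [f1 f2]; split; first exact: f1.
exact: (measurableT_comp (@oppr_measurable _ setT) f2).
Qed.

Lemma cmeas_sum I (s : seq I) (F : I -> 'cV[RR]_n -> CC) :
  (forall i, cmeas (F i)) -> cmeas (fun x => \sum_(i <- s) F i x).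
Proof.
move=> mF; elim: s => [|i s IH].
  by under eq_fun do rewrite big_nil; exact: cmeas_cst.
by under eq_fun do rewrite big_cons; exact: cmeasD.
Qed.

Lemma cmeas_comp m (phi : 'cV[RR]_m -> 'cV[RR]_n) f :
  measurable_fun setT phi -> cmeas f -> cmeas (fun x => f (phi x)).
Proof.
move=> mphi [f1 f2]; split.
  exact: (measurableT_comp f1 mphi).
exact: (measurableT_comp f2 mphi).
Qed.

Lemma cmeas_shift f a : cmeas f -> cmeas (fun x => f (x + a)).
Proof. by apply: cmeas_comp; exact: measurable_cV_shift. Qed.

Lemma cmeas_opp f : cmeas f -> cmeas (fun x => f (- x)).
Proof. by apply: cmeas_comp; exact: measurable_cV_opp. Qed.

Lemma cmeas_expi (u : 'cV[RR]_n -> RR) :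
  measurable_fun setT u -> cmeas (fun x => expi (u x)).
Proof.
move=> mu; split.
  apply: (measurableT_comp (f := @cos RR)) mu.
  by apply: continuous_measurable_fun; exact: continuous_cos.
apply: (measurableT_comp (f := @sin RR)) mu.
by apply: continuous_measurable_fun; exact: continuous_sin.
Qed.

Lemma measurable_dotp (w : 'cV[RR]_n) : measurable_fun setT (dotp w).
Proof.
apply: measurable_sum => i; apply: measurable_funM => //.
exact: measurable_coord.
Qed.

Lemma cmeas_char (c : RR) (w : 'cV[RR]_n) : cmeas (fun t => expi (c * dotp w t)).
Proof.
by apply: cmeas_expi; apply: measurable_funM => //; exact: measurable_dotp.
Qed.

Lemma cmeas_Cof (u : 'cV[RR]_n -> RR) :
  measurable_fun setT u -> cmeas (fun x => Cof (u x)).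
Proof. by move=> mu; split => //; exact: measurable_cst. Qed.

Lemma measurable_abs2 f : cmeas f -> measurable_fun setT (fun x => abs2 (f x)).
Proof.
by move=> [f1 f2]; apply: measurable_funD; apply: measurable_funX.
Qed.

Lemma nrm2E f : cmeas f -> nrm2 f = (\int[@leb n]_x (abs2 (f x))%:E)%E.
Proof.
move=> mf; rewrite integral_leb//; first by move=> x; rewrite lee_fin abs2_ge0.
by apply/measurable_EFinP; exact: measurable_abs2.
Qed.

Lemma nrm2_ge0 f : (0 <= nrm2 f)%E.
Proof. by apply: intRd_ge0 => x; rewrite lee_fin abs2_ge0. Qed.

Lemma nrm2_le f g : cmeas f -> cmeas g -> (forall x, abs2 (f x) <= abs2 (g x)) ->
  (nrm2 f <= nrm2 g)%E.
Proof.
move=> mf mg fg; rewrite !nrm2E//; apply: ge0_le_integral => //.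
- by move=> x _; rewrite lee_fin abs2_ge0.
- by apply/measurable_EFinP; exact: measurable_abs2.
- by apply/measurable_EFinP; exact: measurable_abs2.
- by move=> x _; rewrite lee_fin.
Qed.

Lemma nrm2Z (c : CC) f : cmeas f -> nrm2 (fun x => c * f x) = ((abs2 c)%:E * nrm2 f)%E.
Proof.
move=> mf; rewrite !nrm2E//; last by apply: cmeasM => //; exact: cmeas_cst.
under eq_integral do rewrite abs2M EFinM.
rewrite ge0_integralZl_EFin ?abs2_ge0//.
  by move=> x _; rewrite lee_fin abs2_ge0.
by apply/measurable_EFinP; exact: measurable_abs2.
Qed.

Lemma nrm2D f g : cmeas f -> cmeas g ->
  (nrm2 (fun x => f x + g x)%R <= 2%:E * nrm2 f + 2%:E * nrm2 g)%E.
Proof.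
move=> mf mg; rewrite !nrm2E//; last exact: cmeasD.
have M (h : 'cV[RR]_n -> CC) : cmeas h -> measurable_fun setT (fun x => (abs2 (h x))%:E).
  by move=> mh; apply/measurable_EFinP; exact: measurable_abs2.
rewrite -!ge0_integralZl_EFin//; try exact: M.
rewrite -ge0_integralD//; last 4 first.
- by move=> x _; rewrite -EFinM lee_fin mulr_ge0 ?abs2_ge0.
- by apply: measurable_funeM; exact: M.
- by move=> x _; rewrite -EFinM lee_fin mulr_ge0 ?abs2_ge0.
- by apply: measurable_funeM; exact: M.
apply: ge0_le_integral => //.
- by move=> x _; rewrite lee_fin abs2_ge0.
- by apply: (M (fun x => f x + g x)); exact: cmeasD.
- by apply: emeasurable_funD; apply: measurable_funeM; exact: M.
- by move=> x _; rewrite -!EFinM -EFinD lee_fin abs2_le_add.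
- by move=> x _; rewrite lee_fin abs2_ge0.
- by move=> x _; rewrite lee_fin abs2_ge0.
Qed.

Lemma L2P f : L2 f <-> cmeas f /\ (nrm2 f < +oo)%E.
Proof. by split=> -[/borel_funP]. Qed.

Lemma L2_cmeas f : L2 f -> cmeas f. Proof. by case/L2P. Qed.

Lemma L2_nrm2 f : L2 f -> nrm2 f = (fine (nrm2 f))%:E.
Proof. by case/L2P => _ H; rewrite fineK// ge0_fin_numE ?nrm2_ge0. Qed.

Lemma L2_le f g : cmeas f -> L2 g -> (forall x, abs2 (f x) <= abs2 (g x)) -> L2 f.
Proof.
move=> mf /L2P[mg g2] fg; apply/L2P; split => //.
by apply: le_lt_trans g2; exact: nrm2_le.
Qed.

Lemma L2D f g : L2 f -> L2 g -> L2 (fun x => f x + g x).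
Proof.
move=> lf lg; have mf := L2_cmeas lf; have mg := L2_cmeas lg.
apply/L2P; split; first exact: cmeasD.
apply: (le_lt_trans (nrm2D mf mg)).
by rewrite (L2_nrm2 lf) (L2_nrm2 lg) -!EFinM -EFinD ltry.
Qed.

Lemma L2Z c f : L2 f -> L2 (fun x => c * f x).
Proof.
move=> lf; have mf := L2_cmeas lf; apply/L2P; split.
  by apply: cmeasM => //; exact: cmeas_cst.
by rewrite nrm2Z// (L2_nrm2 lf) -EFinM ltry.
Qed.

Lemma L2N f : L2 f -> L2 (fun x => - f x).
Proof.
by move=> lf; under eq_fun do rewrite -mulN1r; exact: L2Z.
Qed.

Lemma L2B f g : L2 f -> L2 g -> L2 (fun x => f x - g x).
Proof. by move=> lf lg; apply: L2D => //; exact: L2N. Qed.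

Lemma L20 : L2 (fun _ : 'cV[RR]_n => 0).
Proof.
apply/L2P; split; first exact: cmeas_cst.
by rewrite /nrm2; under eq_fun do rewrite abs20; rewrite intRd0.
Qed.

Lemma L2_sum I (s : seq I) (F : I -> 'cV[RR]_n -> CC) :
  (forall i, L2 (F i)) -> L2 (fun x => \sum_(i <- s) F i x).
Proof.
move=> lF; elim: s => [|i s IH].
  by under eq_fun do rewrite big_nil; exact: L20.
by under eq_fun do rewrite big_cons; exact: L2D.
Qed.

Lemma L2_conj f : L2 f -> L2 (fun x => conjC (f x)).
Proof.
move=> lf; apply: (@L2_le _ f) => //; first by apply: cmeas_conj; exact: L2_cmeas.
by move=> x; rewrite abs2_conj.
Qed.

Lemma nrm2_shift f a : cmeas f -> nrm2 (fun x => f (x + a)) = nrm2 f.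
Proof.
move=> mf; rewrite !nrm2E//; last exact: cmeas_shift.
apply: (integral_leb_shift a (h := fun x => (abs2 (f x))%:E)).
  by move=> x; rewrite lee_fin abs2_ge0.
by apply/measurable_EFinP; exact: measurable_abs2.
Qed.

Lemma nrm2_opp f : cmeas f -> nrm2 (fun x => f (- x)) = nrm2 f.
Proof.
move=> mf; rewrite !nrm2E//; last exact: cmeas_opp.
apply: (integral_leb_opp (h := fun x => (abs2 (f x))%:E)).
  by move=> x; rewrite lee_fin abs2_ge0.
by apply/measurable_EFinP; exact: measurable_abs2.
Qed.

Lemma L2_shift f a : L2 f -> L2 (fun x => f (x + a)).
Proof.
by move=> /L2P[mf f2]; apply/L2P; split; [exact: cmeas_shift|rewrite nrm2_shift].
Qed.

Lemma L2_opp f : L2 f -> L2 (fun x => f (- x)).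
Proof.
by move=> /L2P[mf f2]; apply/L2P; split; [exact: cmeas_opp|rewrite nrm2_opp].
Qed.

Lemma L2_unimod f g : L2 f -> cmeas g -> (forall x, abs2 (g x) = 1) ->
  L2 (fun x => g x * f x).
Proof.
move=> lf mg g1; apply: (L2_le _ lf).
  by apply: cmeasM => //; exact: L2_cmeas.
by move=> x; rewrite abs2M g1 mul1r.
Qed.

End cmeas.

Section intC.
Context (n : nat).
Implicit Types (u v : 'cV[RR]_n -> RR) (f g : 'cV[RR]_n -> CC).

(** [intR] applies [fine] to both parts and so returns a default value when one of them is infinite;
    integrability excludes that case. *)
Definition rint u := (@leb n).-integrable setT (EFin \o u).
Definition cint f := rint (ReC \o f) /\ rint (ImC \o f).

Lemma rint_meas u : rint u -> measurable_fun setT u.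
Proof. by move=> /integrableP[/measurable_EFinP]. Qed.

Lemma intRE u : rint u -> intR u = (\int[@leb n]_x u x)%R.
Proof.
move=> iu; have mu := rint_meas iu.
rewrite /Rintegral integralE fineB; last 2 first.
- exact: integrable_pos_fin_num.
- exact: integrable_neg_fin_num.
have mu' : measurable_fun setT (EFin \o u) by exact/measurable_EFinP.
rewrite /intR; congr (fine _ - fine _); rewrite integral_leb//.
- by congr intRd; apply/funext => x; rewrite funeposE EFin_max.
- exact: (measurable_funepos mu').
- by congr intRd; apply/funext => x; rewrite funenegE EFin_max.
- exact: (measurable_funeneg mu').
Qed.

Lemma rintD u v : rint u -> rint v -> rint (fun x => u x + v x).
Proof. by move=> iu iv; exact: (integrableD _ iu iv). Qed.

Lemma rintZ c u : rint u -> rint (fun x => c * u x).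
Proof. by move=> iu; exact: (integrableZl _ c iu). Qed.

Lemma rintN u : rint u -> rint (fun x => - u x).
Proof. by move=> iu; under eq_fun do rewrite -mulN1r; exact: rintZ. Qed.

Lemma intRD u v : rint u -> rint v -> intR (fun x => u x + v x) = intR u + intR v.
Proof. by move=> iu iv; rewrite !intRE ?RintegralD//; exact: rintD. Qed.

Lemma intRZ c u : rint u -> intR (fun x => c * u x) = c * intR u.
Proof. by move=> iu; rewrite !intRE ?RintegralZl//; exact: rintZ. Qed.

Lemma intRN u : rint u -> intR (fun x => - u x) = - intR u.
Proof.
move=> iu; under eq_fun do rewrite -mulN1r.
by rewrite intRZ// mulN1r.
Qed.

Lemma intR_le u v : rint u -> rint v -> (forall x, u x <= v x) -> intR u <= intR v.
Proof. by move=> iu iv uv; rewrite !intRE// le_Rintegral. Qed.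

Lemma rint_le u v : measurable_fun setT u -> rint v -> (forall x, `|u x| <= v x) ->
  rint u.
Proof.
move=> mu iv uv; apply: le_integrable iv => //; first exact/measurable_EFinP.
by move=> x _; rewrite /= lee_fin (le_trans (uv x))// ler_norm.
Qed.

Lemma intR_normle u v : rint u -> rint v -> (forall x, `|u x| <= v x) ->
  `|intR u| <= intR v.
Proof.
move=> iu iv uv; rewrite ler_norml -intRN//; apply/andP; split; apply: intR_le => //.
- exact: rintN.
- by move=> x; have := uv x; rewrite ler_norml => /andP[].
- by move=> x; have := uv x; rewrite ler_norml => /andP[].
Qed.

Lemma cint_meas f : cint f -> cmeas f.
Proof. by case=> /rint_meas ? /rint_meas ?; split. Qed.

Lemma cintD f g : cint f -> cint g -> cint (fun x => f x + g x).
Proof.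
move=> [f1 f2] [g1 g2]; split.
  rewrite (_ : _ \o _ = fun x => ReC (f x) + ReC (g x)); first exact: rintD.
  by apply/funext => x; exact: ReCD.
rewrite (_ : _ \o _ = fun x => ImC (f x) + ImC (g x)); first exact: rintD.
by apply/funext => x; exact: ImCD.
Qed.

Lemma cintZ c f : cint f -> cint (fun x => c * f x).
Proof.
move=> [f1 f2]; split.
  rewrite (_ : _ \o _ = fun x => ReC c * ReC (f x) + - ImC c * ImC (f x)).
    by apply: rintD; exact: rintZ.
  by apply/funext => x; rewrite /= ReCM mulNr.
rewrite (_ : _ \o _ = fun x => ReC c * ImC (f x) + ImC c * ReC (f x)).
  by apply: rintD; exact: rintZ.
by apply/funext => x; exact: ImCM.
Qed.

Lemma cint_conj f : cint f -> cint (fun x => conjC (f x)).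
Proof. by move=> [f1 f2]; split => //; exact: rintN. Qed.

Lemma intCD f g : cint f -> cint g ->
  intC (fun x => f x + g x) = intC f + intC g.
Proof.
move=> [f1 f2] [g1 g2]; apply: CC_eqP; rewrite !CCE -intRD//; congr intR;
  by apply/funext => x; rewrite /= CCE.
Qed.

Lemma intCZ c f : cint f -> intC (fun x => c * f x) = c * intC f.
Proof.
move=> [f1 f2]; apply: CC_eqP; rewrite !CCE -!intRZ//.
  rewrite -intRN ?rintZ// -intRD//; [|exact: rintZ|exact/rintN/rintZ].
  by congr intR; apply/funext => x; rewrite /= CCE.
rewrite -intRD//; [|exact: rintZ|exact: rintZ].
by congr intR; apply/funext => x; rewrite /= CCE.
Qed.

Lemma intC_conj f : cint f -> intC (fun x => conjC (f x)) = conjC (intC f).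
Proof. by move=> [f1 f2]; apply: CC_eqP; rewrite !CCE // -intRN. Qed.

Lemma cint0 : cint (fun _ : 'cV[RR]_n => 0).
Proof. by split; exact: integrable0. Qed.

Lemma intC0 : intC (fun _ : 'cV[RR]_n => 0) = 0.
Proof.
transitivity (intC (fun x : 'cV[RR]_n => 0 * (0 : CC))).
  by congr intC; apply/funext => x; rewrite mul0r.
by rewrite (intCZ 0 cint0) mul0r.
Qed.

Lemma cint_sum I (s : seq I) (F : I -> 'cV[RR]_n -> CC) :
  (forall i, cint (F i)) -> cint (fun x => \sum_(i <- s) F i x).
Proof.
move=> iF; elim: s => [|i s IH].
  by under eq_fun do rewrite big_nil; exact: cint0.
by under eq_fun do rewrite big_cons; exact: cintD.
Qed.

Lemma intC_sum I (s : seq I) (F : I -> 'cV[RR]_n -> CC) :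
  (forall i, cint (F i)) ->
  intC (fun x => \sum_(i <- s) F i x) = \sum_(i <- s) intC (F i).
Proof.
move=> iF; elim: s => [|i s IH].
  by under eq_fun do rewrite big_nil; rewrite big_nil intC0.
under eq_fun do rewrite big_cons.
by rewrite intCD// ?IH ?big_cons//; exact: cint_sum.
Qed.

Lemma cint_le f v : cmeas f -> rint v -> (forall x, abs2 (f x) <= v x ^+ 2) ->
  (forall x, 0 <= v x) -> cint f.
Proof.
move=> [m1 m2] iv fv v0.
have H (a b r : RR) : 0 <= r -> a ^+ 2 + b ^+ 2 <= r ^+ 2 -> `|a| <= r.
  move=> r0 ab; rewrite -(@ler_pXn2r _ 2)// real_normK ?num_real//.
  by rewrite (le_trans _ ab)// lerDl sqr_ge0.
split; apply: rint_le iv _ => // x; apply: (H _ _ _ (v0 x) _).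
  exact: (fv x).
by rewrite addrC; exact: (fv x).
Qed.

Lemma rint_abs2 f : L2 f -> rint (fun x => abs2 (f x)).
Proof.
move=> /L2P[mf f2]; apply/integrableP; split.
  by apply/measurable_EFinP; exact: measurable_abs2.
rewrite (_ : (\int[_]_(x in _) _)%E = nrm2 f)// nrm2E//.
by apply: eq_integral => x _; rewrite /= ger0_norm// abs2_ge0.
Qed.

Lemma nrm2_intR f : L2 f -> nrm2 f = (intR (fun x => abs2 (f x)))%:E.
Proof.
move=> lf; rewrite intRE; last exact: rint_abs2.
rewrite (L2_nrm2 lf) nrm2E//; exact: L2_cmeas.
Qed.

(** A weighted arithmetic-geometric inequality. The free weight [r] lets either term be made small,
    which replaces Cauchy-Schwarz in [intC_small]. *)
Lemma abs2M_le (x y : CC) (r : RR) : 0 < r ->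
  abs2 (x * y) <= (r * abs2 x + r^-1 * abs2 y) ^+ 2.
Proof.
move=> r0; rewrite abs2M; have x0 := abs2_ge0 x; have y0 := abs2_ge0 y.
have -> : (r * abs2 x + r^-1 * abs2 y) ^+ 2 =
  (r * abs2 x) ^+ 2 + (r^-1 * abs2 y) ^+ 2 + 2 * (abs2 x * abs2 y).
  by field; rewrite gt_eqF.
have := sqr_ge0 (r * abs2 x); have := sqr_ge0 (r^-1 * abs2 y).
have := mulr_ge0 x0 y0.
by lra.
Qed.

Lemma L2M_cint f g : L2 f -> L2 g -> cint (fun x => f x * g x).
Proof.
move=> lf lg; apply: (cint_le (v := fun x => 1 * abs2 (f x) + 1^-1 * abs2 (g x))).
- by apply: cmeasM; exact: L2_cmeas.
- by apply: rintD; apply: rintZ; exact: rint_abs2.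
- by move=> x; apply: abs2M_le.
- by move=> x; rewrite invr1 !mul1r addr_ge0// abs2_ge0.
Qed.

Lemma intC_opp f : cmeas f -> intC (fun x => f (- x)) = intC f.
Proof.
move=> [f1 f2].
have H u : measurable_fun setT u ->
    intRd (fun x => (Num.max (u (- x)) 0)%:E) = intRd (fun x => (Num.max (u x) 0)%:E).
  move=> mu; have mu' : measurable_fun setT (fun x => (Num.max (u x) 0)%:E).
    by apply/measurable_EFinP; apply: measurable_maxr.
  rewrite -!integral_leb//; first last.
  - exact: (measurableT_comp mu' (@measurable_cV_opp n)).
  - by move=> x; rewrite lee_fin le_max lexx orbT.
  - by move=> x; rewrite lee_fin le_max lexx orbT.
  apply: (integral_leb_opp (h := fun x => (Num.max (u x) 0)%:E)) => //.
  by move=> x; rewrite lee_fin le_max lexx orbT.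
have K u : measurable_fun setT u -> intR (fun x => u (- x)) = intR u.
  move=> mu; rewrite /intR (H u)// (H (fun x => - u x))//.
  exact: (measurableT_comp (@oppr_measurable _ setT) mu).
by rewrite /intC; congr Complex; [apply: (K (ReC \o f))|apply: (K (ImC \o f))].
Qed.

Lemma intC_shift f a : cmeas f -> intC (fun x => f (x + a)) = intC f.
Proof.
move=> [f1 f2].
have H u : measurable_fun setT u ->
    intRd (fun x => (Num.max (u (x + a)) 0)%:E) = intRd (fun x => (Num.max (u x) 0)%:E).
  move=> mu; have mu' : measurable_fun setT (fun x => (Num.max (u x) 0)%:E).
    by apply/measurable_EFinP; apply: measurable_maxr.
  rewrite -!integral_leb//; first last.
  - exact: (measurableT_comp mu' (measurable_cV_shift a)).
  - by move=> x; rewrite lee_fin le_max lexx orbT.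
  - by move=> x; rewrite lee_fin le_max lexx orbT.
  apply: (integral_leb_shift a (h := fun x => (Num.max (u x) 0)%:E)) => //.
  by move=> x; rewrite lee_fin le_max lexx orbT.
have K u : measurable_fun setT u -> intR (fun x => u (x + a)) = intR u.
  move=> mu; rewrite /intR (H u)// (H (fun x => - u x))//.
  exact: (measurableT_comp (@oppr_measurable _ setT) mu).
by rewrite /intC; congr Complex; [apply: (K (ReC \o f))|apply: (K (ImC \o f))].
Qed.

End intC.

(** * Time-frequency shifts and reflection *)

Section cauchy_schwarz.
Context (n : nat).
Implicit Types f g h : 'cV[RR]_n -> CC.

Lemma intC_le f g (r : RR) : L2 f -> L2 g -> 0 < r ->
  `|ReC (intC (fun x => f x * g x))| <= r * fine (nrm2 f) + r^-1 * fine (nrm2 g) /\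
  `|ImC (intC (fun x => f x * g x))| <= r * fine (nrm2 f) + r^-1 * fine (nrm2 g).
Proof.
move=> lf lg r0; rewrite (nrm2_intR lf) (nrm2_intR lg) /=.
have rf := rint_abs2 lf; have rg := rint_abs2 lg.
rewrite -(intRZ _ rf) -(intRZ _ rg) -intRD; [|exact: rintZ|exact: rintZ].
have H (a b m : RR) : 0 <= m -> a ^+ 2 + b ^+ 2 <= m ^+ 2 -> `|a| <= m.
  move=> m0 ab; rewrite -(@ler_pXn2r _ 2)// real_normK ?num_real//.
  by rewrite (le_trans _ ab)// lerDl sqr_ge0.
have P x : 0 <= r * abs2 (f x) + r^-1 * abs2 (g x).
  by rewrite addr_ge0// mulr_ge0 ?abs2_ge0// ltW// invr_gt0.
have [i1 i2] := L2M_cint lf lg.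
split; apply: intR_normle => //; try by apply: rintD; exact: rintZ.
- by move=> x; apply: (H _ _ _ (P x) (abs2M_le _ _ r0)).
- by move=> x; apply: (H _ (ReC (f x * g x)) _ (P x)); rewrite addrC; exact: abs2M_le.
Qed.

Lemma intC_small g (e : RR) : L2 g -> 0 < e -> exists2 del : RR, 0 < del &
  forall f, L2 f -> (nrm2 f < del%:E)%E -> abs2 (intC (fun x => f x * g x)) < e.
Proof.
move=> lg e0; set N := fine (nrm2 g).
have N0 : 0 <= N by rewrite fine_ge0// nrm2_ge0.
(* With both components at most [c], each square is at most [c] times 1, hence at most [e / 3], and
   the two together stay below [e]. *)
pose c := Num.min 1 (e / 3).
have c0 : 0 < c by rewrite lt_min ltr01 divr_gt0.
(* This weight brings the term [r^-1 * N] below [c / 2]; the radius [c / (2 * r)] then does the same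
   for the term with [f]. *)
pose r := 2 * (N + 1) / c.
have r0 : 0 < r by rewrite divr_gt0// mulr_gt0// ltr_pwDr.
exists (c / (2 * r)); first by rewrite divr_gt0// mulr_gt0.
move=> f lf; rewrite (L2_nrm2 lf) lte_fin => fd.
have Hc : r * fine (nrm2 f) + r^-1 * N <= c.
  rewrite [leRHS]splitr lerD//.
    by rewrite mulrC -ler_pdivlMr// -mulrA -invfM ltW.
  have N1 : 0 < N + 1 by rewrite ltr_pwDr.
  have -> : r^-1 * N = c / 2 * (N / (N + 1)).
    by rewrite /r; field; rewrite !gt_eqF.
  by rewrite ler_piMr ?(ltW (divr_gt0 _ _))// ler_pdivrMr// mul1r lerDl.
have [H1 H2] := intC_le lf lg r0.
have K (a : RR) : `|a| <= c -> a ^+ 2 <= e / 3.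
  move=> ac; rewrite -real_normK ?num_real// expr2.
  have ac1 : `|a| <= 1 by rewrite (le_trans ac)// ge_min lexx.
  have ac2 : `|a| <= e / 3 by rewrite (le_trans ac)// ge_min lexx orbT.
  by rewrite (le_trans _ ac2)// ler_piMl.
have := K _ (le_trans H1 Hc); have := K _ (le_trans H2 Hc).
by rewrite /abs2; lra.
Qed.

Lemma intC_nrm20 f g : L2 f -> L2 g -> nrm2 f = 0%E ->
  intC (fun x => f x * g x) = 0.
Proof.
move=> lf lg f0; apply: abs2_eq0; apply: le_anti; rewrite abs2_ge0 andbT.
apply/ler_addgt0Pr => e e0; rewrite add0r.
have [del d0 H] := intC_small lg e0.
by apply/ltW/H => //; rewrite f0 lte_fin.
Qed.

(** The passage from identities of metaplectic operators, valid up to null sets, to values of the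
    STFT at single points. *)
Lemma intC_ae_eq f h g : L2 f -> L2 h -> L2 g -> Defs.ae_eq f h ->
  intC (fun x => f x * g x) = intC (fun x => h x * g x).
Proof.
move=> lf lh lg fh; apply/eqP; rewrite -subr_eq0; apply/eqP.
have := intC_nrm20 (L2B lf lh) lg fh.
rewrite -[- intC _]mulN1r -intCZ; last exact: L2M_cint.
rewrite -intCD; [|exact: L2M_cint|exact/cintZ/L2M_cint].
by move=> <-; congr intC; apply/funext => x; rewrite mulrBl mulN1r.
Qed.

Lemma L2_ae_trans f g h : L2 f -> L2 g -> L2 h ->
  Defs.ae_eq f g -> Defs.ae_eq g h -> Defs.ae_eq f h.
Proof.
move=> lf lg lh fg gh; apply/eqP; rewrite eq_le nrm2_ge0 andbT.
have := nrm2D (L2_cmeas (L2B lf lg)) (L2_cmeas (L2B lg lh)).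
rewrite fg gh !mule0 adde0.
by congr (nrm2 _ <= _)%E; apply/funext => x; rewrite addrA subrK.
Qed.

End cauchy_schwarz.

Section has_sum.
Context (d : nat).

Lemma has_sumL2_intC (c : 'cV[int]_d -> CC) phi f g (e : RR) :
  has_sumL2 c phi f -> (forall k, L2 (phi k)) -> L2 g -> 0 < e ->
  exists s0 : seq 'cV[int]_d, forall s, uniq s -> {subset s0 <= s} ->
    abs2 (intC (fun x => f x * g x) -
          \sum_(k <- s) c k * intC (fun x => phi k x * g x)) < e.
Proof.
move=> [lf Hf] lphi lg e0.
have [del d0 Hd] := intC_small lg e0.
have [s0 Hs] := Hf _ d0; exists s0 => s us ss0.
have lS : L2 (fun t => \sum_(k <- s) c k * phi k t).
  by apply: L2_sum => k; exact: L2Z.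
have := Hd _ (L2B lf lS) (Hs s us ss0); congr (abs2 _ < _).
have -> : (fun x => (f x - \sum_(k <- s) c k * phi k x) * g x) =
  (fun x => f x * g x + (-1) * \sum_(k <- s) c k * (phi k x * g x)).
  apply/funext => x; rewrite mulrBl mulN1r mulr_suml; congr (_ - _).
  by apply: eq_bigr => k _; rewrite mulrA.
have iS : cint (fun x => \sum_(k <- s) c k * (phi k x * g x)).
  by apply: cint_sum => k; apply: cintZ; exact: L2M_cint.
rewrite intCD; [|exact: L2M_cint|exact: cintZ].
rewrite intCZ// mulN1r intC_sum; last by move=> k; apply: cintZ; exact: L2M_cint.
by congr (_ - _); apply: eq_bigr => k _; rewrite intCZ//; exact: L2M_cint.
Qed.

Lemma norm_le_of_abs2 (x : CC) (e : RR) : 0 < e -> abs2 x < e ^+ 2 -> `|x| <= (e%:C)%C.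
Proof.
case: x => a b e0 H; rewrite normc_def lecR -(ger0_norm (ltW e0)) -sqrtr_sqr.
by rewrite ler_wsqrtr// ltW.
Qed.

(* Pairing with [g] is L2-continuous, so [<f, g> = sum c_k B_k] and
   [<fx, g> = sum conj(c_k) B_k]; if [B_k = u * conj B_k] with [u] independent of
   [k], the first sum is [u] times the conjugate of the second. *)
Lemma has_sumL2_norm_eq (c : 'cV[int]_d -> CC) phi f fx g u :
  has_sumL2 c phi f -> has_sumL2 (fun k => conjC (c k)) phi fx ->
  (forall k, L2 (phi k)) -> L2 g -> abs2 u = 1 ->
  (forall k, intC (fun x => phi k x * g x) =
    u * conjC (intC (fun x => phi k x * g x))) ->
  `|intC (fun x => f x * g x)| = `|intC (fun x => fx x * g x)|.
Proof.
move=> hf hfx lphi lg u1 B.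
pose Sm (c : 'cV[int]_d -> CC) s := \sum_(k <- s) c k * intC (fun x => phi k x * g x).
have SE s : `|Sm c s| = `|Sm (fun k => conjC (c k)) s|.
  apply: normC_eq; rewrite -[RHS]abs2_conj -[RHS]mul1r -u1 -abs2M.
  rewrite /Sm conjC_sum mulr_sumr; congr abs2; apply: eq_bigr => k _.
  by rewrite conjCM conjCCK mulrCA -B.
have key (V W : CC) : (forall e, 0 < e -> exists S1 S2 : CC, [/\ `|S1| = `|S2|,
    abs2 (V - S1) < e & abs2 (W - S2) < e]) -> `|V| <= `|W|.
  move=> H; apply/ler_addgt0Pr => e e0.
  (* In the partial order of the complex numbers a positive [e] is real. *)
  have [del eE d0] : exists2 del : RR, e = (del%:C)%C & 0 < del.
    case: e e0 => a b; rewrite ltcE /= => /andP[/eqP b0 a0].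
    by exists a => //; rewrite b0.
  have d2 : 0 < del / 2 by rewrite divr_gt0.
  have [|S1 [S2 [S12 V1 W2]]] := H ((del / 2) ^+ 2); first by rewrite exprn_gt0.
  have h1 := norm_le_of_abs2 d2 V1; have h2 := norm_le_of_abs2 d2 W2.
  have -> : V = (V - S1) + S1 by rewrite subrK.
  apply: (le_trans (ler_normD _ _)); rewrite S12.
  have -> : S2 = W - (W - S2) by rewrite opprB addrC subrK.
  rewrite addrC; apply: (le_trans (lerD (ler_normB _ _) h1)).
  rewrite -addrA lerD2l (le_trans (lerD h2 (lexx _)))// eE -rmorphD /=.
  by rewrite -splitr.
have E e : 0 < e -> exists S1 S2 : CC, [/\ `|S1| = `|S2|,
    abs2 (intC (fun x => f x * g x) - S1) < e & abs2 (intC (fun x => fx x * g x) - S2) < e].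
  move=> e0; have [s1 H1] := has_sumL2_intC hf lphi lg e0.
  have [s2 H2] := has_sumL2_intC hfx lphi lg e0.
  (* Both series are truncated along one common finite set, since [SE] compares partial sums over
     the same indices only. *)
  pose s := undup (s1 ++ s2).
  exists (Sm c s), (Sm (fun k => conjC (c k)) s); split; first exact: SE.
    by apply: H1; rewrite ?undup_uniq// => k ks; rewrite mem_undup mem_cat ks.
  by apply: H2; rewrite ?undup_uniq// => k ks; rewrite mem_undup mem_cat ks orbT.
apply: le_anti; rewrite !key// => e e0.
have [S1 [S2 [S12 h1 h2]]] := E e e0.
by exists S2, S1; split.
Qed.

End has_sum.

Section time_frequency.
Context (d : nat).
Implicit Types (x y a b : 'cV[RR]_d) (g h : 'cV[RR]_d -> CC).

Lemma dotpDr a x y : dotp a (x + y) = dotp a x + dotp a y.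
Proof. by rewrite /dotp -big_split; apply: eq_bigr => i _; rewrite mxE mulrDr. Qed.
Lemma dotpNr a x : dotp a (- x) = - dotp a x.
Proof. by rewrite /dotp -sumrN; apply: eq_bigr => i _; rewrite mxE mulrN. Qed.
Lemma dotpC x y : dotp x y = dotp y x.
Proof. by apply: eq_bigr => i _; rewrite mulrC. Qed.
Lemma dotp0r x : dotp x 0 = 0.
Proof. by rewrite /dotp big1// => i _; rewrite mxE mulr0. Qed.
Lemma dotp_mx x y : dotp x y = (x^T *m y) 0 0.
Proof. by rewrite mxE; apply: eq_bigr => i _; rewrite mxE. Qed.

Lemma L2_rho z h : L2 h -> L2 (rho z h).
Proof.
move=> lh; rewrite /rho; apply: L2_unimod.
- by apply: L2_shift.
- by apply: cmeasM; [exact: cmeas_cst|exact: cmeas_char].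
- by move=> t; rewrite abs2M !abs2_expi mulr1.
Qed.

Lemma ae_eq_rho z g h : L2 g -> L2 h -> Defs.ae_eq g h -> Defs.ae_eq (rho z g) (rho z h).
Proof.
move=> lg lh gh; rewrite /Defs.ae_eq -[RHS]gh.
have lgh := L2B lg lh; have mgh := L2_cmeas lgh.
rewrite -(nrm2_shift (- usubmx z) mgh) nrm2E; last first.
  by apply: L2_cmeas; apply: L2B; exact: L2_rho.
rewrite [RHS]nrm2E; last exact: (cmeas_shift (- usubmx z) mgh).
by apply: eq_integral => t _; rewrite /rho -mulrBr !abs2M !abs2_expi !mul1r.
Qed.

Lemma transl_rho a h : transl a h = rho (col_mx a 0) h.
Proof.
apply/funext => t; rewrite /transl /rho col_mxKu col_mxKd dotp0r mulr0 expi0.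
by rewrite dotpC dotp0r mulr0 expi0 !mul1r.
Qed.

(** The form is [u^T J v] in matrix notation, and [S^T J S = J] cancels [S]. *)
Lemma symplectic_dotp (S : 'M[RR]_(d + d)) (z w : 'cV[RR]_(d + d)) : symplectic S ->
  dotp (dsubmx (S *m z)) (usubmx (S *m w)) - dotp (usubmx (S *m z)) (dsubmx (S *m w)) =
  dotp (dsubmx z) (usubmx w) - dotp (usubmx z) (dsubmx w).
Proof.
have E (u v : 'cV[RR]_(d + d)) : dotp (dsubmx u) (usubmx v) - dotp (usubmx u) (dsubmx v) =
    (u^T *m Jmx d *m v) 0 0.
  rewrite -[in RHS](vsubmxK u) -[in RHS](vsubmxK v) tr_col_mx /Jmx -mulmxA.
  rewrite mul_block_col mul_row_col !mul0mx addr0 add0r mulNmx !mul1mx mulmxN.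
  by rewrite mxE [X in _ = X + _]mxE -!dotp_mx addrC.
move=> sS; rewrite !E; congr (_ 0 0).
have sS' : S^T *m (Jmx d *m (S *m w)) = Jmx d *m w by rewrite -[in RHS]sS !mulmxA.
by rewrite trmx_mul -!mulmxA sS'.
Qed.

Lemma dotp_dual (A : 'M[RR]_d) (k l : 'cV[int]_d) : A \in unitmx ->
  exists m : int, dotp (duallatpt A k) (latpt A l) = m%:~R.
Proof.
move=> uA; exists (\sum_i k i 0 * l i 0).
rewrite dotp_mx /duallatpt /latpt trmx_mul trmxK -mulmxA mulKmx//.
by rewrite mxE rmorph_sum /=; apply: eq_bigr => i _; rewrite !mxE rmorphM.
Qed.

(* The substitution [t -> a + x - t], where [a] is the position part of [z],
   exchanges the two occurrences of [g]; the phase it produces is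
   [expi (- 2 pi <w, x>)] up to the exponential of the symplectic form of [z] and
   [(x, w)], an integer multiple of [2 pi]. *)
Lemma stft_rho_reflect g x w z :
  L2 g -> (exists m : int, dotp w (usubmx z) - dotp x (dsubmx z) = m%:~R) ->
  let B := intC (fun t => rho z (reflect_op g) t *
    (conjC (g (t - x)) * expi (- (2 * pi * dotp w t)))) in
  B = expi (- (2 * pi * dotp w x)) * conjC B.
Proof.
move=> lg [m Em]; set a := usubmx z in Em *; set b := dsubmx z in Em *; cbv zeta.
set P := fun t => _.
have lr : L2 (rho z (reflect_op g)) by apply: L2_rho; exact: L2_opp.
have lG : L2 (fun t => conjC (g (t - x)) * expi (- (2 * pi * dotp w t))).
  under eq_fun do rewrite mulrC.
  apply: L2_unimod; last by move=> t; rewrite abs2_expi.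
    by apply: L2_conj; exact: L2_shift.
  by under eq_fun do rewrite -mulNr; exact: cmeas_char.
have iP : cint P by exact: L2M_cint.
have mP := cint_meas iP.
rewrite -intC_conj// -intCZ; last exact: cint_conj.
rewrite -[LHS](intC_shift (a + x) mP) -intC_opp; last exact: cmeas_shift.
congr intC; apply/funext => t; rewrite /P /rho /reflect_op -/a -/b !conjCM !conj_expi conjCCK.
have -> : - (- t + (a + x) - a) = t - x by apply/matrixP => i j; rewrite !mxE; ring.
have -> : - t + (a + x) - x = - (t - a) by apply/matrixP => i j; rewrite !mxE; ring.
(* Separates the phases from the two values of [g], leaving an identity between exponentials. *)
have gg (c1 c2 c3 c4 c5 c6 : CC) u v : c1 * c2 * c3 = c4 * c5 * c6 ->
   c1 * c2 * u * (v * c3) = c4 * c5 * v * (u * c6).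
  move=> E; rewrite (_ : _ * _ = c1 * c2 * c3 * u * v); last by ring.
  by rewrite E; ring.
rewrite [RHS](_ : _ = (expi (- (2 * pi * dotp w x)) * expi (- (- pi * dotp a b))) *
   expi (- (2 * pi * dotp b t)) * conjC (g (- (t - a))) * (g (t - x) *
   expi (- - (2 * pi * dotp w t)))); last by ring.
apply: gg; rewrite -!expiD.
(* The two phases differ by an integer multiple of [2 pi]; a factor equal to 1 is inserted to absorb
   it. *)
rewrite -[RHS]mul1r -(expi_2pi_int (- m)) -expiD; congr expi.
rewrite rmorphN /= -Em !dotpDr !dotpNr (dotpC b a) (dotpC x b).
by ring.
Qed.

End time_frequency.

(** * Equality of the moduli on the lattice of lines *)

Section equality.
Context (d : nat) (g : 'cV[RR]_d -> CC) (A : 'M[RR]_d)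
  (S : 'M[RR]_(d + d)) (U Uinv : ('cV[RR]_d -> CC) -> ('cV[RR]_d -> CC)).
Hypotheses (lg : L2 g) (uA : A \in unitmx) (sS : symplectic S)
  (mU : metaplectic S U Uinv).

Lemma L2_TSRg k : L2 (TSRg A U Uinv g k).
Proof.
case: mU => mL2 _; apply: (mL2 _ _).1; rewrite transl_rho; apply: L2_rho.
by apply: (mL2 _ _).2; exact: L2_opp.
Qed.

(** A translation is [rho] at a point with zero frequency; conjugation by [U] moves that point by
    [S], and [U] then cancels against [Uinv]. *)
Lemma TSRg_rho k : Defs.ae_eq (TSRg A U Uinv g k)
  (rho (S *m col_mx (latpt A k) 0) (reflect_op g)).
Proof.
case: mU => mL2 [_ [_ [_ [mI mrho]]]].
have lr : L2 (reflect_op g) by exact: L2_opp.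
have li : L2 (Uinv (reflect_op g)) by exact: (mL2 _ lr).2.
rewrite /TSRg transl_rho.
apply: (@L2_ae_trans _ _ (rho (S *m col_mx (latpt A k) 0) (U (Uinv (reflect_op g))))).
- by apply: (mL2 _ _).1; exact: L2_rho.
- by apply: L2_rho; exact: (mL2 _ _).1.
- exact: L2_rho.
- exact: mrho.
- by apply: ae_eq_rho; [exact: (mL2 _ _).1|exact: lr|exact: (mI _ lr).1].
Qed.

Lemma stft_norm_eq c f fx x k :
  has_sumL2 c (TSRg A U Uinv g) f ->
  has_sumL2 (fun k => conjC (c k)) (TSRg A U Uinv g) fx ->
  let z := S *m col_mx x (duallatpt A k) in
  `|STFT g f (usubmx z) (dsubmx z)| = `|STFT g fx (usubmx z) (dsubmx z)|.
Proof.
move=> hf hfx z; set w := dsubmx z; set y := usubmx z.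
(* [G] is the window of the STFT at [z], so that the STFT becomes a pairing with a fixed L2
   function. *)
pose G t := conjC (g (t - y)) * expi (- (2 * pi * dotp w t)).
have lG : L2 G.
  rewrite /G; under eq_fun do rewrite mulrC.
  apply: L2_unimod; last by move=> t; rewrite abs2_expi.
    by apply: L2_conj; exact: L2_shift.
  by under eq_fun do rewrite -mulNr; exact: cmeas_char.
have SE h : STFT g h y w = intC (fun t => h t * G t).
  by congr intC; apply/funext => t; rewrite /G mulrA.
rewrite !SE; apply: (has_sumL2_norm_eq hf hfx L2_TSRg lG (abs2_expi (- (2 * pi * dotp w y)))) => l.
have lR : L2 (rho (S *m col_mx (latpt A l) 0) (reflect_op g)).
  by apply: L2_rho; exact: L2_opp.
rewrite (intC_ae_eq (L2_TSRg l) lR lG (TSRg_rho l)).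
apply: (@stft_rho_reflect d g y w) => //.
have [m Em] := dotp_dual k l uA; exists m.
rewrite symplectic_dotp// !col_mxKu !col_mxKd dotp0r subr0.
exact: Em.
Qed.

End equality.

(** * The fundamental tile of the dual lattice *)

(** Codes of no element contribute 0. Lattice sums become series over the naturals, to which the
    theorems on exchanging sum and integral apply. *)
Lemma esum_pickle (T : countType) (a : T -> \bar RR) : (forall k, 0 <= a k)%E ->
  (\esum_(k in [set: T]) a k = \sum_(n <oo) oapp a 0 (pickle_inv n))%E.
Proof.
move=> a0; set f := fun n => oapp a 0%E (@pickle_inv T n).
have f0 n : (0 <= f n)%E by rewrite /f; case: (pickle_inv n) => //= k.
rewrite (nneseries_esumT f0).
transitivity (\esum_(n in (@pickle T) @` setT) f n)%E.
  rewrite esum_image//.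
  by apply: eq_esum => k _; rewrite /f pickleK_inv.
rewrite [LHS]esum_mkcond; apply: eq_esum => n _.
case: ifPn => // /negP nn; rewrite /f; case E : (pickle_inv n) => [k|//].
exfalso; apply: nn; apply/mem_set; exists k => //.
by have := @pickle_invK T n; rewrite /ocancel E.
Qed.

Lemma esumZl (T : countType) (c : RR) (a : T -> \bar RR) : 0 <= c ->
  (forall k, 0 <= a k)%E ->
  (\esum_(k in [set: T]) (c%:E * a k)%E = c%:E * (\esum_(k in [set: T]) a k))%E.
Proof.
move=> c0 a0; rewrite (esum_pickle a0) (esum_pickle (a := fun k => (c%:E * a k)%E)); last first.
  by move=> k; rewrite mule_ge0// lee_fin.
rewrite -nneseriesZl//; last by move=> n _; case: (pickle_inv n) => //=.
by apply: eq_eseriesr => n _; case: (pickle_inv n) => //=; rewrite mule0.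
Qed.

Section esum_integral.
Context d (X : measurableType d) (mu : {measure set X -> \bar RR}) (T : countType).
Variable F : T -> X -> \bar RR.
Hypotheses (F0 : forall k x, (0 <= F k x)%E) (mF : forall k, measurable_fun setT (F k)).

Let G n x := oapp (F^~ x) 0%E (@pickle_inv T n).
Let G0 n x : (0 <= G n x)%E.
Proof. by rewrite /G; case: (pickle_inv n) => //= k. Qed.
Let mG n : measurable_fun setT (G n).
Proof. by rewrite /G; case: (pickle_inv n) => [k|] /=; [exact: mF|exact: measurable_cst]. Qed.
Let esumE x : (\esum_(k in [set: T]) F k x = \sum_(n <oo) G n x)%E.
Proof. by rewrite (esum_pickle (a := F^~ x)). Qed.

Lemma measurable_esum : measurable_fun setT (fun x => \esum_(k in [set: T]) F k x)%E.
Proof.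
under eq_fun do rewrite esumE.
by apply: ge0_emeasurable_sum => // n.
Qed.

Lemma integral_esum :
  (\int[mu]_x (\esum_(k in [set: T]) F k x) = \esum_(k in [set: T]) \int[mu]_x F k x)%E.
Proof.
under eq_integral do rewrite esumE.
rewrite integral_nneseries//= (esum_pickle (a := fun k => (\int[mu]_x F k x)%E)); last first.
  by move=> k; exact: integral_ge0.
apply: eq_eseriesr => n _; rewrite /G; case: (pickle_inv n) => //=.
by rewrite integral0.
Qed.

End esum_integral.

Lemma esum_delta (T : choiceType) (a : T -> \bar RR) k0 : (0 <= a k0)%E ->
  (forall k, k != k0 -> a k = 0)%E -> (\esum_(k in [set: T]) a k = a k0)%E.
Proof.
move=> a0 H; rewrite -[RHS]esum_set1// [RHS]esum_mkcond; apply: eq_esum => k _.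
case: ifPn => // kk; apply: H; apply: contra kk => /eqP ->.
exact/mem_set.
Qed.

(* The squared norm of a finite combination is determined by the Gram matrix. *)
Lemma nrm2_sum n I (s : seq I) (c : I -> CC) (u : I -> 'cV[RR]_n -> CC) :
  (forall i, L2 (u i)) ->
  nrm2 (fun x => \sum_(i <- s) c i * u i x) =
  (ReC (\sum_(i <- s) \sum_(j <- s)
     (c i * conjC (c j)) * intC (fun x => u i x * conjC (u j x))))%:E.
Proof.
move=> lu.
have lS : L2 (fun x => \sum_(i <- s) c i * u i x) by apply: L2_sum => i; exact: L2Z.
rewrite (nrm2_intR lS); congr (_%:E).
have iij i j : cint (fun x => u i x * conjC (u j x)) by apply: L2M_cint => //; exact: L2_conj.
transitivity (ReC (intC (fun x => \sum_(i <- s) \sum_(j <- s)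
    (c i * conjC (c j)) * (u i x * conjC (u j x))))).
  rewrite !CCE; congr intR; apply/funext => x /=; rewrite abs2E; congr ReC.
  rewrite conjC_sum mulr_suml; apply: eq_bigr => i _; rewrite mulr_sumr.
  by apply: eq_bigr => j _; rewrite conjCM mulrACA.
congr ReC; rewrite intC_sum; last by move=> i; apply: cint_sum => j; exact: cintZ.
apply: eq_bigr => i _; rewrite intC_sum; last by move=> j; exact: cintZ.
by apply: eq_bigr => j _; rewrite intCZ.
Qed.

Lemma rint_indic n (E : set 'cV[RR]_n) : measurable E -> (leb E < +oo)%E ->
  rint (\1_E : 'cV[RR]_n -> RR).
Proof.
move=> mE Efin; apply/integrableP; split.
  by apply/measurable_EFinP; exact: measurable_indic.
under eq_integral do rewrite /= ger0_norm//.
by rewrite integral_indic// setIT.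
Qed.

Lemma intR_indic n (E : set 'cV[RR]_n) : measurable E -> (leb E < +oo)%E ->
  intR (\1_E : 'cV[RR]_n -> RR) = fine (leb E).
Proof.
move=> mE Efin; rewrite (intRE (rint_indic mE Efin)) /Rintegral.
by rewrite integral_indic// setIT.
Qed.

Section tiling.
Context (d : nat) (A : 'M[RR]_d).
Hypothesis uA : A \in unitmx.
Local Notation gam := (duallatpt A).

(** The half-open version of [fundP]: its translates by the dual lattice partition the space
    exactly, without overlaps on faces. *)
Definition tile : set 'cV[RR]_d := [set w | forall i, 0 <= (A^T *m w) i 0 < 1].

Lemma tr_duallatpt k : A^T *m gam k = intvec k.
Proof. by rewrite /duallatpt mulmxA -trmx_mul mulVmx// trmx1 mul1mx. Qed.

Lemma measurable_linear (M : 'M[RR]_d) i :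
  measurable_fun setT (fun w : 'cV[RR]_d => (M *m w) i 0).
Proof.
under eq_fun do rewrite mxE.
by apply: measurable_sum => j; apply: measurable_funM => //; exact: measurable_coord.
Qed.

Lemma measurable_tile : measurable tile.
Proof.
rewrite (_ : tile = \bigcap_(i in [set: 'I_d])
  ((fun w => (A^T *m w) i 0) @^-1` `[0, 1[%classic)); last first.
  apply/seteqP; split=> x /= H i; first by move=> _; rewrite /= in_itv/=; exact: H.
  by have := H i Logic.I; rewrite /= in_itv.
apply: fin_bigcap_measurable => // i _.
by rewrite -[X in measurable X]setTI; apply: measurable_linear.
Qed.

Lemma measurable_tile_shift v :
  measurable_fun setT (fun w : 'cV[RR]_d => (\1_tile (w + v) : RR)%:E).
Proof.
apply/measurable_EFinP.
have mt : measurable_fun setT (\1_tile : 'cV[RR]_d -> RR).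
  by apply: measurable_indic; exact: measurable_tile.
exact: (measurableT_comp mt (measurable_cV_shift v)).
Qed.

Lemma measurable_tile_indic :
  measurable_fun setT (fun w : 'cV[RR]_d => (\1_tile w : RR)%:E).
Proof.
by apply/measurable_EFinP; apply: measurable_indic; exact: measurable_tile.
Qed.

(** In the coordinates [A^T w] the dual lattice is the integer lattice, and the only translation
    into the unit cube subtracts the integer parts. *)
Lemma tile_esum w : (\esum_(k in [set: 'cV[int]_d]) ((\1_tile (w + gam k)%R : RR)%:E) = 1)%E.
Proof.
pose k0 : 'cV[int]_d := \col_i - Num.floor ((A^T *m w) i 0).
have E k i : (A^T *m (w + gam k)) i 0 = (A^T *m w) i 0 + (k i 0)%:~R.
  by rewrite mulmxDr tr_duallatpt !mxE.
rewrite (esum_delta (k0 := k0)) ?lee_fin//.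
  rewrite indicE mem_set//= => i; rewrite E.
  have -> : k0 i 0 = - Num.floor ((A^T *m w) i 0) by rewrite [LHS]mxE.
  have := floor_itv ((A^T *m w) i 0); rewrite rmorphD rmorphN /= => /andP[h1 h2].
  by apply/andP; split; lra.
move=> k kk0; rewrite indicE memNset// => H; move/negP : kk0; apply; apply/eqP.
apply/matrixP => i j; rewrite (ord1 j) [RHS]mxE.
have := H i; rewrite E => /andP[h1 h2].
apply/eqP; rewrite eq_sym eqr_oppLR eq_sym; apply/eqP.
apply/esym/floor_def; rewrite rmorphN /= rmorphD /= rmorphN /=.
by apply/andP; split; lra.
Qed.

(** The partition of unity [tile_esum] is inserted, sum and integral are exchanged, and each term is
    translated back to the tile. *)
Lemma unfold_integral (H : 'cV[RR]_d -> RR) :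
  (forall w, 0 <= H w) -> measurable_fun setT H ->
  (\int[@leb d]_w (H w)%:E =
   \int[@leb d]_w ((\1_tile w)%:E * \esum_(k in [set: 'cV[int]_d]) (H (w - gam k)%R)%:E))%E.
Proof.
move=> H0 mH.
have mI k := measurable_tile_shift (gam k).
have mH' : measurable_fun setT (EFin \o H) by exact/measurable_EFinP.
have mHs k : measurable_fun setT (fun w : 'cV[RR]_d => (H (w - gam k))%:E).
  by apply/measurable_EFinP; exact: (measurableT_comp mH (measurable_cV_shift (- gam k))).
have mt := measurable_tile_indic.
transitivity (\int[@leb d]_w \esum_(k in [set: 'cV[int]_d])
    ((H w)%:E * (\1_tile (w + gam k)%R)%:E))%E.
  apply: eq_integral => w _; rewrite -[LHS]mule1 -(tile_esum w).
  by rewrite esumZl// => k; rewrite lee_fin.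
rewrite integral_esum; last 2 first.
- by move=> k w; rewrite mule_ge0// lee_fin.
- by move=> k; exact: emeasurable_funM.
transitivity (\esum_(k in [set: 'cV[int]_d])
    \int[@leb d]_w ((\1_tile w)%:E * (H (w - gam k)%R)%:E))%E.
  apply: eq_esum => k _.
  apply: etrans (esym (integral_leb_shift (- gam k) (h := fun w => ((H w)%:E * (\1_tile (w + gam k)%R)%:E)%E) _ _)) _.
  - by move=> w; rewrite mule_ge0// lee_fin.
  - exact: emeasurable_funM.
  - by apply: eq_integral => w _; rewrite subrK muleC.
rewrite -integral_esum; last 2 first.
- by move=> k w; rewrite mule_ge0// lee_fin.
- by move=> k; exact: emeasurable_funM.
by apply: eq_integral => w _; rewrite esumZl// => k; rewrite lee_fin.
Qed.

Lemma gamN k : gam (- k) = - gam k.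
Proof.
rewrite /duallatpt -mulmxN; congr (_ *m _); apply/matrixP => i j.
by rewrite !mxE rmorphN.
Qed.

(** A periodic function has the same integral over every translate of a fundamental domain:
    unfolding the shifted tile gives [h] times a sum of indicators equal to 1. *)
Lemma integral_tile_shift (h : 'cV[RR]_d -> RR) v :
  (forall w, 0 <= h w) -> measurable_fun setT h ->
  (forall w k, h (w + gam k) = h w) ->
  (\int[@leb d]_w ((\1_tile w)%:E * (h (w + v)%R)%:E) =
   \int[@leb d]_w ((\1_tile w)%:E * (h w)%:E))%E.
Proof.
move=> h0 mh hp.
have mh' : measurable_fun setT (EFin \o h) by exact/measurable_EFinP.
have mI := measurable_tile_shift (- v).
have mt := measurable_tile_indic.
transitivity (\int[@leb d]_w ((\1_tile (w - v)%R)%:E * (h w)%:E))%E.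
  apply: etrans _ (integral_leb_shift v (h := fun w => ((\1_tile (w - v)%R)%:E * (h w)%:E)%E) _ _).
  - by apply: eq_integral => w _; rewrite addrK.
  - by move=> w; rewrite mule_ge0// lee_fin.
  - exact: emeasurable_funM.
transitivity (\int[@leb d]_w (\1_tile (w - v)%R * h w)%:E)%E.
  by apply: eq_integral => w _; rewrite EFinM.
rewrite unfold_integral; last 2 first.
- by move=> w; rewrite mulr_ge0.
- by apply: measurable_funM => //; exact/measurable_EFinP.
apply: eq_integral => w _; congr (_ * _)%E.
rewrite -[RHS]mule1 -(tile_esum (w - v)) -esumZl//.
rewrite (reindex_esum [set: 'cV[int]_d] [set: 'cV[int]_d] -%R)/=.
- by apply: eq_esum => k _; rewrite gamN opprK hp EFinM muleC addrAC.
- by split => // [x y _ _ /oppr_inj//|k _]; exists (- k) => //; rewrite opprK.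
Qed.


Lemma tile_sub_fundP w : tile w -> fundP A w.
Proof.
move=> tw; exists (A^T *m w); split; first by move=> i; have /andP[-> /ltW ->] := tw i.
by rewrite mulmxA -trmx_mul mulmxV// trmx1 mul1mx.
Qed.

Lemma leb_tile_fin : (leb tile < +oo)%E.
Proof.
(* [N] exceeds every row sum of absolute values of [A^-T], hence every coordinate of a point of the
   tile. *)
pose N : RR := \sum_i \sum_j (`|(invmx A)^T i j| + 1) + 1.
have N0 : 0 <= N by rewrite addr_ge0// sumr_ge0// => i _; rewrite sumr_ge0// => j _; rewrite addr_ge0.
apply: (@le_lt_trans _ _ (leb (@cube d N))); last first.
  by rewrite leb_box ?ltry// => i; rewrite (@le_trans _ _ 0)// oppr_le0.
apply: le_measure; rewrite ?inE; [exact: measurable_tile|exact: measurable_box|].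
move=> w tw i.
have E : w i 0 = \sum_j (invmx A)^T i j * (A^T *m w) j 0.
  have -> : \sum_j (invmx A)^T i j * (A^T *m w) j 0 = ((invmx A)^T *m (A^T *m w)) i 0.
    by rewrite [RHS]mxE.
  by rewrite mulmxA -trmx_mul mulmxV// trmx1 mul1mx.
have B : `|w i 0| < N.
  rewrite E; apply: (le_lt_trans (ler_norm_sum _ _ _)).
  rewrite /N ltr_pwDr// [leRHS](bigD1 i)//= -[leLHS]addr0 lerD//; last first.
    by rewrite sumr_ge0// => k _; rewrite sumr_ge0// => j _; rewrite addr_ge0.
  apply: ler_sum => j _; rewrite normrM.
  have /andP[h0 h1] := tw j; rewrite (ger0_norm h0).
  by rewrite (@le_trans _ _ `|(invmx A)^T i j|)// ?lerDl// ler_piMr// ltW.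
by move: B; rewrite ltr_norml => /andP[h1 h2]; apply/andP; split => //; exact: ltW.
Qed.

Definition tileC (w : 'cV[RR]_d) : CC := Cof (\1_tile w).

Lemma L2_tileC : L2 tileC.
Proof.
apply/L2P; split.
  by apply: cmeas_Cof; apply: measurable_indic; exact: measurable_tile.
rewrite (_ : nrm2 tileC = leb tile) ?leb_tile_fin//.
rewrite /leb /nrm2; congr intRd; apply/funext => w; rewrite /abs2 /tileC /Cof !CCE.
by rewrite expr0n addr0 indicE; case: (_ \in _); rewrite ?expr0n ?expr1n.
Qed.

(* Translating by [v] changes the sign of [cos (2 pi <A m, w> + th)] and does not
   change integrals of periodic functions over the tile; this proves orthogonality
   of the characters without a linear change of variables in R^d. *)
Lemma half_period (m : 'cV[int]_d) : m != 0 ->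
  exists v : 'cV[RR]_d, dotp (latpt A m) v = 2^-1.
Proof.
move=> m0; have [i mi] : exists i, m i 0 != 0.
  apply: contrapT => H; move/negP : m0; apply; apply/eqP/matrixP => i j.
  by rewrite (ord1 j) mxE; apply/eqP/negPn/negP => mi; apply: H; exists i.
pose e : 'cV[RR]_d := \col_j ((j == i)%:R / (2 * (m i 0)%:~R)).
exists ((invmx A)^T *m e).
rewrite dotp_mx /latpt trmx_mul -mulmxA (mulmxA A^T) -trmx_mul mulVmx// trmx1 mul1mx.
rewrite mxE (bigD1 i)//= big1 ?addr0; last first.
  by move=> j ji; rewrite !mxE (negbTE ji) mul0r mulr0.
have -> : (intvec m)^T 0 i = (m i 0)%:~R by rewrite !mxE.
have -> : e i 0 = 1 / (2 * (m i 0)%:~R) by rewrite mxE eqxx.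
have mR : (m i 0)%:~R != 0 :> RR by rewrite intr_eq0.
by field.
Qed.

Lemma tile_cos0 (m : 'cV[int]_d) th : m != 0 ->
  intR (fun w => \1_tile w * cos (2 * pi * dotp (latpt A m) w + th)) = 0.
Proof.
move=> m0; have [v Ev] := half_period m0.
pose u w : RR := cos (2 * pi * dotp (latpt A m) w + th).
rewrite -/(intR (fun w => \1_tile w * u w)).
have mu : measurable_fun setT u.
  apply: (measurableT_comp (f := @cos RR)); first by apply: continuous_measurable_fun; exact: continuous_cos.
  by apply: measurable_funD => //; apply: measurable_funM => //; exact: measurable_dotp.
have mt : measurable_fun setT (\1_tile : 'cV[RR]_d -> RR).
  by apply: measurable_indic; exact: measurable_tile.
have it : rint (\1_tile : 'cV[RR]_d -> RR).
  by apply: rint_indic; [exact: measurable_tile|exact: leb_tile_fin].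
have iu : rint (fun w => \1_tile w * u w).
  apply: (rint_le _ it); first exact: measurable_funM.
  by move=> w; rewrite normrM (ger0_norm (_ : 0 <= \1_tile w))// ler_piMr// cos_max.
have up w : u (w + v) = - u w.
  rewrite /u dotpDr Ev.
  have -> : 2 * pi * (dotp (latpt A m) w + 2^-1) + th =
    (2 * pi * dotp (latpt A m) w + th) + pi :> RR by move: (pi : RR) => p; field.
  exact: cosDpi.
have uper w k : u (w + gam k) = u w.
  have [j Ej] := dotp_dual k m uA.
  have E : expi (2 * pi * dotp (latpt A m) (w + gam k) + th) =
      expi (2 * pi * dotp (latpt A m) w + th).
    rewrite dotpDr (dotpC _ (gam k)) Ej -[RHS]mulr1 -(expi_2pi_int j) -expiD.
    by congr expi; move: (pi : RR) => p; ring.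
  by move/(congr1 ReC) : E.
(* [integral_tile_shift] concerns nonnegative functions, so it is applied to [1 + u]. The shift by
   [v] turns this into [1 - u]; equal integrals force that of [u] to vanish. *)
have h0 w : 0 <= 1 + u w by rewrite -lerBlDl sub0r cos_geN1.
have mh : measurable_fun setT (fun w => 1 + u w) by apply: measurable_funD.
have E := integral_tile_shift v h0 mh (fun w k => congr1 (+%R 1) (uper w k)).
have K (h : 'cV[RR]_d -> RR) : rint (fun w => \1_tile w * h w) ->
    (\int[@leb d]_w ((\1_tile w)%:E * (h w)%:E) = (intR (fun w => \1_tile w * h w))%:E)%E.
  move=> ih; rewrite (intRE ih) /Rintegral fineK; last exact: integrable_fin_num.
  by apply: eq_integral => w _.
have D (c : RR) : (fun w => \1_tile w * (1 + c * u w)) =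
    (fun w => \1_tile w + c * (\1_tile w * u w)).
  by apply/funext => w; rewrite mulrDr mulr1 mulrCA.
have I (c : RR) : rint (fun w => \1_tile w * (1 + c * u w)).
  by rewrite D; apply: rintD => //; exact: rintZ.
have V (c : RR) : intR (fun w => \1_tile w * (1 + c * u w)) =
    intR (\1_tile : 'cV[RR]_d -> RR) + c * intR (fun w => \1_tile w * u w).
  by rewrite D intRD ?intRZ//; exact: rintZ.
have E1 : intR (fun w => \1_tile w * (1 + (-1) * u w)) = intR (fun w => \1_tile w * (1 + 1 * u w)).
  apply: EFin_inj; rewrite -(K _ (I (-1))) -(K _ (I 1)).
  under [RHS]eq_integral do rewrite mul1r.
  rewrite -[RHS]E; apply: eq_integral => w _.
  by rewrite up mulN1r.
by move: E1; rewrite !V; lra.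
Qed.

Lemma tile_orthogonal (k l : 'cV[int]_d) :
  intC (fun w => (tileC w * expi (- (2 * pi * dotp (latpt A k) w))) *
     conjC (tileC w * expi (- (2 * pi * dotp (latpt A l) w)))) =
  if k == l then Cof (fine (leb tile)) else 0.
Proof.
have latB : latpt A (l - k) = latpt A l - latpt A k.
  by rewrite /latpt -mulmxBr; congr (_ *m _); apply/matrixP => i j; rewrite !mxE rmorphB.
(* The sine is written as a cosine with phase [- (pi / 2)], so that [tile_cos0] covers both
   components. *)
have E : (fun w => (tileC w * expi (- (2 * pi * dotp (latpt A k) w))) *
     conjC (tileC w * expi (- (2 * pi * dotp (latpt A l) w)))) =
   fun w => Complex (\1_tile w * cos (2 * pi * dotp (latpt A (l - k)) w + 0))
      (\1_tile w * cos (2 * pi * dotp (latpt A (l - k)) w + (- (pi / 2)))).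
  apply/funext => w.
  have -> : tileC w * expi (- (2 * pi * dotp (latpt A k) w)) *
    conjC (tileC w * expi (- (2 * pi * dotp (latpt A l) w))) =
    tileC w * expi (2 * pi * dotp (latpt A (l - k)) w).
    rewrite conjCM conj_expi opprK mulrACA -expiD latB; congr (_ * expi _).
      apply: CC_eqP; rewrite /tileC /Cof !CCE; last by ring.
      by rewrite indicE; case: (_ \in _); rewrite ?oppr0 ?mulr0 ?mul0r ?mulr1 ?subr0.
    by rewrite (dotpC _ w) (dotpC (latpt A l - _)) dotpDr dotpNr !(dotpC w); ring.
  apply: CC_eqP; rewrite /tileC /Cof !CCE ?mul0r ?addr0 ?subr0//.
  by rewrite cosBpihalf.
rewrite E; have [->|kl] := eqVneq k l; last first.
  have lk0 : l - k != 0 by rewrite subr_eq0 eq_sym.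
  by apply: CC_eqP; [exact: (tile_cos0 0 lk0)|exact: (tile_cos0 (- (pi / 2)) lk0)].
have it : rint (\1_tile : 'cV[RR]_d -> RR).
  by apply: rint_indic; [exact: measurable_tile|exact: leb_tile_fin].
apply: CC_eqP; rewrite /intC !CCE.
  rewrite (_ : _ \o _ = (\1_tile : 'cV[RR]_d -> RR)).
    by rewrite intR_indic//; [exact: measurable_tile|exact: leb_tile_fin].
  apply/funext => w /=; rewrite CCE subrr (_ : latpt A 0 = 0) ?(dotpC 0) ?dotp0r ?mulr0 ?addr0 ?cos0 ?mulr1//.
  by rewrite /latpt (_ : intvec 0 = 0) ?mulmx0//; apply/matrixP => i j; rewrite !mxE.
rewrite (_ : _ \o _ = (fun _ => 0)).
  by have := @intC0 d => /(congr1 ReC).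
apply/funext => w /=; rewrite CCE subrr (_ : latpt A 0 = 0).
  by rewrite (dotpC 0) dotp0r mulr0 add0r cosN cos_pihalf mulr0.
by rewrite /latpt (_ : intvec 0 = 0) ?mulmx0//; apply/matrixP => i j; rewrite !mxE.
Qed.

End tiling.

(** * Trigonometric sums against a bounded periodization *)

Section periodized_bound.
Context (d : nat) (A : 'M[RR]_d) (Phi : 'cV[RR]_d -> CC).
Hypotheses (uA : A \in unitmx) (lPhi : L2 Phi)
  (bP : ess_bdd_on (fundP A) (periodization A Phi)).
Local Notation gam := (duallatpt A).

(** The factor by which the Fourier transform of [phi] is multiplied when [phi] is replaced by its
    combination of lattice translates. *)
Definition trig (s : seq 'cV[int]_d) (c : 'cV[int]_d -> CC) (w : 'cV[RR]_d) : CC :=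
  \sum_(k <- s) c k * expi (- (2 * pi * dotp (latpt A k) w)).

Lemma cmeas_trig s c : cmeas (trig s c).
Proof.
apply: cmeas_sum => k; apply: cmeasM; first exact: cmeas_cst.
by under eq_fun do rewrite -mulNr; exact: cmeas_char.
Qed.

Lemma trig_periodic s c w k : trig s c (w - gam k) = trig s c w.
Proof.
apply: eq_bigr => l _; congr (_ * _).
have [j Ej] := dotp_dual k l uA.
rewrite dotpDr dotpNr (dotpC _ (gam k)) Ej -[RHS]mulr1 -(expi_2pi_int j) -expiD.
by congr expi; move: (pi : RR) => p; ring.
Qed.

Lemma measurable_fundP : measurable (fundP A).
Proof.
rewrite (_ : fundP A = \bigcap_(i in [set: 'I_d])
  ((fun w => (A^T *m w) i 0) @^-1` `[0, 1]%classic)); last first.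
  apply/seteqP; split=> [x [u [u01 ->]] i _|x H].
    by rewrite /= in_itv/= mulmxA -trmx_mul mulVmx// trmx1 mul1mx; exact: u01.
  exists (A^T *m x); split; first by move=> i; have := H i Logic.I; rewrite /= in_itv.
  by rewrite mulmxA -trmx_mul mulmxV// trmx1 mul1mx.
apply: fin_bigcap_measurable => // i _.
by rewrite -[X in measurable X]setTI; apply: measurable_linear.
Qed.

Lemma measurable_periodization : measurable_fun setT (periodization A Phi).
Proof.
have mPhi := L2_cmeas lPhi.
apply: measurable_esum => k; first by move=> x; rewrite lee_fin abs2_ge0.
by apply/measurable_EFinP; apply: measurable_abs2; exact: cmeas_shift.
Qed.

Lemma periodization_ge0 w : (0 <= periodization A Phi w)%E.
Proof. by apply: esum_ge0 => k _; rewrite lee_fin abs2_ge0. Qed.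

Lemma periodization_opp w :
  (\esum_(k in [set: 'cV[int]_d]) (abs2 (Phi (w - gam k)))%:E)%E = periodization A Phi w.
Proof.
rewrite (reindex_esum [set: 'cV[int]_d] [set: 'cV[int]_d] -%R)/=.
- by apply: eq_esum => k _; rewrite gamN opprK.
- by split => // [x y _ _ /oppr_inj//|k _]; exists (- k) => //; rewrite opprK.
Qed.

Lemma trig_bound : exists2 C : RR, 0 <= C & forall s c, uniq s ->
  (nrm2 (fun w => trig s c w * Phi w)%R <= (C * \sum_(k <- s) abs2 (c k))%:E)%E.
Proof.
(* The essential bound [M0] may be negative; its maximum with 0 gives a constant that can multiply
   inequalities. *)
have [M0 nM] := bP; set M := Num.max M0 0.
have mPhi := L2_cmeas lPhi; have mp := measurable_periodization.
have mN : measurable [set w | fundP A w /\ (M0%:E < periodization A Phi w)%E].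
  apply: measurableI; first exact: measurable_fundP.
  rewrite -[X in measurable X]setTI.
  have := emeasurable_fun_o_infty measurableT mp => /(_ M0%:E).
  by congr (measurable (_ `&` _)); apply/seteqP; split => w /=; rewrite in_itv/= andbT.
exists (M * fine (leb (tile A))); first by rewrite mulr_ge0 ?fine_ge0 ?leb_ge0// le_max lexx orbT.
move=> s c us.
have mt : measurable_fun setT (\1_(tile A) : 'cV[RR]_d -> RR).
  by apply: measurable_indic; exact: measurable_tile.
have mtr := measurable_abs2 (cmeas_trig s c).
have H0 w : 0 <= abs2 (trig s c w * Phi w) by exact: abs2_ge0.
have mH : measurable_fun setT (fun w => abs2 (trig s c w * Phi w)).
  by apply: measurable_abs2; apply: cmeasM => //; exact: cmeas_trig.
rewrite nrm2E; last by apply: cmeasM => //; exact: cmeas_trig.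
rewrite (unfold_integral uA H0 mH).
have E w : (\esum_(k in [set: 'cV[int]_d]) (abs2 (trig s c (w - gam k) * Phi (w - gam k)))%:E)%E =
    ((abs2 (trig s c w))%:E * periodization A Phi w)%E.
  rewrite -periodization_opp -esumZl ?abs2_ge0//; last by move=> k; rewrite lee_fin abs2_ge0.
  by apply: eq_esum => k _; rewrite trig_periodic abs2M EFinM.
under eq_integral do rewrite E.
pose u k (w : 'cV[RR]_d) := tileC A w * expi (- (2 * pi * dotp (latpt A k) w)).
have lu k : L2 (u k).
  rewrite /u; under eq_fun do rewrite mulrC.
  apply: L2_unimod; first exact: L2_tileC.
    by under eq_fun do rewrite -mulNr; exact: cmeas_char.
  by move=> w; exact: abs2_expi.
have abs2t w : abs2 (tileC A w) = \1_(tile A) w.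
  by rewrite /tileC /Cof /abs2 !CCE expr0n addr0 indicE; case: (_ \in _); rewrite ?expr0n ?expr1n.
apply: (@le_trans _ _ (\int[@leb d]_w (M%:E * (abs2 (\sum_(k <- s) c k * u k w))%:E))%E).
  have su w : \sum_(k <- s) c k * u k w = tileC A w * trig s c w.
    by rewrite /trig mulr_sumr; apply: eq_bigr => k _; rewrite mulrCA.
  apply: ae_ge0_le_integral => //.
  - by move=> w _; rewrite !mule_ge0 ?lee_fin ?abs2_ge0// periodization_ge0.
  - apply: emeasurable_funM; first exact/measurable_EFinP.
    by apply: emeasurable_funM => //; exact/measurable_EFinP.
  - by move=> w _; rewrite mule_ge0 ?lee_fin ?abs2_ge0// le_max lexx orbT.
  - apply: measurable_funeM; apply/measurable_EFinP.
    by apply: measurable_abs2; apply: cmeas_sum => k; apply: cmeasM; [exact: cmeas_cst|exact: L2_cmeas].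
  (* The null set is the one supplied by [ess_bdd_on]. A point where the inequality fails lies in
     the tile, since the left side is 0 elsewhere, and the periodization exceeds [M0] there. *)
  exists [set w | fundP A w /\ (M0%:E < periodization A Phi w)%E]; split => //.
  move=> w /= /not_implyP[_ /negP]; rewrite -ltNge => lt1.
  have tw : tile A w.
    apply: contrapT => ntw; move: lt1.
    by rewrite indicE memNset// mul0e ltNge mule_ge0// ?lee_fin ?abs2_ge0// le_max lexx orbT.
  split; first exact: tile_sub_fundP.
  rewrite ltNge; apply/negP => pM; move: lt1; rewrite ltNge => /negP; apply.
  rewrite su abs2M abs2t indicE mem_set// mul1e mul1r muleC.
  rewrite lee_pmul ?periodization_ge0 ?lee_fin ?abs2_ge0//.
  by rewrite (le_trans pM)// lee_fin le_max lexx.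
rewrite ge0_integralZl_EFin//; last 3 first.
- by move=> w _; rewrite lee_fin abs2_ge0.
- apply/measurable_EFinP.
  by apply: measurable_abs2; apply: cmeas_sum => k; apply: cmeasM; [exact: cmeas_cst|exact: L2_cmeas].
- by rewrite le_max lexx orbT.
rewrite -nrm2E; last by apply: cmeas_sum => k; apply: cmeasM; [exact: cmeas_cst|exact: L2_cmeas].
rewrite nrm2_sum// -EFinM lee_fin -mulrA ler_wpM2l//; first by rewrite le_max lexx orbT.
rewrite ReC_sum mulr_sumr big_seq [leRHS]big_seq; apply: ler_sum => k ks.
rewrite (bigD1_seq k)//= big1 ?addr0; last first.
  by move=> l lk; rewrite tile_orthogonal// eq_sym (negbTE lk) mulr0.
rewrite tile_orthogonal// eqxx /Cof ReCM ReCE ImCE mulr0 subr0 -abs2E.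
by rewrite mulrC.
Qed.

End periodized_bound.

(** Lower semicontinuity of the norm under pointwise convergence of the squared moduli; the index
    [N] allows for bounds that hold only eventually. *)
Lemma nrm2_fatou n (u : nat -> 'cV[RR]_n -> CC) (f : 'cV[RR]_n -> CC) (B : RR) N :
  (forall m, cmeas (u m)) -> cmeas f ->
  (forall x, (fun m => abs2 (u m x)) @ \oo --> abs2 (f x)) ->
  (forall m, (N <= m)%N -> (nrm2 (u m) <= B%:E)%E) -> (nrm2 f <= B%:E)%E.
Proof.
move=> mu mf uf uB; rewrite nrm2E//.
pose v m x := (abs2 (u (m + N)%N x))%:E.
have v0 m x : setT x -> (0 <= v m x)%E by move=> _; rewrite lee_fin abs2_ge0.
have mv m : measurable_fun setT (v m).
  by apply/measurable_EFinP; exact: measurable_abs2.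
have := fatou (@leb n) measurableT mv v0.
have -> : (\int[@leb n]_x limn_einf (v ^~ x) = \int[@leb n]_x (abs2 (f x))%:E)%E.
  apply: eq_integral => x _.
  have vx : v ^~ x @ \oo --> (abs2 (f x))%:E.
    apply: cvg_EFin; first by near=> m.
    have := uf x; rewrite -(cvg_shiftn N); exact.
  by have [-> _] := cvg_limn_einf_sup vx.
move=> /le_trans; apply.
rewrite limn_einf_lim; apply: lime_le; first exact: is_cvg_einfs.
near=> m; apply: (@le_trans _ _ (\int[@leb n]_x v m x)%E).
  by apply: ereal_inf_lbound; exists m => /=.
by rewrite -nrm2E//; apply: uB; rewrite leq_addl.
Unshelve. all: by end_near. Qed.

(** * Measurability and the translation rule of the Fourier integral *)

Section fourier.
Context (n : nat).
Implicit Types h : 'cV[RR]_n -> CC.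

(** Each component is a difference of two integrals with parameter [w] of jointly measurable
    nonnegative functions, so [measurable_intRd] applies. *)
Lemma cmeas_fourierL1 h : cmeas h -> cmeas (fourierL1 h).
Proof.
move=> [h1 h2].
have mdot : measurable_fun setT (fun p : 'cV[RR]_n * 'cV[RR]_n => dotp p.1 p.2).
  apply: measurable_sum => i; apply: measurable_funM.
    exact: (measurableT_comp (measurable_coord i) measurable_fst).
  exact: (measurableT_comp (measurable_coord i) measurable_snd).
have mph : measurable_fun setT (fun p : 'cV[RR]_n * 'cV[RR]_n => - (2 * pi * dotp p.1 p.2)).
  by apply: measurableT_comp => //; exact: measurable_funM.
have mcos : measurable_fun setT (fun p : 'cV[RR]_n * 'cV[RR]_n => cos (- (2 * pi * dotp p.1 p.2))).
  by apply: (measurableT_comp (f := @cos RR)) mph; apply: continuous_measurable_fun; exact: continuous_cos.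
have msin : measurable_fun setT (fun p : 'cV[RR]_n * 'cV[RR]_n => sin (- (2 * pi * dotp p.1 p.2))).
  by apply: (measurableT_comp (f := @sin RR)) mph; apply: continuous_measurable_fun; exact: continuous_sin.
have K (u : 'cV[RR]_n * 'cV[RR]_n -> RR) : measurable_fun setT u ->
    measurable_fun setT (fun w => intR (fun t => u (w, t))).
  move=> mu.
  have P (v : 'cV[RR]_n * 'cV[RR]_n -> RR) : measurable_fun setT v ->
      measurable_fun setT (fun w => fine (intRd (fun t => (Num.max (v (w, t)) 0)%:E))).
    move=> mv; apply: (measurableT_comp (f := fine)) => //.
    apply: (measurable_intRd (h := fun p => (Num.max (v p) 0)%:E)).
      by move=> z; rewrite lee_fin le_max lexx orbT.
    by apply/measurable_EFinP; exact: measurable_maxr.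
  apply: measurable_funB; first exact: P.
  by apply: (P (fun p => - u p)); exact: measurableT_comp.
split.
  rewrite (_ : _ \o _ = fun w => intR (fun t => ReC (h t) * cos (- (2 * pi * dotp w t)) -
      ImC (h t) * sin (- (2 * pi * dotp w t)))); last first.
    by apply/funext => w; congr intR; apply/funext => t; rewrite /= CCE.
  apply: (K (fun p => ReC (h p.2) * cos (- (2 * pi * dotp p.1 p.2)) -
      ImC (h p.2) * sin (- (2 * pi * dotp p.1 p.2)))).
  by apply: measurable_funB; apply: measurable_funM => //;
    [exact: (measurableT_comp h1 measurable_snd)|exact: (measurableT_comp h2 measurable_snd)].
rewrite (_ : _ \o _ = fun w => intR (fun t => ReC (h t) * sin (- (2 * pi * dotp w t)) +
    ImC (h t) * cos (- (2 * pi * dotp w t)))); last first.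
  by apply/funext => w; congr intR; apply/funext => t; rewrite /= CCE.
apply: (K (fun p => ReC (h p.2) * sin (- (2 * pi * dotp p.1 p.2)) +
    ImC (h p.2) * cos (- (2 * pi * dotp p.1 p.2)))).
by apply: measurable_funD; apply: measurable_funM => //;
  [exact: (measurableT_comp h1 measurable_snd)|exact: (measurableT_comp h2 measurable_snd)].
Qed.

Lemma cint_unimod h g : cint h -> cmeas g -> (forall x, abs2 (g x) = 1) ->
  cint (fun x => h x * g x).
Proof.
move=> [h1 h2] mg g1.
have mh : cmeas h by exact: cint_meas.
apply: (cint_le (v := fun x => `|ReC (h x)| + `|ImC (h x)|)).
- exact: cmeasM.
- apply: rintD; [exact: (integrable_abse h1)|exact: (integrable_abse h2)].
- move=> x; rewrite abs2M g1 mulr1 /abs2.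
  rewrite -(real_normK (num_real (ReC (h x)))) -(real_normK (num_real (ImC (h x)))).
  have := normr_ge0 (ReC (h x)); have := normr_ge0 (ImC (h x)).
  by move: `|_| `|_| => a b a0 b0; rewrite !expr2; nra.
- by move=> x; rewrite addr_ge0.
Qed.

Lemma cmeas_fourier_char (w : 'cV[RR]_n) : cmeas (fun t => expi (- (2 * pi * dotp w t))).
Proof. by under eq_fun do rewrite -mulNr; exact: cmeas_char. Qed.

Lemma fourierL1_translates I (s : seq I) (c : I -> CC) (a : I -> 'cV[RR]_n) h w :
  cint h ->
  fourierL1 (fun t => \sum_(k <- s) c k * h (t - a k)) w =
  (\sum_(k <- s) c k * expi (- (2 * pi * dotp (a k) w))) * fourierL1 h w.
Proof.
move=> ih.
have mh := cint_meas ih.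
pose H t := h t * expi (- (2 * pi * dotp w t)).
have iH : cint H.
  by apply: cint_unimod => //; [exact: cmeas_fourier_char|move=> x; exact: abs2_expi].
have iHs k : cint (fun t => H (t - a k)).
  have [H1 H2] := iH; have mH := cint_meas iH; have [m1 m2] := cmeas_shift (- a k) mH.
  have P (u : 'cV[RR]_n -> RR) : rint u -> measurable_fun setT (fun t : 'cV[RR]_n => u (t - a k)) ->
      rint (fun t : 'cV[RR]_n => u (t - a k)).
    move=> /integrableP[mu iu] mus; apply/integrableP; split; first exact/measurable_EFinP.
    apply: le_lt_trans iu.
    rewrite -(integral_leb_shift (- a k) (h := fun t : 'cV[RR]_n => `|(EFin \o u) t|%E))//.
    exact: measurableT_comp.
  by split; [exact: (P (ReC \o H))|exact: (P (ImC \o H))].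
rewrite /fourierL1 mulr_suml.
transitivity (intC (fun t => \sum_(k <- s)
   (c k * expi (- (2 * pi * dotp (a k) w))) * H (t - a k))).
  congr intC; apply/funext => t; rewrite mulr_suml; apply: eq_bigr => k _.
  rewrite /H -!mulrA; congr (_ * _); rewrite [RHS]mulrCA; congr (_ * _).
  rewrite -expiD; congr expi; rewrite dotpDr dotpNr (dotpC (a k)).
  by move: (pi : RR) => p; ring.
rewrite intC_sum; last by move=> k; exact: cintZ.
apply: eq_bigr => k _; rewrite intCZ//; congr (_ * _).
exact: (intC_shift (- a k) (cint_meas iH)).
Qed.

End fourier.

(** * Completeness of L2 *)

Lemma geometric_lt (R : realType) (a z e : R) : 0 <= z < 1 -> 0 < e ->
  exists n, a * z ^+ n < e.
Proof.
move=> /andP[z0 z1] e0.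
have : geometric a z @ \oo --> (0 : R) by apply: cvg_geometric; rewrite ger0_norm.
move/cvgrPdist_lt => /(_ _ e0) [n _ /(_ n (leqnn n))] /=.
by rewrite sub0r normrN => /(le_lt_trans (ler_norm _)) H; exists n.
Qed.

Lemma cvg_sqrB2 (R : realType) (a b : R^nat) (la lb xa xb : R) :
  a @ \oo --> la -> b @ \oo --> lb ->
  (fun m => (a m - xa) ^+ 2 + (b m - xb) ^+ 2) @ \oo --> (la - xa) ^+ 2 + (lb - xb) ^+ 2.
Proof.
move=> ha hb; apply: cvgD; rewrite expr2; under eq_fun do rewrite expr2.
  by apply: cvgM; apply: cvgB => //; exact: cvg_cst.
by apply: cvgM; apply: cvgB => //; exact: cvg_cst.
Qed.

Lemma cvg_abs2B (v : nat -> CC) (l z : CC) :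
  (fun m => ReC (v m)) @ \oo --> ReC l -> (fun m => ImC (v m)) @ \oo --> ImC l ->
  (fun m => abs2 (v m - z)) @ \oo --> abs2 (l - z).
Proof.
move=> h1 h2; have := @cvg_sqrB2 RR _ _ _ _ (ReC z) (ImC z) h1 h2.
by rewrite /abs2 !CCE; under [X in _ -> X @ _ --> _]eq_fun do rewrite !CCE.
Qed.

Lemma Cof_indic1 T (E : set T) t : E t -> Cof (\1_E t) = 1.
Proof. by move=> Et; rewrite indicE mem_set. Qed.

Lemma Cof_indic0 T (E : set T) t : ~ E t -> Cof (\1_E t) = 0.
Proof. by move=> Et; rewrite indicE memNset. Qed.

Section riesz_fischer.
Context (d : nat).
Implicit Types (c : 'cV[int]_d -> CC) (s : seq 'cV[int]_d).

(** Take a finite set whose sum comes within [e] of the supremum; a finite set disjoint from it can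
    add at most [e]. *)
Lemma ell2_tail c (e : RR) : ell2 c -> 0 < e -> exists s0 : seq 'cV[int]_d,
  forall s, uniq s -> (forall k, k \in s -> k \notin s0) ->
  \sum_(k <- s) abs2 (c k) <= e.
Proof.
move=> c2 e0.
have Sfin : (\esum_(k in [set: 'cV[int]_d]) (abs2 (c k))%:E)%E \is a fin_num.
  by rewrite ge0_fin_numE//; apply: esum_ge0 => k _; rewrite lee_fin abs2_ge0.
have [_ [F [finF _] <-] HF] := ub_ereal_sup_adherent e0 Sfin.
rewrite fsbig_finite//= in HF.
pose r := finmap.enum_fset (fset_set F).
exists r => s us sF.
have ur : uniq (s ++ r).
  rewrite cat_uniq us finmap.fset_uniq andbT /=; apply/hasPn => k kr.
  by apply/negP => ks; move/negP : (sF _ ks); apply.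
have : (\sum_(k <- s ++ r) (abs2 (c k))%:E <=
    \esum_(k in [set: 'cV[int]_d]) (abs2 (c k))%:E)%E.
  apply: esum_ge; exists [set` s ++ r]; last by rewrite (fsbig_seq _ _ ur).
  by split => //; exact: finite_seq.
move: HF; rewrite -/(esum _ _) big_cat /=.
rewrite -(fineK Sfin) !sumEFin -EFinB -EFinD lte_fin lee_fin => h1 h2.
by move: h1 h2; rewrite -/r; set a := fine _; lra.
Qed.

Lemma sum_split (I : eqType) (V : nmodType) (F : I -> V) (s t : seq I) :
  uniq s -> uniq t -> {subset t <= s} ->
  \sum_(k <- s) F k = \sum_(k <- t) F k + \sum_(k <- [seq k <- s | k \notin t]) F k.
Proof.
move=> us ut ts; rewrite (bigID (fun k => k \in t))/= -big_filter -[X in _ + X]big_filter; congr (_ + _).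
apply: perm_big; apply: uniq_perm => //; first exact: filter_uniq.
by move=> k; rewrite mem_filter; case: (boolP (k \in t)) => //= /ts.
Qed.

(** The increments are absolutely summable because [b <= 2^n * b^2 + 2^-n], a consequence of
    [2^n * (b - 2^-n)^2 >= 0]. *)
Lemma abs2_series_cvg (u : nat -> CC) : (\sum_(n <oo) (2 ^+ n * abs2 (u n.+1 - u n))%:E < +oo)%E ->
  cvgn (fun n => ReC (u n)) /\ cvgn (fun n => ImC (u n)).
Proof.
move=> H.
have nn n : 0 <= 2 ^+ n * abs2 (u n.+1 - u n) by rewrite mulr_ge0 ?exprn_ge0 ?abs2_ge0.
have c1 : cvgn (series (fun n => 2 ^+ n * abs2 (u n.+1 - u n) : RR)).
  apply: nondecreasing_is_cvgn.
    by apply/nondecreasing_seqP => n; rewrite seriesSr lerDl.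
  set S := (\sum_(n <oo) _)%E in H.
  have S0 : (0 <= S)%E by apply: nneseries_ge0 => n _ _; rewrite lee_fin.
  exists (fine S) => _ [n _ <-]; rewrite -lee_fin fineK ?ge0_fin_numE//.
  rewrite /series /= -sumEFin; apply: nneseries_lim_ge => k _ _; rewrite lee_fin; exact: nn.
have c2 : cvgn (series (geometric 1 (2^-1 : RR))).
  by apply: is_cvg_geometric_series; rewrite ger0_norm// invf_lt1// ltr1n.
have key (v : nat -> RR) : (forall n, (v n.+1 - v n) ^+ 2 <= abs2 (u n.+1 - u n)) -> cvgn v.
  move=> vu.
  have : cvgn (series (telescope v)).
    apply: (@normed_cvg RR RR^o).
    apply: (@series_le_cvg RR _ (fun n => 2 ^+ n * abs2 (u n.+1 - u n) + geometric 1 (2^-1) n)).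
    - by move=> n; exact: normr_ge0.
    - by move=> n; rewrite addr_ge0//= mul1r exprn_ge0// invr_ge0.
    - move=> n; rewrite /= mul1r exprVn.
      have p0 : 0 < 2 ^+ n :> RR by rewrite exprn_gt0.
      have q0 : 0 < (2 ^+ n)^-1 :> RR by rewrite invr_gt0.
      have pq : 2 ^+ n * (2 ^+ n)^-1 = 1 :> RR by rewrite mulfV ?gt_eqF.
      have := vu n; rewrite -(real_normK (num_real (v n.+1 - v n))).
      move: (abs2 _) (`|_|) (normr_ge0 (v n.+1 - v n)) => a b b0 ba.
      move: p0 q0 pq; move: (2 ^+ n : RR) (_^-1) => p q p0 q0 pq.
      have : p * b ^+ 2 <= p * a by rewrite ler_pM2l.
      have := mulr_ge0 (ltW p0) (sqr_ge0 (b - q)).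
      have E : p * (b - q) ^+ 2 = p * b ^+ 2 - 2 * b * (p * q) + q * (p * q) by ring.
      rewrite E pq; lra.
    - rewrite (_ : series _ = series (fun n => 2 ^+ n * abs2 (u n.+1 - u n) : RR) +
         series (geometric 1 (2^-1 : RR))).
        exact: is_cvgD.
      by apply/funext => n; rewrite /series /= fctE big_split.
  move=> ct; have -> : v = (fun n => v 0%N + series (telescope v) n).
    by apply/funext => n; exact: eq_sum_telescope.
  have /cvg_ex[l Hl] := ct; apply/cvg_ex; exists (v 0%N + l).
  exact: (@cvgD _ RR^o nat \oo _ (cst (v 0%N)) _ _ _ (cvg_cst _) Hl).
split; apply: key => n; rewrite /abs2 !CCE ?lerDl ?sqr_ge0//.
by rewrite lerDr sqr_ge0.
Qed.

(* Riesz-Fischer: partial sums along finite sets that exhaust all but [4^-n] of the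
   l2-norm of [c] converge almost everywhere. *)
Lemma has_sumL2_exists c (phi : 'cV[int]_d -> 'cV[RR]_d -> CC) (C : RR) :
  0 <= C -> (forall k, L2 (phi k)) ->
  (forall s, uniq s -> (nrm2 (fun t => \sum_(k <- s) c k * phi k t)%R <=
     (C * \sum_(k <- s) abs2 (c k))%:E)%E) ->
  ell2 c -> exists f, has_sumL2 c phi f.
Proof.
move=> C0 lphi bes c2.
(* With tails [4^-n], the weights [2^n] of [abs2_series_cvg] still leave a convergent geometric
   series of ratio 1/2. *)
pose ep n : RR := 4^-1 ^+ n.
have ep0 n : 0 < ep n by rewrite exprn_gt0.
have /choice[sn Hsn] n := ell2_tail c2 (ep0 n).
(* Accumulating the sets [sn i] makes the index sets increasing, so that differences of partial sums
   are tails. *)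
pose T n := undup (flatten [seq sn i | i <- iota 0 n.+1]).
have uT n : uniq (T n) by exact: undup_uniq.
have snT n : {subset sn n <= T n}.
  move=> k kn; rewrite mem_undup; apply/flattenP; exists (sn n) => //.
  by apply: map_f; rewrite mem_iota add0n ltnS leqnn.
have TT n m : (n <= m)%N -> {subset T n <= T m}.
  move=> nm k; rewrite !mem_undup => /flattenP[_ /mapP[i + ->] ki].
  rewrite mem_iota add0n ltnS => ni; apply/flattenP; exists (sn i) => //.
  by apply: map_f; rewrite mem_iota add0n ltnS (leq_trans ni).
pose P s t := \sum_(k <- s) c k * phi k t.
have lP s : L2 (P s) by apply: L2_sum => k; exact: L2Z.
have mP s := L2_cmeas (lP s).
have PT n s : uniq s -> {subset T n <= s} ->
    (nrm2 (fun t => P s t - P (T n) t)%R <= (C * ep n)%:E)%E.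
  move=> us Ts; have -> : (fun t => P s t - P (T n) t) = P [seq k <- s | k \notin T n].
    by apply/funext => t; rewrite /P (sum_split _ us (uT n) Ts) addrC addKr.
  apply: (le_trans (bes _ (filter_uniq _ us))); rewrite lee_fin ler_wpM2l//.
  apply: Hsn; first exact: filter_uniq.
  by move=> k; rewrite mem_filter => /andP[kT _]; apply: contra kT; exact: snT.
pose u n := P (T n).
have mu n : cmeas (u n) by exact: mP.
have muB n m : cmeas (fun t => u n t - u m t) by exact: cmeasB.
pose D n t : \bar RR := (2 ^+ n * abs2 (u n.+1 t - u n t))%:E.
have D0 n t : (0 <= D n t)%E by rewrite lee_fin mulr_ge0 ?exprn_ge0 ?abs2_ge0.
have mD n : measurable_fun setT (D n).
  apply/measurable_EFinP; apply: measurable_funM => //.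
  exact: (measurable_abs2 (muB n.+1 n)).
pose w t := (\sum_(n <oo) D n t)%E.
have mw : measurable_fun setT w by apply: ge0_emeasurable_sum.
(* On [E] the weighted series of increments converges; its complement is null because the series has
   a finite integral. *)
pose E := [set t | (w t < +oo)%E].
have mE : measurable E.
  have := emeasurable_fun_infty_o measurableT mw => /(_ +oo%E); rewrite setTI.
  by congr measurable; apply/seteqP; split => t /=; rewrite in_itv.
have nE : leb (~` E) = 0%E.
  have iw : (\int[@leb d]_t w t < +oo)%E.
    rewrite integral_nneseries//.
    have geo : (\sum_(n <oo) (C * (2^-1) ^+ n)%:E < +oo)%E.
      apply: (@le_lt_trans _ _ (C * 2)%:E); last exact: ltry.
      apply: lime_le; first by apply: is_cvg_nneseries => n _ _; rewrite lee_fin mulr_ge0// exprn_ge0.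
      near=> n; rewrite sumEFin lee_fin -mulr_sumr ler_wpM2l//.
      have := @geometric_le_lim RR n 1 2^-1 ler01.
      rewrite invr_gt0 ltr0n => /(_ isT); rewrite ger0_norm// invf_lt1// ltr1n => /(_ isT).
      rewrite mul1r (_ : (1 - 2^-1)^-1 = 2); last by field.
      by apply: le_trans; rewrite /series /=; apply: ler_sum => i _; rewrite mul1r.
    apply: le_lt_trans geo; apply: lee_nneseries => [n _ _|n _]; first exact: integral_ge0.
    rewrite /D; under eq_integral do rewrite EFinM.
    rewrite ge0_integralZl_EFin ?exprn_ge0//; last 2 first.
    - by move=> t _; rewrite lee_fin abs2_ge0.
    - by apply/measurable_EFinP; apply: measurable_abs2; exact: cmeasB.
    rewrite -nrm2E; last exact: cmeasB.
    have -> : C * 2^-1 ^+ n = 2 ^+ n * (C * ep n).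
      by rewrite mulrCA /ep -exprMn; congr (_ * _ ^+ n); field.
    rewrite EFinM lee_wpmul2l ?lee_fin ?exprn_ge0//.
    by apply: PT => //; exact: TT.
  have wi : (@leb d).-integrable setT w.
    apply/integrableP; split => //; apply: le_lt_trans iw.
    rewrite le_eqVlt; apply/orP; left; apply/eqP; apply: eq_integral => t _.
    by rewrite gee0_abs//; apply: nneseries_ge0 => n _ _; exact: D0.
  have [N [mN N0 sN]] := integrable_ae measurableT wi.
  apply/eqP; rewrite eq_le measure_ge0 andbT -N0; apply: le_measure; rewrite ?inE//.
    exact: measurableC.
  move=> t /= nEt; apply: sN => /= /(_ Logic.I) wf; apply: nEt.
  by rewrite /E /= ltey_eq wf.
(* Setting the partial sums to 0 off [E] makes them converge at every point, so that the limit is a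
   measurable function. *)
pose v n t := Cof (\1_E t) * u n t.
have mv n : cmeas (v n).
  by apply: cmeasM => //; apply: cmeas_Cof; exact: measurable_indic.
have mvB n m : cmeas (fun t => v n t - v m t) by apply: cmeasB.
have vE n t : E t -> v n t = u n t.
  by move=> Et; rewrite /v Cof_indic1// mul1r.
have vNE n t : ~ E t -> v n t = 0.
  by move=> Et; rewrite /v Cof_indic0// mul0r.
have vc t : cvgn (fun n => ReC (v n t)) /\ cvgn (fun n => ImC (v n t)).
  have [Et|Et] := pselect (E t); last first.
    have H n : v n t = 0 by exact: vNE.
    by split; [under eq_fun do rewrite H|under eq_fun do rewrite H]; exact: is_cvg_cst.
  have [h1 h2] := abs2_series_cvg (u := fun n => u n t) Et.
  by split; [under eq_fun do rewrite vE//|under eq_fun do rewrite vE//].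
pose f t : CC := Complex (limn (fun n => ReC (v n t))) (limn (fun n => ImC (v n t))).
have mf : cmeas f.
  split.
    by apply: (@measurable_fun_cvg _ _ _ setT (fun n t => ReC (v n t))) => [m|t _];
      [exact: (mv m).1|exact: (vc t).1].
  by apply: (@measurable_fun_cvg _ _ _ setT (fun n t => ImC (v n t))) => [m|t _];
    [exact: (mv m).2|exact: (vc t).2].
have uv n : nrm2 (fun t => u n t - v n t) = 0%E.
  rewrite nrm2E; last exact: cmeasB.
  rewrite (ge0_negligible_integral (N := ~` E))//; last 3 first.
  - exact: measurableC.
  - by apply/measurable_EFinP; apply: measurable_abs2; exact: cmeasB.
  - by move=> t _; rewrite lee_fin abs2_ge0.
  apply: integral0_eq => t [_ /=]; move/contrapT => Et.
  by rewrite vE// subrr abs20.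
have vmn n m : (n <= m)%N -> (nrm2 (fun t => v m t - v n t)%R <= (C * ep n)%:E)%E.
  move=> nm; apply: le_trans (PT n _ (uT m) (TT _ _ nm)).
  apply: nrm2_le => //; first exact: cmeasB.
  move=> t; have [Et|Et] := pselect (E t); first by rewrite !vE.
  by rewrite !vNE// subr0 abs20 abs2_ge0.
have fv n : (nrm2 (fun t => f t - v n t)%R <= (C * ep n)%:E)%E.
  apply: (@nrm2_fatou _ (fun m t => v m t - v n t) _ _ n) => //; first exact: cmeasB.
    move=> t; have [h1 h2] := vc t.
    exact: cvg_abs2B.
  by move=> m nm; exact: vmn.
have lv n : L2 (v n).
  apply: (L2_le (mv n) (lP (T n))) => t.
  have [Et|Et] := pselect (E t); first by rewrite vE.
  by rewrite vNE// abs20 abs2_ge0.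
have lf : L2 f.
  have -> : f = (fun t => (f t - v 0%N t) + v 0%N t) by apply/funext => t; rewrite subrK.
  apply: L2D => //; apply/L2P; split; first exact: cmeasB.
  by apply: (le_lt_trans (fv 0%N)); exact: ltry.
exists f; split => // e e0.
(* The 6 is [2 + 2 * 2]: two nested uses of [nrm2D], the distance between [u n] and [v n] being
   0. *)
have [n Hn] : exists n, 6 * C * ep n < e.
  by apply: geometric_lt => //; rewrite invr_ge0 ler0n invf_lt1// ltr1n.
exists (T n) => s us Ts.
have h1 := fv n; have h2 := PT n s us Ts; have h3 := uv n.
have E3 : (fun t => f t - P s t) = (fun t => (f t - v n t) +
    (- (u n t - v n t) - (P s t - u n t))).
  by apply/funext => t; rewrite /u; ring.
rewrite [X in nrm2 X]E3.
apply: (le_lt_trans (nrm2D _ _)); [exact: cmeasB|apply: cmeasB; [apply: cmeasN|]; exact: cmeasB|].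
have h4 : (nrm2 (fun t => - (u n t - v n t) - (P s t - u n t))%R <= (2 * (C * ep n))%:E)%E.
  apply: (le_trans (nrm2D _ _)); [apply: cmeasN|apply: cmeasN|]; try exact: cmeasB.
  have NN (h : 'cV[RR]_d -> CC) : nrm2 (fun t => - h t) = nrm2 h.
    by congr intRd; apply/funext => t; rewrite abs2N.
  rewrite !NN h3 mule0 add0e EFinM lee_wpmul2l//.
apply: (@le_lt_trans _ _ (2%:E * (C * ep n)%:E + 2%:E * (2 * (C * ep n))%:E)%E).
  by apply: leeD; apply: lee_wpmul2l.
by rewrite -!EFinM -EFinD lte_fin; move: Hn; lra.
Unshelve. all: by end_near. Qed.

End riesz_fischer.

(** * The Bessel inequality for lattice translates *)

Lemma cV_norm_le n (x : 'cV[RR]_n) (r : RR) : 0 <= r ->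
  (`|x| <= r) <-> (forall i, `|x i 0| <= r).
Proof.
move=> r0; rewrite /Num.norm /= mx_normrE; split=> [/bigmax_leP[_ H] i|H].
  exact: (H (i, 0)).
by apply/bigmax_leP; split => // -[i j] _; rewrite (ord1 j); exact: H.
Qed.

Definition vanishes_off n (N : RR) (h : 'cV[RR]_n -> CC) :=
  forall t, N < `|t| -> h t = 0.

(* The only part of Plancherel's theorem that the Bessel bound needs; no attempt
   is made to get the sharp constant. *)
Definition fourier_bounded_below n := exists2 K : RR, 0 <= K &
  forall (h : 'cV[RR]_n -> CC) N, L2 h -> vanishes_off N h ->
    (nrm2 h <= K%:E * nrm2 (fourierL1 h))%E.

Lemma nrm2N n (h : 'cV[RR]_n -> CC) : nrm2 (fun t => - h t) = nrm2 h.
Proof. by congr intRd; apply/funext => t; rewrite abs2N. Qed.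

Definition nball n (N : RR) : set 'cV[RR]_n := [set t | `|t| <= N].

Lemma measurable_nball n N : measurable (@nball n N).
Proof.
have m : measurable_fun setT (fun t : 'cV[RR]_n => `|t| : RR).
  by apply: continuous_measurable_fun_cV; exact: norm_continuous.
have := m measurableT _ (measurable_itv `]-oo, N]).
by rewrite setTI; congr measurable; apply/seteqP; split => t /=; rewrite in_itv.
Qed.

(** The margin 1 is there because [cube] omits its lower faces. *)
Lemma nball_sub_cube n N : 0 <= N -> @nball n N `<=` @cube n (N + 1).
Proof.
move=> N0 t /(cV_norm_le _ N0) tN i; have := tN i.
by rewrite ler_norml => /andP[h1 h2]; apply/andP; split; lra.
Qed.

Lemma leb_cube_fin n N : 0 <= N -> (leb (@cube n N) < +oo)%E.
Proof. by move=> N0; rewrite leb_box ?ltry// => i; rewrite (@le_trans _ _ 0)// oppr_le0. Qed.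

Lemma leb_nball_fin n N : 0 <= N -> (leb (@nball n N) < +oo)%E.
Proof.
move=> N0; apply: (@le_lt_trans _ _ (leb (@cube n (N + 1)))).
  apply: le_measure; rewrite ?inE; [exact: measurable_nball|exact: measurable_box|].
  exact: nball_sub_cube.
by apply: leb_cube_fin; rewrite addr_ge0.
Qed.

Lemma abs2_indic T (E : set T) t : abs2 (Cof (\1_E t)) = \1_E t.
Proof.
rewrite /Cof /abs2 !CCE expr0n addr0 indicE.
by case: (_ \in _); rewrite ?expr0n ?expr1n.
Qed.

Lemma L2_indic n (E : set 'cV[RR]_n) : measurable E -> (leb E < +oo)%E ->
  L2 (fun t => Cof (\1_E t)).
Proof.
move=> mE Efin; apply/L2P; split.
  by apply: cmeas_Cof; exact: measurable_indic.
rewrite (_ : nrm2 _ = leb E)//.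
by congr intRd; apply/funext => t; rewrite abs2_indic.
Qed.

Lemma L2_indicM n (E : set 'cV[RR]_n) h : measurable E -> L2 h ->
  L2 (fun t => Cof (\1_E t) * h t).
Proof.
move=> mE lh; apply: (L2_le _ lh).
  by apply: cmeasM; [apply: cmeas_Cof; exact: measurable_indic|exact: L2_cmeas].
move=> t; rewrite abs2M abs2_indic ler_piMl ?abs2_ge0//.
Qed.

Lemma L2_vanishes_cint n N (h : 'cV[RR]_n -> CC) : L2 h -> vanishes_off N h -> cint h.
Proof.
move=> lh hN.
have N0 : 0 <= Num.max N 0 by rewrite le_max lexx orbT.
have -> : h = (fun t => Cof (\1_(nball (Num.max N 0)) t) * h t).
  apply/funext => t; have [tN|tN] := pselect (nball (Num.max N 0) t).
    by rewrite Cof_indic1// mul1r.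
  rewrite Cof_indic0// mul0r hN//; move/negP : tN; rewrite -ltNge.
  by apply: le_lt_trans; rewrite le_max lexx.
apply: L2M_cint => //; apply: L2_indic; [exact: measurable_nball|exact: leb_nball_fin].
Qed.

Section bessel.
Context (d : nat) (A : 'M[RR]_d) (phi Phi : 'cV[RR]_d -> CC).
Hypotheses (uA : A \in unitmx) (lphi : L2 phi) (phiPhi : is_fourierL2 phi Phi)
  (bP : ess_bdd_on (fundP A) (periodization A Phi)) (fbb : fourier_bounded_below d).

Lemma trig_abs2_bounded s c : exists2 T : RR, 0 <= T & forall w, abs2 (trig A s c w) <= T.
Proof.
elim: s => [|k s [T T0 IH]].
  by exists 0 => // w; rewrite /trig big_nil abs20.
exists (2 * abs2 (c k) + 2 * T); first by rewrite addr_ge0 ?mulr_ge0 ?abs2_ge0.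
move=> w; rewrite /trig big_cons; apply: (le_trans (abs2_le_add _ _)).
by rewrite lerD// ?abs2M ?abs2_expi ?mulr1// ler_pM2l//; exact: IH.
Qed.

(** The sums [h m] of truncated translates have bounded support, so the lower bound for [fourierL1]
    applies to them; they converge pointwise to the full sum and Fatou's lemma carries the bound
    over. *)
Lemma bessel_translates : exists2 C : RR, 0 <= C & forall s c, uniq s ->
  (nrm2 (fun t => \sum_(k <- s) c k * phi (t - latpt A k))%R <=
     (C * \sum_(k <- s) abs2 (c k))%:E)%E.
Proof.
have [lPhi HPhi] := phiPhi; have mPhi := L2_cmeas lPhi.
have [K K0 HK] := fbb.
have [C0 C00 HC0] := trig_bound uA lPhi bP.
exists (K * (2 * C0)); first by rewrite !mulr_ge0.
move=> s c us; set S := \sum_(k <- s) abs2 (c k).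
have [T T0 HT] := trig_abs2_bounded s c.
pose psi (m : nat) t := Cof (\1_[set s : 'cV[RR]_d | `|s| <= m%:R] t) * phi t.
have lpsi m : L2 (psi m) by apply: L2_indicM => //; exact: measurable_nball.
have vpsi m : vanishes_off m%:R (psi m).
  by move=> t mt; rewrite /psi Cof_indic0 ?mul0r//= ; apply/negP; rewrite -ltNge.
have ipsi m := L2_vanishes_cint (lpsi m) (@vpsi m).
pose h m t := \sum_(k <- s) c k * psi m (t - latpt A k).
have lh m : L2 (h m) by apply: L2_sum => k; apply: L2Z; apply: L2_shift.
(* Translating by the finitely many lattice points enlarges the support by at most [R]. *)
pose R := \sum_(k <- s) `|latpt A k|.
have lR k : k \in s -> `|latpt A k| <= R.
  by move=> ks; rewrite /R (bigD1_seq k)//= lerDl sumr_ge0.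
have vh m : vanishes_off (m%:R + R) (h m).
  move=> t tR; rewrite /h big_seq big1// => k ks; rewrite vpsi ?mulr0//.
  have := ler_normB (t - latpt A k) (- latpt A k); rewrite opprK subrK normrN.
  by have := lR k ks; move: tR; lra.
have Fh m w : fourierL1 (h m) w = trig A s c w * fourierL1 (psi m) w.
  exact: fourierL1_translates.
have mF m : cmeas (fourierL1 (psi m)) by apply: cmeas_fourierL1; exact: L2_cmeas.
have mtr := cmeas_trig A s c.
apply/lee_addgt0Pr => e e0.
(* Chosen so that the error contribution [2 * K * T * e'] is at most [e]; the summand 1 keeps the
   denominator positive. *)
pose e' := e / (2 * K * T + 1).
have D0 : 0 < 2 * K * T + 1 by rewrite ltr_pwDr// !mulr_ge0.
have e'0 : 0 < e' by rewrite divr_gt0.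
have [N HN] := HPhi _ e'0.
apply: (@nrm2_fatou _ h _ _ N).
- by move=> m; exact: L2_cmeas.
- by apply: L2_cmeas; apply: L2_sum => k; apply: L2Z; exact: L2_shift.
(* From index [M] on, no truncation affects the finitely many values of [phi] entering at [t], so
   the sequence is eventually constant. *)
- move=> t; pose M := Num.bound (`|t| + R).
  apply: cvg_near_cst; exists M => // m /= Mm; congr abs2.
  rewrite /h; apply: eq_big_seq => k ks; congr (_ * _).
  rewrite /psi Cof_indic1 ?mul1r//=.
  apply: (le_trans (ler_normB _ _)).
  apply: (@le_trans _ _ (`|t| + R)); first by rewrite lerD2l lR.
  apply/ltW; apply: (@lt_le_trans _ _ M%:R); last by rewrite ler_nat.
  apply: archi_boundP; rewrite addr_ge0// (le_trans _ (lR k ks))//.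
- move=> m Nm; apply: (le_trans (HK _ _ (lh m) (vh m))).
  (* The main term is controlled by the periodization through [trig_bound]; the error term by the
     uniform bound [T] and the convergence of the truncated transforms to [Phi]. *)
  have -> : fourierL1 (h m) = (fun w => trig A s c w * Phi w +
      - (trig A s c w * (Phi w - fourierL1 (psi m) w))).
    by apply/funext => w; rewrite Fh; ring.
  apply: (@le_trans _ _ (K%:E * (2%:E * (C0 * S)%:E + 2%:E * (T * e')%:E))%E); last first.
    apply: (@le_trans _ _ (K * (2 * (C0 * S) + 2 * (T * e')))%:E); first exact: lexx.
    rewrite lee_fin mulrDr -!mulrA lerD// /e'.
    have -> : K * (2 * (T * (e / (2 * K * T + 1)))) = (2 * K * T / (2 * K * T + 1)) * e.
      by field; rewrite gt_eqF.
    by rewrite ler_piMl ?(ltW e0)// ler_pdivrMr// mul1r lerDl.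
  rewrite lee_wpmul2l ?lee_fin//.
  apply: (le_trans (nrm2D _ _)).
  + exact: cmeasM.
  + by apply: cmeasN; apply: cmeasM => //; exact: cmeasB.
  rewrite nrm2N; apply: leeD; rewrite lee_wpmul2l//; first exact: HC0.
  apply: (@le_trans _ _ (T%:E * nrm2 (fun w => Phi w - fourierL1 (psi m) w)%R)%E); last first.
    by rewrite EFinM lee_wpmul2l ?lee_fin//; apply/ltW; exact: HN.
  have mB : cmeas (fun w => Phi w - fourierL1 (psi m) w) by exact: cmeasB.
  rewrite !nrm2E//; last exact: cmeasM.
  have mB2 := measurable_abs2 mB.
  rewrite -ge0_integralZl_EFin//; [|by move=> w _; rewrite lee_fin abs2_ge0|exact/measurable_EFinP].
  apply: ge0_le_integral => //.
  + by move=> w _; rewrite lee_fin abs2_ge0.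
  + by apply/measurable_EFinP; apply: measurable_abs2; exact: cmeasM.
  + by apply: measurable_funeM; exact/measurable_EFinP.
  + by move=> w _; rewrite -EFinM lee_fin abs2M ler_wpM2r ?abs2_ge0.
Qed.

End bessel.

Section existence.
Context (d : nat) (g : 'cV[RR]_d -> CC) (A : 'M[RR]_d)
  (S : 'M[RR]_(d + d)) (U Uinv : ('cV[RR]_d -> CC) -> ('cV[RR]_d -> CC)).
Hypotheses (lg : L2 g) (uA : A \in unitmx) (mU : metaplectic S U Uinv).

Lemma metaplectic_sum I (s : seq I) (c : I -> CC) (h : I -> 'cV[RR]_d -> CC) :
  (forall k, L2 (h k)) ->
  Defs.ae_eq (U (fun t => \sum_(k <- s) c k * h k t)) (fun t => \sum_(k <- s) c k * U (h k) t).
Proof.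
move=> lh; have [mL2 [_ [mlin [miso _]]]] := mU.
have lU f : L2 f -> L2 (U f) by move=> lf; exact: (mL2 _ lf).1.
elim: s => [|k s IH].
  under [X in U X]eq_fun do rewrite big_nil.
  under [X in Defs.ae_eq _ X]eq_fun do rewrite big_nil.
  rewrite /Defs.ae_eq; under eq_fun do rewrite subr0.
  rewrite miso; last exact: L20.
  by rewrite /nrm2; under eq_fun do rewrite abs20; rewrite intRd0.
have lS : L2 (fun t => \sum_(k <- s) c k * h k t) by apply: L2_sum => j; exact: L2Z.
have lSU : L2 (fun t => \sum_(k <- s) c k * U (h k) t).
  by apply: L2_sum => j; apply: L2Z; exact: lU.
have lc : L2 (fun t => c k * h k t) by exact: L2Z.
have lcU : L2 (fun t => c k * U (h k) t) by apply: L2Z; exact: lU.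
under [X in U X]eq_fun do rewrite big_cons.
under [X in Defs.ae_eq _ X]eq_fun do rewrite big_cons.
apply: (@L2_ae_trans _ _ (fun t => c k * U (h k) t + U (fun t => \sum_(k <- s) c k * h k t) t)).
- by apply: lU; exact: L2D.
- by apply: L2D => //; exact: lU.
- exact: L2D.
- exact: mlin.
- move: IH; rewrite /Defs.ae_eq => <-; congr nrm2; apply/funext => t.
  by rewrite opprD addrACA subrr add0r.
Qed.

Lemma has_sumL2_TSRg Phi c : fourier_bounded_below d ->
  is_fourierL2 (Uinv (reflect_op g)) Phi ->
  ess_bdd_on (fundP A) (periodization A Phi) -> ell2 c ->
  exists f, has_sumL2 c (TSRg A U Uinv g) f.
Proof.
move=> fbb hPhi bP c2; have [mL2 [_ [_ [miso _]]]] := mU.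
have lr : L2 (reflect_op g) by exact: L2_opp.
have lphi : L2 (Uinv (reflect_op g)) by exact: (mL2 _ lr).2.
have [C C0 HC] := bessel_translates uA lphi hPhi bP fbb.
(* The factor 2 comes from [nrm2D]: [U] of a finite sum equals the sum of the images only up to a
   null function, which is split off. *)
apply: (@has_sumL2_exists d c _ (2 * C)) => //; first by rewrite mulr_ge0.
  by move=> k; apply: (L2_TSRg A lg mU).
move=> s us.
have lT k : L2 (transl (latpt A k) (Uinv (reflect_op g))) by exact: L2_shift.
pose h t := \sum_(k <- s) c k * transl (latpt A k) (Uinv (reflect_op g)) t.
have lh : L2 h by apply: L2_sum => k; exact: L2Z.
have lUh : L2 (U h) by exact: (mL2 _ lh).1.
have lSU : L2 (fun t => \sum_(k <- s) c k * TSRg A U Uinv g k t).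
  by apply: L2_sum => k; apply: L2Z; exact: (L2_TSRg A lg mU).
have := metaplectic_sum s c lT; rewrite /Defs.ae_eq -/h => E.
have -> : (fun t => \sum_(k <- s) c k * TSRg A U Uinv g k t) =
    (fun t => U h t + - (U h t - \sum_(k <- s) c k * TSRg A U Uinv g k t)).
  by apply/funext => t; ring.
apply: (le_trans (nrm2D (L2_cmeas lUh) (L2_cmeas (L2N (L2B lUh lSU))))).
rewrite nrm2N E mule0 adde0 miso// -mulrA EFinM lee_wpmul2l//.
exact: HC.
Qed.

End existence.

(** * Gram matrix of Fourier transforms of intervals *)

Definition ctail n (x : 'cV[RR]_n.+1) : 'cV[RR]_n := \col_i x (lift ord0 i) 0.

Lemma ctail_ccons n a (y : 'cV[RR]_n) : ctail (ccons a y) = y.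
Proof. by apply/matrixP => i j; rewrite (ord1 j) mxE cconsS. Qed.

Lemma measurable_ctail n : measurable_fun setT (@ctail n).
Proof.
apply: measurable_fun_cV => i; under eq_fun do rewrite mxE.
exact: measurable_coord.
Qed.

Lemma intRd1 (h : RR -> \bar RR) :
  intRd (fun x : 'cV[RR]_1 => h (x ord0 0)) = (\int[leb1]_x h x)%E.
Proof. by rewrite intRdS; apply: eq_integral => x _ /=; rewrite ccons0. Qed.

Lemma measurable_fun_of_cV1 (u : RR -> RR) :
  measurable_fun setT (fun x : 'cV[RR]_1 => u (x ord0 0)) -> measurable_fun setT u.
Proof.
move=> mu; rewrite (_ : u = (fun x : 'cV[RR]_1 => u (x ord0 0)) \o (fun r => ccons r 0)).
  apply: measurableT_comp mu _; exact: measurable_fun_ccons.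
by apply/funext => r /=; rewrite ccons0.
Qed.

Lemma rint_ge0P m (u : 'cV[RR]_m -> RR) : (forall x, 0 <= u x) ->
  rint u <-> measurable_fun setT u /\ (intRd (fun x => (u x)%:E) < +oo)%E.
Proof.
move=> u0.
have E : measurable_fun setT u ->
    (\int[@leb m]_x `|(u x)%:E| = intRd (fun x => (u x)%:E))%E.
  move=> mu; rewrite -integral_leb//; last exact/measurable_EFinP.
  by apply: eq_integral => x _; rewrite gee0_abs// lee_fin.
split=> [/integrableP[/measurable_EFinP mu]|[mu iu]].
  by rewrite /comp E.
by apply/integrableP; split; [exact/measurable_EFinP|rewrite /comp E].
Qed.

Lemma intR_ge0E m (u : 'cV[RR]_m -> RR) : (forall x, 0 <= u x) -> rint u ->
  intR u = fine (intRd (fun x => (u x)%:E)).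
Proof.
move=> u0 iu; rewrite (intRE iu) /Rintegral integral_leb//.
by apply/measurable_EFinP; exact: rint_meas.
Qed.

Section tensor.
Context (n : nat).
Implicit Types (u : RR -> RR) (v : 'cV[RR]_n -> RR).

Definition tensor (T : pzRingType) (u : RR -> T) (v : 'cV[RR]_n -> T) (x : 'cV[RR]_n.+1) : T :=
  u (x ord0 0) * v (ctail x).

Lemma measurable_tensor u v : measurable_fun setT u -> measurable_fun setT v ->
  measurable_fun setT (tensor u v).
Proof.
move=> mu mv; apply: measurable_funM.
  exact: (measurableT_comp mu (measurable_coord _)).
exact: (measurableT_comp mv (@measurable_ctail n)).
Qed.

Lemma intRd_tensor u v : (forall r, 0 <= u r) -> (forall y, 0 <= v y) ->
  measurable_fun setT u -> measurable_fun setT v ->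
  (intRd (fun x => (tensor u v x)%:E) =
   intRd (fun x : 'cV[RR]_1 => (u (x ord0 0%R))%:E) * intRd (fun y => (v y)%:E))%E.
Proof.
move=> u0 v0 mu mv.
rewrite (intRd1 (fun r => (u r)%:E)) -ge0_integralZr//; last 3 first.
- exact/measurable_EFinP.
- by move=> x _; rewrite lee_fin.
- by apply: intRd_ge0 => y; rewrite lee_fin.
apply: eq_integral => x _; rewrite -intRdZl//.
- by congr intRd; apply/funext => y; rewrite -EFinM /tensor ccons0 ctail_ccons.
- exact/measurable_EFinP.
Qed.

(** One-dimensional integrals are taken over columns of height 1, so that the results on [rint] and
    [intR] apply unchanged. *)
Definition rint1 u := rint (fun x : 'cV[RR]_1 => u (x ord0 0)).
Definition int1 u := intR (fun x : 'cV[RR]_1 => u (x ord0 0)).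

Lemma rint_tensor_ge0 u v : (forall r, 0 <= u r) -> (forall y, 0 <= v y) ->
  rint1 u -> rint v -> rint (tensor u v) /\ intR (tensor u v) = int1 u * intR v.
Proof.
move=> u0 v0 iu iv.
have [mu fu] := (rint_ge0P (u := fun x : 'cV[RR]_1 => u (x ord0 0)) (fun x => u0 _)).1 iu.
have [mv fv] := (rint_ge0P v0).1 iv.
have mu1 := measurable_fun_of_cV1 mu.
have t0 x : 0 <= tensor u v x by rewrite mulr_ge0.
have fu' : intRd (fun x : 'cV[RR]_1 => (u (x ord0 0%R))%:E) \is a fin_num.
  by rewrite ge0_fin_numE// intRd_ge0// => x; rewrite lee_fin.
have fv' : intRd (fun x => (v x)%:E) \is a fin_num.
  by rewrite ge0_fin_numE// intRd_ge0// => x; rewrite lee_fin.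
have it : rint (tensor u v).
  apply/(rint_ge0P t0); split; first exact: measurable_tensor.
  by rewrite intRd_tensor// ltey_eq fin_numM.
split => //.
rewrite (intR_ge0E t0 it) /int1 (intR_ge0E (u := fun x : 'cV[RR]_1 => u (x ord0 0)) (fun x => u0 _) iu).
by rewrite (intR_ge0E v0 iv) intRd_tensor// fineM.
Qed.

Lemma rint_pos m (u : 'cV[RR]_m -> RR) : rint u -> rint (fun x => Num.max (u x) 0).
Proof.
move=> iu; apply: (rint_le (v := fun x => `|u x|)).
- by apply: measurable_maxr => //; exact: rint_meas.
- exact: (integrable_abse iu).
- by move=> x; case: (leP (u x) 0) => ux; rewrite ?normr0 ?normr_ge0.
Qed.

Lemma max0B (r : RR) : r = Num.max r 0 - Num.max (- r) 0.
Proof.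
case: (leP r 0) => r0; case: (leP (- r) 0) => r1; lra.
Qed.

(** Splitting both factors into positive and negative parts gives four nonnegative products, each
    covered by Tonelli's theorem. *)
Lemma intR_tensor u v : rint1 u -> rint v ->
  rint (tensor u v) /\ intR (tensor u v) = int1 u * intR v.
Proof.
move=> iu iv.
pose up r := Num.max (u r) 0; pose um r := Num.max (- u r) 0.
pose vp y := Num.max (v y) 0; pose vm y := Num.max (- v y) 0.
have iup : rint1 up := rint_pos iu.
have ium : rint1 um by apply: (rint_pos (u := fun x : 'cV[RR]_1 => - u (x ord0 0))); exact: rintN.
have ivp : rint vp := rint_pos iv.
have ivm : rint vm by apply: (rint_pos (u := fun x => - v x)); exact: rintN.
have m0 (r : RR) : 0 <= Num.max r 0 by rewrite le_max lexx orbT.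
have [i1 e1] := rint_tensor_ge0 (fun r => m0 (u r)) (fun y => m0 (v y)) iup ivp.
have [i2 e2] := rint_tensor_ge0 (fun r => m0 (- u r)) (fun y => m0 (v y)) ium ivp.
have [i3 e3] := rint_tensor_ge0 (fun r => m0 (u r)) (fun y => m0 (- v y)) iup ivm.
have [i4 e4] := rint_tensor_ge0 (fun r => m0 (- u r)) (fun y => m0 (- v y)) ium ivm.
have E : tensor u v = fun x => (tensor up vp x + tensor um vm x) + - (tensor um vp x + tensor up vm x).
  apply/funext => x; rewrite /tensor (max0B (u _)) (max0B (v _)) -/(up _) -/(um _) -/(vp _) -/(vm _).
  by move: (up _) (um _) (vp _) (vm _) => p q r s; ring.
have Eu : int1 u = int1 up - int1 um.
  rewrite /int1 -intRN// -intRD//; last exact: rintN.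
  by congr intR; apply/funext => x; rewrite {1}(max0B (u _)).
have Ev : intR v = intR vp - intR vm.
  rewrite -intRN// -intRD//; last exact: rintN.
  by congr intR; apply/funext => x; rewrite {1}(max0B (v _)).
have iA : rint (fun x => tensor up vp x + tensor um vm x) by exact: rintD.
have iB : rint (fun x => tensor um vp x + tensor up vm x) by exact: rintD.
rewrite E; split; first by apply: rintD => //; exact: rintN.
rewrite intRD//; last exact: rintN.
rewrite intRN// !intRD// e1 e2 e3 e4 Eu Ev.
by move: (int1 up) (int1 um) (intR vp) (intR vm) => p q r s; ring.
Qed.
End tensor.

Definition cint1 (u : RR -> CC) := cint (fun x : 'cV[RR]_1 => u (x ord0 0)).
Definition intC1 (u : RR -> CC) := intC (fun x : 'cV[RR]_1 => u (x ord0 0)).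

Lemma intC_tensor n (u : RR -> CC) (v : 'cV[RR]_n -> CC) : cint1 u -> cint v ->
  cint (tensor u v) /\ intC (tensor u v) = intC1 u * intC v.
Proof.
move=> [u1 u2] [v1 v2].
have [i1 e1] := intR_tensor (u := ReC \o u) u1 v1.
have [i2 e2] := intR_tensor (u := ImC \o u) u2 v2.
have [i3 e3] := intR_tensor (u := ReC \o u) u1 v2.
have [i4 e4] := intR_tensor (u := ImC \o u) u2 v1.
have ER : ReC \o tensor u v =
    (fun x => tensor (ReC \o u) (ReC \o v) x + - tensor (ImC \o u) (ImC \o v) x).
  by apply/funext => x; rewrite /tensor /= !CCE.
have EI : ImC \o tensor u v =
    (fun x => tensor (ReC \o u) (ImC \o v) x + tensor (ImC \o u) (ReC \o v) x).
  by apply/funext => x; rewrite /tensor /= !CCE.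
split.
  by split; rewrite ?ER ?EI; apply: rintD => //; exact: rintN.
apply: CC_eqP; rewrite !CCE.
  by rewrite ER intRD ?intRN// ?e1 ?e2//; exact: rintN.
by rewrite EI intRD// e3 e4.
Qed.

Lemma intC_prod n (u : 'I_n -> RR -> CC) : (forall i, cint1 (u i)) ->
  cint (fun x : 'cV[RR]_n => \prod_i u i (x i 0)) /\
  intC (fun x : 'cV[RR]_n => \prod_i u i (x i 0)) = \prod_i intC1 (u i).
Proof.
elim: n u => [|n IH] u iu.
  under eq_fun do rewrite big_ord0; rewrite big_ord0.
  have i1 : rint (fun _ : 'cV[RR]_0 => 1).
    by apply/(rint_ge0P (u := fun _ : 'cV[RR]_0 => 1)) => //; split => //; rewrite /= ltry.
  split; first by split => //; exact: integrable0.
  apply: CC_eqP; rewrite !CCE.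
    by rewrite (intR_ge0E (u := fun _ : 'cV[RR]_0 => 1)).
  by rewrite /intR /= /comp /= oppr0 subrr.
have [IH1 IH2] := IH (fun i => u (lift ord0 i)) (fun i => iu _).
have [t1 t2] := intC_tensor (iu ord0) IH1.
have E : (fun x : 'cV[RR]_n.+1 => \prod_i u i (x i 0)) =
    tensor (u ord0) (fun y : 'cV[RR]_n => \prod_i u (lift ord0 i) (y i 0)).
  apply/funext => x; rewrite /tensor big_ord_recl; congr (_ * _).
  by apply: eq_bigr => i _; rewrite mxE.
by rewrite E; split => //; rewrite t2 IH2 big_ord_recl.
Qed.
Lemma integral_oc_antiderivative (R : realType) (f F : R -> R) (a b : R) : a <= b ->
  continuous f -> (forall x : R, is_derive x 1 F (f x)) ->
  (\int[@lebesgue_measure R]_(x in `]a, b]) (f x)%:E = (F b - F a)%:E)%E.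
Proof.
move=> ab cf dF; move: ab; rewrite le_eqVlt => /predU1P[<-|ab].
  by rewrite subrr set_itvoc0 integral_set0.
rewrite integral_itv_obnd_cbnd; last first.
  by apply/measurable_EFinP; apply: measurable_funTS; exact: continuous_measurable_fun.
have cF : continuous F.
  move=> x; apply: differentiable_continuous; apply/derivable1_diffP.
  exact: ex_derive.
rewrite (@continuous_FTC2 _ f F)//.
- by apply: continuous_subspaceT => x; exact: cf.
- split=> [x _||]; first exact: ex_derive.
    by apply: cvg_at_right_filter; exact: cF.
  by apply: cvg_at_left_filter; exact: cF.
- by move=> x _; rewrite derive1E; apply: derive_val.
Qed.

Lemma integral_oc_cos (R : realType) (v a b : R) : a <= b -> v != 0 ->
  (\int[@lebesgue_measure R]_(x in `]a, b]) (cos (v * x))%:E =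
   ((sin (v * b) - sin (v * a)) / v)%:E)%E.
Proof.
move=> ab v0.
have dF (x : R) : is_derive x 1 (fun x => v^-1 * sin (v * x)) (cos (v * x)).
  apply: is_derive_eq; rewrite /GRing.scale /= ?scaler1 ?mulr1.
  by rewrite ?mulNr ?mulrN ?opprK mulrC mulfK.
have cf : continuous (fun x => cos (v * x)).
  move=> x; apply: (@continuous_comp _ _ _ ( *%R v) cos).
    exact: mulrl_continuous.
  exact: continuous_cos.
rewrite (integral_oc_antiderivative ab cf dF).
by congr (_%:E); ring.
Qed.

Lemma integral_oc_sin (R : realType) (v a b : R) : a <= b -> v != 0 ->
  (\int[@lebesgue_measure R]_(x in `]a, b]) (sin (v * x))%:E =
   ((cos (v * a) - cos (v * b)) / v)%:E)%E.
Proof.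
move=> ab v0.
have dF (x : R) : is_derive x 1 (fun x => (- v^-1) * cos (v * x)) (sin (v * x)).
  apply: is_derive_eq; rewrite /GRing.scale /= ?scaler1 ?mulr1.
  by rewrite ?mulNr ?mulrN ?opprK mulrC mulfK.
have cf : continuous (fun x => sin (v * x)).
  move=> x; apply: (@continuous_comp _ _ _ ( *%R v) sin).
    exact: mulrl_continuous.
  exact: continuous_sin.
rewrite (integral_oc_antiderivative ab cf dF).
by congr (_%:E); ring.
Qed.
Lemma int1E (u : RR -> RR) : leb1.-integrable setT (EFin \o u) ->
  int1 u = fine (\int[leb1]_x (u x)%:E)%E.
Proof.
move=> iu; rewrite [in RHS]integralE fineB; last 2 first.
- exact: integrable_pos_fin_num.
- exact: integrable_neg_fin_num.
rewrite /int1 /intR; congr (fine _ - fine _).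
  rewrite (intRd1 (fun r => (Num.max (u r) 0)%:E)).
  by apply: eq_integral => x _; rewrite funeposE EFin_max.
rewrite (intRd1 (fun r => (Num.max (- u r) 0)%:E)).
by apply: eq_integral => x _; rewrite funenegE EFin_max.
Qed.

Lemma measurable_fun_cV1 (u : RR -> RR) :
  measurable_fun setT u -> measurable_fun setT (fun x : 'cV[RR]_1 => u (x ord0 0)).
Proof. by move=> mu; exact: (measurableT_comp mu (measurable_coord _)). Qed.

Lemma rint1P (u : RR -> RR) : rint1 u <-> leb1.-integrable setT (EFin \o u).
Proof.
have E : measurable_fun setT u ->
    (\int[@leb 1]_x `|(u (x ord0 0%R))%:E| = \int[leb1]_x `|(u x)%:E|)%E.
  move=> mu; rewrite -(intRd1 (fun r => `|(u r)%:E|)%E) -integral_leb//.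
  apply/measurable_EFinP; apply: measurableT_comp => //; exact: measurable_fun_cV1.
split=> /integrableP[/measurable_EFinP mu iu].
  have mu' := measurable_fun_of_cV1 mu.
  by apply/integrableP; split; [exact/measurable_EFinP|rewrite /comp -E].
apply/integrableP; split; first by apply/measurable_EFinP; exact: measurable_fun_cV1.
by rewrite /comp E.
Qed.

Lemma leb1_set1 (r : RR) : leb1 [set r] = 0%E.
Proof. exact: lebesgue_measure_set1. Qed.

(** Closed formulas for transforms of intervals divide by the frequency; the single point 0 is
    discarded here. *)
Lemma ae_leb1 (P : RR -> Prop) : (forall v, v != 0 -> P v) -> {ae leb1, forall v, P v}.
Proof.
move=> H; exists [set 0]; split => //; first exact: leb1_set1.
by move=> v /= nP; apply: contrapT => v0; apply: nP; apply: H; apply/eqP.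
Qed.

Lemma ge0_ae_eq_leb1 (u u' : RR -> RR) : (forall v, 0 <= u v) -> (forall v, 0 <= u' v) ->
  measurable_fun setT u -> measurable_fun setT u' -> (forall v, v != 0 -> u v = u' v) ->
  (\int[leb1]_v (u v)%:E = \int[leb1]_v (u' v)%:E)%E.
Proof.
move=> u0 u0' mu mu' E; apply: ge0_ae_eq_integral => //.
- exact/measurable_EFinP.
- exact/measurable_EFinP.
- by move=> v _; rewrite lee_fin.
- by move=> v _; rewrite lee_fin.
- by apply: ae_leb1 => v v0 _ /=; rewrite E.
Qed.

Lemma int1_ae (u u' : RR -> RR) : measurable_fun setT u -> measurable_fun setT u' ->
  (forall v, v != 0 -> u v = u' v) -> int1 u = int1 u'.
Proof.
move=> mu mu' E; rewrite /int1 /intR.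
have m0 (f : RR -> RR) v : 0 <= Num.max (f v) 0 by rewrite le_max lexx orbT.
rewrite (intRd1 (fun r => (Num.max (u r) 0)%:E)) (intRd1 (fun r => (Num.max (u' r) 0)%:E)).
rewrite (intRd1 (fun r => (Num.max (- u r) 0)%:E)) (intRd1 (fun r => (Num.max (- u' r) 0)%:E)).
congr (fine _ - fine _); apply: ge0_ae_eq_leb1 => //.
- exact: measurable_maxr.
- exact: measurable_maxr.
- by move=> v v0; rewrite E.
- by apply: measurable_maxr => //; apply: measurableT_comp.
- by apply: measurable_maxr => //; apply: measurableT_comp.
- by move=> v v0; rewrite E.
Qed.

Lemma integral_leb1_scale (c : RR) (f : RR -> \bar RR) : 0 < c ->
  (forall x, 0 <= f x)%E -> measurable_fun setT f ->
  (\int[leb1]_x f x = c%:E * \int[leb1]_x f (c * x)%R)%E.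
Proof.
move=> c0 f0 mf.
have ms : measurable_fun setT (fun x : RR => c * x) by apply: measurable_funM.
have E := ge0_integral_pushforward ms leb1 measurableT mf (fun y _ => f0 y).
rewrite preimage_setT in E; rewrite -E.
pose cn : {nonneg RR} := NngNum (ltW c0).
rewrite -(ge0_integral_mscale _ measurableT cn)//.
apply: eq_measure_integral => A mA _.
apply: (@lebesgue_measure_unique RR) => //= _ [[u v]] _ <-.
have P : (fun x => c * x) @^-1` `]u, v]%classic = `]u / c, v / c]%classic.
  by apply/seteqP; split => x /=; rewrite !in_itv/= ltr_pdivrMr// ler_pdivlMr// mulrC.
change (lebesgue_measure `]u, v]%classic =
  c%:E * leb1 ((fun x : RR => (c * x)%R) @^-1` `]u, v]%classic))%E.
rewrite P lebesgue_measure_itv [X in (_ * X)%E]lebesgue_measure_itv/= !lte_fin ltr_pM2r ?invr_gt0//.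
by case: ifP => // _; rewrite ?mule0// -EFinM; congr (_%:E); field; rewrite gt_eqF.
Qed.

(** * Fourier transforms of intervals and their chord integrals *)

Definition itvC (a b t : RR) : CC := Cof (\1_(`]a, b]%classic) t).
Definition fourier_itv (a b v : RR) : CC :=
  intC1 (fun t => itvC a b t * expi (- (2 * pi * (v * t)))).

Lemma rint1_itv (a b : RR) : rint1 (\1_(`]a, b]%classic) : RR -> RR).
Proof.
apply/rint1P; apply/integrableP; split.
  by apply/measurable_EFinP; exact: measurable_indic.
under eq_integral do rewrite /= ger0_norm//.
rewrite integral_indic// setIT; apply: le_lt_trans (ltry (Num.max a b - a)).
rewrite -leb1_itvoc; last by rewrite le_max lexx.
apply: le_measure; rewrite ?inE//.
by move=> x /=; rewrite !in_itv/= le_max => /andP[-> ->]; rewrite orbT.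
Qed.

Lemma cint1_itv a b : cint1 (itvC a b).
Proof. by split; [exact: rint1_itv|exact: integrable0]. Qed.

Lemma cint1_fourier_itv a b v :
  cint1 (fun t => itvC a b t * expi (- (2 * pi * (v * t)))).
Proof.
apply: (cint_unimod (cint1_itv a b)); last by move=> x; rewrite abs2_expi.
apply: cmeas_expi; apply: (measurable_fun_cV1 (u := fun t => - (2 * pi * (v * t)))).
by apply: measurableT_comp => //; apply: measurable_funM => //; exact: measurable_funM.
Qed.

Lemma int1_itvM (a b : RR) (f : RR -> RR) (l : RR) : measurable_fun setT f ->
  rint1 (fun t => \1_(`]a, b]%classic) t * f t) ->
  (\int[leb1]_(x in `]a, b]) (f x)%:E = l%:E)%E ->
  int1 (fun t => \1_(`]a, b]%classic) t * f t) = l.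
Proof.
move=> mf /rint1P iu E; rewrite (int1E iu) (_ : (\int[_]_x _)%E = l%:E)//.
rewrite -E [RHS]integral_mkcond; apply: eq_integral => x _.
rewrite patchE indicE; case: ifPn => _; last by rewrite mul0r.
by rewrite mul1r.
Qed.

Lemma fourier_itvE a b v : a <= b -> v != 0 -> let c := 2 * pi * v in
  fourier_itv a b v = Complex ((sin (c * b) - sin (c * a)) / c) ((cos (c * b) - cos (c * a)) / c).
Proof.
move=> ab v0 c; have c0 : c != 0 by rewrite !mulf_neq0// gt_eqF// pi_gt0.
have [i1 i2] := cint1_fourier_itv a b v.
have ER t : ReC (itvC a b t * expi (- (2 * pi * (v * t)))) =
    \1_(`]a, b]%classic) t * cos (c * t).
  by rewrite /itvC /Cof /expi !CCE mul0r subr0 cosN /c !mulrA.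
have EI t : ImC (itvC a b t * expi (- (2 * pi * (v * t)))) =
    \1_(`]a, b]%classic) t * (- sin (c * t)).
  by rewrite /itvC /Cof /expi !CCE mul0r addr0 sinN /c !mulrA.
have mcos : measurable_fun setT (fun t => cos (c * t) : RR).
  apply: (measurableT_comp (f := @cos RR)); last exact: measurable_funM.
  by apply: continuous_measurable_fun; exact: continuous_cos.
have msin : measurable_fun setT (fun t => sin (c * t) : RR).
  apply: (measurableT_comp (f := @sin RR)); last exact: measurable_funM.
  by apply: continuous_measurable_fun; exact: continuous_sin.
apply: CC_eqP; rewrite !CCE.
  have E := @int1_itvM a b (fun t => cos (c * t)) _ mcos _ (integral_oc_cos ab c0).
  rewrite -E.
    by congr intR; apply/funext => x; exact: ER.
  by move: i1; congr rint; apply/funext => x; exact: ER.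
have irs : rint1 (fun t => \1_(`]a, b]%classic) t * sin (c * t)).
  move/rintN : i2; congr rint; apply/funext => x; rewrite /= EI; ring.
have E := @int1_itvM a b (fun t => sin (c * t)) _ msin irs (integral_oc_sin ab c0).
rewrite -opprB mulNr -E -intRN//.
by congr intR; apply/funext => x; rewrite /= EI mulrN.
Qed.

Lemma measurable_invr : measurable_fun setT (fun r : RR => r^-1).
Proof.
have o : open [set r : RR | r != 0] by exact: open_neq.
rewrite -(setUv [set r : RR | r != 0]) measurable_funU; last 2 first.
- exact: open_measurable.
- by apply: measurableC; exact: open_measurable.
split.
  apply: open_continuous_measurable_fun => // r /set_mem /= r0.
  exact: inv_continuous.
apply: (@eq_measurable_fun _ _ RR RR _ (fun=> 0)); last exact: measurable_cst.
by move=> r /set_mem /= /negP/negPn/eqP ->; rewrite invr0.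
Qed.

(* For [v <> 0] this is half of the squared modulus of the Fourier transform of the
   indicator of an interval of length [`|x|]; at [v = 0] it has the junk value 0. *)
Definition chord (x v : RR) : RR := (1 - cos (2 * pi * v * x)) / (2 * pi * v) ^+ 2.

Lemma chord_ge0 x v : 0 <= chord x v.
Proof. by rewrite divr_ge0 ?sqr_ge0// subr_ge0 cos_le1. Qed.

Lemma measurable_chord x : measurable_fun setT (chord x).
Proof.
apply: measurable_funM.
  apply: measurable_funB => //; apply: (measurableT_comp (f := @cos RR)).
    by apply: continuous_measurable_fun; exact: continuous_cos.
  by apply: measurable_funM => //; exact: measurable_funM.
apply: (measurableT_comp measurable_invr).
by apply: measurable_funX; exact: measurable_funM.
Qed.

Lemma abs2_fourier_itv a b v : a <= b -> v != 0 ->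
  abs2 (fourier_itv a b v) = 2 * chord (b - a) v.
Proof.
move=> ab v0; have c0 : 2 * pi * v != 0 :> RR by rewrite !mulf_neq0// gt_eqF// pi_gt0.
rewrite fourier_itvE// /abs2 !CCE /chord mulrBr cosB.
have := cos2Dsin2 (2 * pi * v * a); have := cos2Dsin2 (2 * pi * v * b).
move: (2 * pi * v) c0 => c c0; move: (cos (c * a)) (cos (c * b)) (sin (c * a)) (sin (c * b)).
move=> ca cb sa sb h1 h2.
rewrite !expr_div_n -mulrDl mulrA; congr (_ / _).
by rewrite !sqrrB; lra.
Qed.
Definition chord_integral (x : RR) : \bar RR := (\int[leb1]_v (chord x v)%:E)%E.

Lemma chord_integral_ge0 x : (0 <= chord_integral x)%E.
Proof. by apply: integral_ge0 => v _; rewrite lee_fin chord_ge0. Qed.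

Lemma chord0 v : chord 0 v = 0.
Proof. by rewrite /chord mulr0 cos0 subrr mul0r. Qed.

Lemma chordN x v : chord (- x) v = chord x v.
Proof. by rewrite /chord mulrN cosN. Qed.

(* By scaling, the integral is a multiple of [`|x|]. This suffices for the
   orthogonality of disjoint intervals, and the constant is never computed. *)
Lemma chord_integral_scale x : chord_integral x = (`|x|%:E * chord_integral 1%R)%E.
Proof.
have H y : 0 < y -> chord_integral y = (y%:E * chord_integral 1%R)%E.
  move=> y0; rewrite /chord_integral.
  rewrite (integral_leb1_scale (c := y) (f := fun v => (chord 1 v)%:E))//; last 2 first.
  - by move=> v; rewrite lee_fin chord_ge0.
  - by apply/measurable_EFinP; exact: measurable_chord.
  have y2 : 0 <= y * y by rewrite mulr_ge0// ltW.
  rewrite muleA -EFinM -ge0_integralZl_EFin//; last 2 first.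
  - by move=> v _; rewrite lee_fin chord_ge0.
  - apply/measurable_EFinP; apply: (measurableT_comp (measurable_chord 1)).
    exact: measurable_funM.
  apply: eq_integral => v _; rewrite -EFinM; congr (_%:E).
  rewrite /chord mulr1 (_ : 2 * pi * (y * v) = 2 * pi * v * y); last by ring.
  rewrite [in RHS]exprMn [in RHS]invfM; set A := 1 - _; set B := (_ ^+ 2)^-1.
  by field; rewrite gt_eqF.
case: (ltrgt0P x) => [x0|x0|->].
- exact: H.
- by rewrite -H ?oppr_gt0// /chord_integral; apply: eq_integral => v _; rewrite chordN.
- by rewrite mul0e /chord_integral; apply: integral0_eq => v _; rewrite chord0.
Qed.

(** Each component integrates a function dominated by the indicator of an interval of length 1, so
    its square is at most 1. *)
Lemma fourier_itv_abs2_le v : abs2 (fourier_itv 0 1 v) <= 2.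
Proof.
have H u : rint1 u -> (forall t, `|u t| <= \1_(`]0, 1]%classic) t) -> int1 u ^+ 2 <= 1.
  move=> iu uv; rewrite -[leRHS](expr1n _ 2) -real_normK ?num_real// lerXn2r ?nnegrE//.
  have <- : int1 (\1_(`]0, 1]%classic) : RR -> RR) = 1.
    rewrite int1E; last exact/rint1P/rint1_itv.
    rewrite (_ : (\int[_]_x _)%E = 1%E)// integral_indic// setIT.
    by apply: etrans (leb1_itvoc ler01) _; rewrite subr0.
  by apply: intR_normle => //; exact: rint1_itv.
have [i1 i2] := cint1_fourier_itv 0 1 v.
have B (z : CC) (t : RR) : abs2 z = \1_(`]0, 1]%classic) t ->
    `|ReC z| <= \1_(`]0, 1]%classic) t /\ `|ImC z| <= \1_(`]0, 1]%classic) t.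
  have K (r s : RR) (b : bool) : r ^+ 2 + s ^+ 2 = b%:R -> `|r| <= b%:R.
    move=> rs; rewrite -(@ler_pXn2r _ 2)// ?nnegrE// real_normK ?num_real//.
    have s2 := sqr_ge0 s; apply: (@le_trans _ _ b%:R); first by rewrite -rs lerDl.
    by case: b {rs}; rewrite ?expr1n ?expr0n.
  rewrite indicE /abs2 => E; split; first exact: K E.
  by move: E; rewrite addrC => /K.
have E t : abs2 (itvC 0 1 t * expi (- (2 * pi * (v * t)))) = \1_(`]0, 1]%classic) t.
  by rewrite abs2M abs2_expi mulr1 abs2_indic.
rewrite /abs2 -[leRHS]/(1 + 1) lerD//.
  by apply: (H (fun t => ReC (itvC 0 1 t * expi (- (2 * pi * (v * t)))))) => // t; exact: (B _ _ (E t)).1.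
by apply: (H (fun t => ImC (itvC 0 1 t * expi (- (2 * pi * (v * t)))))) => // t; exact: (B _ _ (E t)).2.
Qed.

(** The bounds 1, useful near 0, and [v^-2], useful at infinity, combine into a multiple of
    [1 / (1 + v^2)]. *)
Lemma chord1_le v : v != 0 -> chord 1 v <= 2 * (oneDsqr v)^-1.
Proof.
move=> v0.
have p2 : 2 <= pi :> RR := pi_ge2 _.
have h1 : chord 1 v <= 1.
  have := fourier_itv_abs2_le v; rewrite abs2_fourier_itv// subr0.
  by rewrite -[leRHS]mulr1 ler_pM2l.
have h2 : chord 1 v <= (v ^+ 2)^-1.
  have c1 := cos_geN1 (2 * pi * v).
  rewrite /chord mulr1 ler_pdivrMr; last by rewrite exprn_even_gt0//= !mulf_neq0// gt_eqF// pi_gt0.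
  rewrite exprMn mulrCA mulVf ?expf_neq0// mulr1.
  (* The numerator is at most 2, hence at most 4, and [4 <= (2 pi)^2]. *)
  apply: (@le_trans _ _ (2 ^+ 2)); first by rewrite expr2; lra.
  by rewrite lerXn2r// ?nnegrE ?mulr_ge0 ?pi_ge0//; lra.
have o0 : 0 < oneDsqr v by rewrite (lt_le_trans _ (oneDsqr_ge1 v)).
rewrite ler_pdivlMr//.
have g0 := chord_ge0 1 v.
have : chord 1 v * v ^+ 2 <= 1 by rewrite -ler_pdivlMr ?mul1r// exprn_even_gt0.
rewrite /oneDsqr; lra.
Qed.

(** By evenness the integral reduces to the half line, where its value is known. *)
Lemma integral_oneDsqr_fin (R : realType) :
  (\int[@lebesgue_measure R]_v ((oneDsqr v)^-1)%:E < +oo)%E.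
Proof.
rewrite (ge0_symfun_integralT (f := fun v : R => (oneDsqr v)^-1)).
- rewrite (_ : [set x | _] = `[0, +oo[%classic); last first.
    by apply/seteqP; split => x/=; rewrite in_itv/= andbT.
  by rewrite integral0y_oneDsqr -EFinM ltry.
- by move=> x; rewrite invr_ge0 (le_trans _ (oneDsqr_ge1 x)).
- exact: continuous_oneDsqrV.
- by move=> x /=; rewrite /oneDsqr sqrrN.
Qed.

Lemma chord_integral1_fin : (chord_integral 1%R < +oo)%E.
Proof.
have moD : measurable_fun setT (fun v : RR => (oneDsqr v)^-1).
  by apply: continuous_measurable_fun; exact: continuous_oneDsqrV.
have o0 (v : RR) : 0 <= (oneDsqr v)^-1 by rewrite invr_ge0 (le_trans _ (oneDsqr_ge1 v)).
apply: (@le_lt_trans _ _ (\int[leb1]_v (2%:E * ((oneDsqr v)^-1)%:E))%E); last first.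
  rewrite ge0_integralZl_EFin//.
  - by apply: lte_mul_pinfty => //; exact: integral_oneDsqr_fin.
  - exact/measurable_EFinP.
apply: ae_ge0_le_integral => //.
- by move=> v _; rewrite lee_fin chord_ge0.
- by apply/measurable_EFinP; exact: measurable_chord.
- by apply: measurable_funeM; exact/measurable_EFinP.
- by apply: ae_leb1 => v v0 _; rewrite -EFinM lee_fin chord1_le.
Qed.

(** Positivity is needed because [kappa] is inverted in the lower bound for the Fourier
    transform. *)
Lemma chord_integral1_gt0 : (0 < chord_integral 1%R)%E.
Proof.
have p0 : 0 < pi :> RR := pi_gt0 _.
(* On this interval [2 pi v] lies between [pi / 2] and [pi], so the cosine is nonpositive and the
   numerator at least 1, while [r * (2 pi v)^2 = v^2 <= 1]. *)
pose a : RR := 1/4; pose b : RR := 1/2.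
pose r : RR := (1/4 * (pi ^+ 2)^-1).
have r0 : 0 < r by rewrite mulr_gt0// invr_gt0 exprn_gt0.
apply: (@lt_le_trans _ _ (\int[leb1]_(v in `]a, b]) (cst r%:E v))%E).
  rewrite integral_cst//= leb1_itvoc; last by rewrite /a /b; lra.
  by rewrite -EFinM lte_fin mulr_gt0// /a /b; lra.
apply: (@le_trans _ _ (\int[leb1]_(v in `]a, b]) (chord 1 v)%:E)%E).
  apply: ge0_le_integral => //.
  - by move=> v _; rewrite lee_fin ltW.
  - by apply/measurable_EFinP; apply: measurable_funTS; exact: measurable_chord.
  move=> v; rewrite /= in_itv/= => /andP[v1 v2]; rewrite lee_fin.
  move: v1 v2; rewrite /a /b => v1 v2; have v0 : 0 < v by lra.
  rewrite /chord mulr1 ler_pdivlMr; last by rewrite exprn_gt0// !mulr_gt0.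
  have c0 : cos (2 * pi * v) <= 0.
    rewrite -[2 * pi * v](subrK pi) cosDpi oppr_le0 cos_ge0_pihalf//.
    by apply/andP; split; nra.
  apply: (@le_trans _ _ 1); last by lra.
  rewrite (_ : r * _ = v ^+ 2); last first.
    have pn : pi != 0 :> RR by rewrite gt_eqF.
    by rewrite /r; move: (pi : RR) pn => p pn; field.
  by rewrite expr2; nra.
apply: ge0_subset_integral => //.
- by apply/measurable_EFinP; exact: measurable_chord.
- by move=> v _; rewrite lee_fin chord_ge0.
Qed.
Lemma fourier_itv_fourierL1 (a b : RR) (w : 'cV[RR]_1) :
  fourier_itv a b (w ord0 0) = fourierL1 (fun t : 'cV[RR]_1 => itvC a b (t ord0 0)) w.
Proof.
by congr intC; apply/funext => t; rewrite /dotp big_ord1.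
Qed.

Lemma cmeas_fourier_itv (a b : RR) :
  cmeas (fun w : 'cV[RR]_1 => fourier_itv a b (w ord0 0)).
Proof.
under eq_fun do rewrite fourier_itv_fourierL1.
by apply: cmeas_fourierL1; apply: cint_meas; exact: cint1_itv.
Qed.

Lemma fourier_itv_conj a b v : fourier_itv a b (- v) = conjC (fourier_itv a b v).
Proof.
rewrite /fourier_itv -intC_conj; last exact: cint1_fourier_itv.
congr intC; apply/funext => t; rewrite conjCM conj_expi mulNr mulrN.
by congr (_ * _); rewrite /itvC /conjC /Cof !CCE oppr0.
Qed.

Lemma int1_chord x : rint1 (chord x) /\ int1 (chord x) = `|x| * fine (chord_integral 1).
Proof.
have cf : chord_integral 1 \is a fin_num by rewrite ge0_fin_numE ?chord_integral1_fin// chord_integral_ge0.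
have i : rint1 (chord x).
  apply/rint1P; apply/integrableP; split; first by apply/measurable_EFinP; exact: measurable_chord.
  rewrite (_ : (\int[_]_x _)%E = chord_integral x).
    by rewrite chord_integral_scale -(fineK cf) -EFinM ltry.
  by apply: eq_integral => v _; rewrite /= ger0_norm// chord_ge0.
split => //; rewrite int1E; last exact/rint1P.
by rewrite -/(chord_integral x) chord_integral_scale -{1}(fineK cf) -EFinM.
Qed.

Lemma L2_fourier_itv (a b : RR) : a <= b ->
  L2 (fun w : 'cV[RR]_1 => fourier_itv a b (w ord0 0)).
Proof.
move=> ab; apply/L2P; split; first exact: cmeas_fourier_itv.
rewrite /nrm2 (intRd1 (fun v => (abs2 (fourier_itv a b v))%:E)).
have mF : measurable_fun setT (fun v => abs2 (fourier_itv a b v)).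
  apply: measurable_fun_of_cV1; exact: (measurable_abs2 (cmeas_fourier_itv a b)).
have mc : measurable_fun setT (fun v => 2 * chord (b - a) v).
  by apply: measurable_funM => //; exact: measurable_chord.
rewrite (ge0_ae_eq_leb1 _ _ mF mc).
- have [/rint1P ic _] := int1_chord (b - a).
  have := integrableZl measurableT 2 ic => /integrableP[_].
  apply: le_lt_trans; apply: ge0_le_integral => //.
  + by move=> v _; rewrite lee_fin mulr_ge0// chord_ge0.
  + exact/measurable_EFinP.
  + by apply: measurableT_comp => //; exact/measurable_EFinP.
  + by move=> v _; rewrite -EFinM /= lee_fin ler_norm.
- by move=> v; exact: abs2_ge0.
- by move=> v; rewrite mulr_ge0// chord_ge0.
- by move=> v v0; rewrite abs2_fourier_itv.
Qed.

Lemma gram_itv (a b a' b' : RR) :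
  intC1 (fun t => itvC a b t * conjC (itvC a' b' t)) =
  Cof (Num.max 0 (Num.min b b' - Num.max a a')).
Proof.
set lo := Num.max a a'; set hi := Num.min b b'.
transitivity (intC1 (itvC lo hi)).
  congr intC; apply/funext => x; rewrite /itvC.
  set t := x ord0 0; rewrite !indicE !mem_setE !in_itv/= gt_max le_min.
  rewrite (_ : [&& a < t & a' < t] && ((t <= b) && (t <= b')) = ((a < t <= b) && (a' < t <= b'))).
    have K (A B : bool) : Cof (A && B)%:R = Cof A%:R * conjC (Cof B%:R).
      by case: A; case: B; rewrite /Cof; apply: CC_eqP; rewrite !CCE /=; ring.
    exact/esym/K.
  by case: (a < t); case: (a' < t); case: (t <= b); case: (t <= b').
apply: CC_eqP; last exact: (congr1 ImC (@intC0 1)).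
have /rint1P/int1E H := rint1_itv lo hi; apply: etrans H _.
rewrite integral_indic// setIT; have [lh|hl] := leP lo hi.
  apply: etrans (congr1 fine (leb1_itvoc lh)) _.
  by rewrite /= max_r// subr_ge0.
rewrite set_itv_ge ?measure0 ?max_l ?subr_le0 ?ltW//.
by rewrite bnd_simp -leNgt ltW.
Qed.

(** The Plancherel constant of this normalization, equal to 1 by Plancherel's theorem; the argument
    relies on its positivity only. *)
Definition kappa : RR := 2 * fine (chord_integral 1).

Lemma kappa_gt0 : 0 < kappa.
Proof.
by rewrite mulr_gt0// fine_gt0// chord_integral1_gt0 chord_integral1_fin.
Qed.

(** A second difference of the absolute value measures the overlap of two intervals; this turns four
    chord integrals into one inner product. *)
Lemma overlap_length (a b a' b' : RR) : a <= b -> a' <= b' ->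
  `|b - a'| + `|a - b'| - (`|b - b'| + `|a - a'|) =
  2 * Num.max 0 (Num.min b b' - Num.max a a').
Proof.
move=> ab ab'.
have nL (x y : RR) : x <= y -> `|x - y| = y - x.
  by move=> xy; rewrite ler0_norm ?opprB// subr_le0.
have nR (x y : RR) : x <= y -> `|y - x| = y - x by move=> xy; rewrite distrC nL.
have [h1|/ltW h1] := leP a a'; have [h2|/ltW h2] := leP b b'.
- rewrite (nL a b' (le_trans ab h2)) (nL b b' h2) (nL a a' h1).
  by have [h|/ltW h] := leP a' b; [rewrite nR// max_r|rewrite nL// max_l]; lra.
- rewrite (nR a' b (le_trans ab' h2)) (nL a b' (le_trans h1 ab')) (nR b' b h2) (nL a a' h1).
  by rewrite max_r; lra.
- rewrite (nR a' b (le_trans h1 ab)) (nL a b' (le_trans ab h2)) (nL b b' h2) (nR a' a h1).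
  by rewrite max_r; lra.
- rewrite (nR a' b (le_trans h1 ab)) (nR b' b h2) (nR a' a h1).
  by have [h|/ltW h] := leP a b'; [rewrite nL// max_r|rewrite nR// max_l]; lra.
Qed.

Lemma gram_fourier_itv (a b a' b' : RR) : a <= b -> a' <= b' ->
  intC1 (fun v => fourier_itv a b v * conjC (fourier_itv a' b' v)) =
  Cof kappa * intC1 (fun t => itvC a b t * conjC (itvC a' b' t)).
Proof.
move=> ab ab'; rewrite gram_itv.
set P := fun v => fourier_itv a b v * conjC (fourier_itv a' b' v).
have iP : cint1 P.
  by apply: L2M_cint; [exact: L2_fourier_itv|apply: L2_conj; exact: L2_fourier_itv].
(* The reflection of the frequency conjugates the integrand, so the integral equals its own
   conjugate. *)
have Im0 : ImC (intC1 P) = 0.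
  have : intC1 P = conjC (intC1 P).
    rewrite /intC1 -[in LHS]intC_opp; last exact: cint_meas.
    rewrite -intC_conj//; congr intC; apply/funext => x.
    by rewrite /P mxE !fourier_itv_conj conjCM.
  have K (r : RR) : r = - r -> r = 0 by lra.
  by move/(congr1 ImC)/K.
apply: CC_eqP; last by rewrite Im0 !CCE; ring.
(* Expanding the product of the two transforms leaves four cosines of differences of endpoints; the
   constants 1 cancel, which lets each cosine become a [chord]. *)
pose Q v := ((chord (b - a') v + chord (a - b') v) + - (chord (b - b') v + chord (a - a') v)).
have [i1 e1] := int1_chord (b - a'); have [i2 e2] := int1_chord (a - b').
have [i3 e3] := int1_chord (b - b'); have [i4 e4] := int1_chord (a - a').
have mQ : measurable_fun setT Q.
  apply: measurable_funD; first by apply: measurable_funD; exact: measurable_chord.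
  by apply: measurableT_comp => //; apply: measurable_funD; exact: measurable_chord.
have mP : measurable_fun setT (fun v => ReC (P v)).
  by apply: measurable_fun_of_cV1; exact: (rint_meas iP.1).
transitivity (int1 (fun v => ReC (P v))); first by [].
rewrite (int1_ae mP mQ); last first.
  move=> v v0; rewrite /P !fourier_itvE// /Q /chord !CCE !mulrBr !cosB.
  have c0 : 2 * pi * v != 0 :> RR by rewrite !mulf_neq0// gt_eqF// pi_gt0.
  move: (2 * pi * v) c0 => c c0; field.
  exact: c0.
transitivity ((int1 (chord (b - a')) + int1 (chord (a - b'))) -
   (int1 (chord (b - b')) + int1 (chord (a - a')))).
  by rewrite /int1 /Q !(intRD, intRN)//; [exact: rintD|exact: rintD|exact/rintN/rintD].
rewrite e1 e2 e3 e4 !CCE mul0r subr0 /kappa -!mulrDl -mulrBl mulrAC; congr (_ * _).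
exact: overlap_length.
Qed.

(** * Density of step functions *)

Lemma nd_le_lim (R : realType) (f : R^nat) (a : R) n :
  nondecreasing_seq f -> f @ \oo --> a -> f n <= a.
Proof.
move=> ndf fa; rewrite -(cvg_lim _ fa)//; apply: nondecreasing_cvgn_le => //.
by apply/cvg_ex; exists a.
Qed.

Lemma cvg_mul_sqrB0 (R : realType) (f : R^nat) (a c : R) :
  f @ \oo --> a -> (fun k => c * (a - f k) ^+ 2) @ \oo --> (0 : R).
Proof.
move=> fa; rewrite [X in _ --> X](_ : 0 = c * ((a - a) * (a - a))); last by ring.
under eq_fun do rewrite expr2.
apply: cvgM; first exact: cvg_cst.
by apply: cvgM; apply: cvgB => //; exact: cvg_cst.
Qed.

Lemma nrm2_dct n (u : nat -> 'cV[RR]_n -> CC) (G : 'cV[RR]_n -> CC) :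
  (forall m, cmeas (u m)) -> L2 G -> (forall m x, abs2 (u m x) <= abs2 (G x)) ->
  (forall x, (fun m => abs2 (u m x)) @ \oo --> (0 : RR)) ->
  forall e : RR, 0 < e -> exists m, (nrm2 (u m) < e%:E)%E.
Proof.
move=> mu lG uG u0 e e0.
have H : (fun m => \int[@leb n]_x (abs2 (u m x))%:E)%E @ \oo --> (\int[@leb n]_x (0%:E : \bar RR))%E.
  apply: (@dominated_cvg _ _ _ _ _ measurableT _ _ (fun x => (abs2 (G x))%:E)).
  - by move=> m; apply/measurable_EFinP; exact: measurable_abs2.
  - move=> x _; apply: cvg_EFin; first by near=> m.
    exact: u0.
  - by [].
  - exact: rint_abs2.
  - by move=> m x _; rewrite /= ger0_norm ?abs2_ge0// lee_fin.
rewrite integral0 in H.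
have : \forall m \near \oo, (\int[@leb n]_x (abs2 (u m x))%:E < e%:E)%E.
  have h0 : (0 < e%:E)%E by rewrite lte_fin.
  exact: (H _ (open_ereal_lt' h0)).
move=> [m _ /(_ m (leqnn m)) /= Hm]; exists m.
by rewrite nrm2E.
Unshelve. all: by end_near. Qed.

Lemma nrm2_ltP n (f : 'cV[RR]_n -> CC) (e : RR) : (nrm2 f < e%:E)%E ->
  exists2 r, nrm2 f = r%:E & r < e.
Proof.
move=> fe; have ff : nrm2 f \is a fin_num.
  by rewrite ge0_fin_numE ?nrm2_ge0// (lt_trans fe) ?ltry.
by exists (fine (nrm2 f)); rewrite ?fineK// -lte_fin fineK.
Qed.

Lemma nrm2D_lt n (f g : 'cV[RR]_n -> CC) (e : RR) : cmeas f -> cmeas g ->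
  (nrm2 f < (e / 4)%:E)%E -> (nrm2 g < (e / 4)%:E)%E -> (nrm2 (fun x => f x + g x)%R < e%:E)%E.
Proof.
move=> mf mg /nrm2_ltP[r Er re] /nrm2_ltP[s Es se].
apply: (le_lt_trans (nrm2D mf mg)); rewrite Er Es -!EFinM -EFinD lte_fin; lra.
Qed.

Section step.
Context (n : nat) (N : RR).
Hypothesis N0 : 0 <= N.
Let Q := @cube n N.
Let mQ : measurable Q := measurable_box _ _.

Definition boxC (a b : 'I_n -> RR) (t : 'cV[RR]_n) : CC := Cof (\1_(box a b) t).

Lemma boxC_prod a b t : boxC a b t = \prod_i itvC (a i) (b i) (t i 0).
Proof.
rewrite /boxC indic_box /itvC (big_morph Cof (id1 := 1) (op1 := *%R))//.
by move=> x y; apply: CC_eqP; rewrite /Cof !CCE; ring.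
Qed.

Lemma cmeas_boxC a b : cmeas (boxC a b).
Proof. by apply: cmeas_Cof; apply: measurable_indic; exact: measurable_box. Qed.

Definition step (l : seq (CC * (('I_n -> RR) * ('I_n -> RR)))) (t : 'cV[RR]_n) : CC :=
  \sum_(p <- l) p.1 * boxC p.2.1 p.2.2 t.

Lemma cmeas_step l : cmeas (step l).
Proof.
by apply: cmeas_sum => p; apply: cmeasM; [exact: cmeas_cst|exact: cmeas_boxC].
Qed.

(** The approximants have to vanish off [Q] as well, so that convergence in L2 forces pointwise
    convergence of the Fourier integrals. *)
Definition step_approx (h : 'cV[RR]_n -> CC) := forall e : RR, 0 < e ->
  exists2 l, forall t, ~ Q t -> step l t = 0 & (nrm2 (fun t => h t - step l t)%R < e%:E)%E.

Lemma step_approxD h k : cmeas h -> cmeas k -> step_approx h -> step_approx k ->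
  step_approx (fun t => h t + k t).
Proof.
move=> mh mk ah ak e e0; have e4 : 0 < e / 4 by rewrite divr_gt0.
have [l lQ hl] := ah _ e4; have [l' lQ' hl'] := ak _ e4.
have E t : step (l ++ l') t = step l t + step l' t by rewrite /step big_cat.
exists (l ++ l'); first by move=> t Qt; rewrite E lQ// lQ'// addr0.
under eq_fun do rewrite E opprD addrACA.
by apply: nrm2D_lt => //; apply: cmeasB => //; exact: cmeas_step.
Qed.

Lemma step_approxZ c h : cmeas h -> step_approx h -> step_approx (fun t => c * h t).
Proof.
move=> mh ah e e0; have c0 : 0 < abs2 c + 1 by rewrite ltr_wpDl// abs2_ge0.
have [l lQ /nrm2_ltP[r Er re]] := ah _ (divr_gt0 e0 c0).
have E t : step [seq (c * p.1, p.2) | p <- l] t = c * step l t.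
  by rewrite /step big_map mulr_sumr; apply: eq_bigr => p _; rewrite mulrA.
exists [seq (c * p.1, p.2) | p <- l]; first by move=> t Qt; rewrite E lQ// mulr0.
under eq_fun do rewrite E -mulrBr.
rewrite nrm2Z; last by apply: cmeasB => //; exact: cmeas_step.
rewrite Er -EFinM lte_fin; move: re; rewrite ltr_pdivlMr// => re.
have r0 : 0 <= r by rewrite -lee_fin -Er nrm2_ge0.
by have := abs2_ge0 c; nra.
Qed.

Lemma step_approx0 : step_approx (fun=> 0).
Proof.
move=> e e0; exists [::]; first by move=> t _; rewrite /step big_nil.
under eq_fun do rewrite /step big_nil subr0.
rewrite /nrm2; under eq_fun do rewrite abs20.
by rewrite intRd0 lte_fin.
Qed.

Lemma step_approx_sum I (s : seq I) (h : I -> 'cV[RR]_n -> CC) :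
  (forall i, cmeas (h i)) -> (forall i, step_approx (h i)) ->
  step_approx (fun t => \sum_(i <- s) h i t).
Proof.
move=> mh ah; elim: s => [|i s IH].
  by under eq_fun do rewrite big_nil; exact: step_approx0.
under eq_fun do rewrite big_cons; apply: step_approxD => //.
exact: cmeas_sum.
Qed.

Lemma step_approx_lim h : cmeas h ->
  (forall e : RR, 0 < e -> exists k, [/\ cmeas k, step_approx k &
     (nrm2 (fun t => h t - k t)%R < e%:E)%E]) -> step_approx h.
Proof.
move=> mh H e e0; have e4 : 0 < e / 4 by rewrite divr_gt0.
have [k [mk ak hk]] := H _ e4; have [l lQ kl] := ak _ e4.
exists l => //; have E t : h t - step l t = (h t - k t) + (k t - step l t).
  by rewrite addrA subrK.
under eq_fun do rewrite E.
by apply: nrm2D_lt => //; apply: cmeasB => //; exact: cmeas_step.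
Qed.

Lemma setI_box (a b a' b' : 'I_n -> RR) :
  box a b `&` box a' b' = box (fun i => Num.max (a i) (a' i)) (fun i => Num.min (b i) (b' i)).
Proof.
apply/seteqP; split=> [t [H H'] i|t H].
  have /andP[h1 h2] := H i; have /andP[h1' h2'] := H' i.
  by rewrite gt_max le_min h1 h2 h1' h2'.
by split => i; have := H i; rewrite gt_max le_min => /andP[/andP[h1 h2] /andP[h3 h4]]; apply/andP.
Qed.

Definition boxes := [set E | exists a b : 'I_n -> RR, E = box a b].

(** A coordinate half-space is a countable union of boxes, so the identity is measurable from the
    sigma-algebra of boxes to the Borel one. *)
Lemma measurable_boxes : @measurable _ 'cV[RR]_n = <<s boxes >>.
Proof.
apply/seteqP; split; last first.
  by apply: smallest_sub; [exact: sigma_algebra_measurable|move=> _ [a [b ->]]; exact: measurable_box].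
move=> E mE.
pose X := g_sigma_algebraType boxes.
have m : measurable_fun setT (id : X -> 'cV[RR]_n).
  apply: measurable_fun_cV => i.
  apply: (@measurability _ _ _ _ _ _ (@RGenOInfty.G RR)).
    exact: RGenOInfty.measurableE.
  move=> _ [_ [r ->] <-]; rewrite setTI.
  rewrite (_ : _ @^-1` _ = \bigcup_k (box (fun j => if j == i then r else - k%:R) (fun=> k%:R))).
    apply: bigcup_measurable => k _; apply: sub_sigma_algebra.
    by exists (fun j => if j == i then r else - k%:R), (fun=> k%:R).
  apply/seteqP; split => t /=; last first.
    by move=> [k _ /(_ i)]; rewrite eqxx in_itv/= andbT => /andP[].
  rewrite in_itv/= andbT => rt.
  have [k tk] : exists k : nat, forall j, `|t j 0| < k%:R.
    exists (Num.bound `|t|) => j; apply: le_lt_trans (archi_boundP (normr_ge0 _)).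
    by apply: (cV_norm_le t (normr_ge0 t)).1.
  exists k => // j; have := tk j; rewrite ltr_norml => /andP[t1 t2].
  by rewrite (ltW t2) andbT; case: eqP => [->|].
have := m measurableT E mE.
by rewrite setTI.
Qed.

(** Dynkin's theorem: boxes are stable under intersection, and the sets that can be approximated
    inside [Q] are stable under complements and countable disjoint unions. *)
Lemma step_approx_measurable (E : set 'cV[RR]_n) : measurable E ->
  step_approx (fun t => Cof (\1_(E `&` Q) t)).
Proof.
have lQ : (leb Q < +oo)%E by exact: leb_cube_fin.
have mI (F : set 'cV[RR]_n) : measurable F -> cmeas (fun t => Cof (\1_(F `&` Q) t)).
  by move=> mF; apply: cmeas_Cof; apply: measurable_indic; exact: measurableI.
have aB a b : step_approx (fun t => Cof (\1_(box a b `&` Q) t)).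
  move=> e e0; pose a' i := Num.max (a i) (- N); pose b' i := Num.min (b i) N.
  have S t : step [:: (1, (a', b'))] t = Cof (\1_(box a b `&` Q) t).
    by rewrite /step big_seq1 /= mul1r /boxC /Q /cube setI_box.
  exists [:: (1, (a', b'))].
    by move=> t Qt; rewrite S Cof_indic0// => -[].
  under eq_fun do rewrite S subrr.
  rewrite /nrm2; under eq_fun do rewrite abs20.
  by rewrite intRd0 lte_fin.
have aQ : step_approx (fun t => Cof (\1_Q t)).
  by have := aB (fun=> - N) (fun=> N); rewrite /Q /cube setIid.
move=> mE; have : <<s boxes >> E by rewrite -measurable_boxes.
move: {mE} E; apply: (@dynkin_induction _ _ boxes (fun E => step_approx (fun t => Cof (\1_(E `&` Q) t)))).
- exact: measurable_boxes.
- by move=> _ _ [a [b ->]] [a' [b' ->]]; rewrite setI_box; eexists _, _.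
- by rewrite setTI.
- by move=> _ [a [b ->]].
- move=> F mF aF.
  have E' t : Cof (\1_(~` F `&` Q) t) = Cof (\1_Q t) + (- 1) * Cof (\1_(F `&` Q) t).
    rewrite !indicE !in_setI in_setC; case: (t \in F); case: (t \in Q) => /=;
      apply: CC_eqP; rewrite /Cof !CCE; ring.
  under eq_fun do rewrite E'.
  apply: step_approxD => //.
  + by apply: cmeas_Cof; exact: measurable_indic.
  + by apply: cmeasM; [exact: cmeas_cst|exact: mI].
  + by apply: step_approxZ => //; exact: mI.
- move=> F mF tF aF; apply: step_approx_lim.
    by apply: mI; exact: bigcup_measurable.
  move=> e e0.
  pose S m t := \sum_(0 <= k < m) Cof (\1_(F k `&` Q) t).
  pose u m t := Cof (\1_((\bigcup_k F k) `&` Q) t) - S m t.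
  have mS m : cmeas (S m) by apply: cmeas_sum => k; exact: mI.
  (* By disjointness at most one [F K] contains [t], and the remainder [u m] equals 1 at [t] exactly
     while [m <= K]. It therefore tends to 0 and is dominated by the indicator of [Q]. *)
  have uE t : exists K, exists2 b : bool, b -> Q t & forall m, u m t = Cof (b && (m <= K)%N)%:R.
    have [[k [Fk Qt]]|H] := pselect (exists k, (F k `&` Q) t).
      exists k, true => // m.
      have Sm : S m t = Cof (k < m)%N%:R.
        rewrite /S; elim: m => [|m IH]; first by rewrite big_nil.
        rewrite big_nat_recr//= IH (_ : (k < m.+1)%N = (k == m) || (k < m)%N); last by rewrite ltnS leq_eqVlt.
        have [<-|km] := eqVneq k m; first by rewrite ltnn/= Cof_indic1// add0r.
        rewrite Cof_indic0 ?addr0// => -[Fm _].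
        by move/eqP : km; apply; apply: tF => //; exists t.
      rewrite /u Sm Cof_indic1; last by split => //; exists k.
      by rewrite [(m <= k)%N]leqNgt; case: (k < m)%N => /=; [exact: subrr|exact: subr0].
    exists 0%N, false => // m.
    rewrite /u /S Cof_indic0; last by move=> [[k _ Fk] Qt]; apply: H; exists k.
    rewrite big1 ?subrr// => k _; rewrite Cof_indic0// => FQ.
    by apply: H; exists k.
  have [m Hm] : exists m, (nrm2 (u m) < e%:E)%E.
    apply: (nrm2_dct (G := fun t => Cof (\1_Q t))) => //.
    + by move=> m; apply: cmeasB => //; apply: mI; exact: bigcup_measurable.
    + exact: L2_indic.
    + move=> m t; have [K [b bQ ->]] := uE t.
      case: b bQ => [/(_ isT) Qt|_]; last by rewrite abs20 abs2_ge0.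
      rewrite Cof_indic1//; case: (_ <= _)%N => //=; by rewrite abs20 abs2_ge0.
    + move=> t; have [K [b _ Hu]] := uE t.
      apply: cvg_near_cst; exists K.+1 => // m /= Km.
      by rewrite Hu leqNgt Km andbF abs20.
  exists (S m); split => //.
  by apply: step_approx_sum => k; [exact: mI|exact: aF].
Qed.

Lemma cmeas_CofI (E : set 'cV[RR]_n) : measurable E -> cmeas (fun t => Cof (\1_E t)).
Proof. by move=> mE; apply: cmeas_Cof; exact: measurable_indic. Qed.

Import HBNNSimple.

Lemma step_approx_sfun (f : {nnsfun 'cV[RR]_n >-> RR}) :
  step_approx (fun t => Cof (\1_Q t * f t)).
Proof.
pose E (y : RR) := f @^-1` [set y].
have mE y : measurable (E y).
  exact: (measurable_sfunP f).
have H t : Cof (\1_Q t * f t) = \sum_(y <- finmap.enum_fset (fset_set (range f))) Cof y * Cof (\1_(E y `&` Q) t).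
  rewrite {1}(fimfunE f) fsbig_finite//= mulr_sumr.
  rewrite (big_morph Cof (id1 := 0) (op1 := +%R))//; last first.
    by move=> x y; apply: CC_eqP; rewrite /Cof !CCE; ring.
  apply: eq_bigr => y _; rewrite indicI; apply: CC_eqP; rewrite /Cof !CCE /=; ring.
under eq_fun do rewrite H.
apply: step_approx_sum => y.
  by apply: cmeasM; [exact: cmeas_cst|apply: cmeas_CofI; exact: measurableI].
apply: step_approxZ; first by apply: cmeas_CofI; exact: measurableI.
exact: step_approx_measurable.
Qed.

(** Simple functions increase to [h], and the error is dominated by [h] itself, so dominated
    convergence yields approximation in L2. *)
Lemma step_approx_ge0 (h : 'cV[RR]_n -> RR) : (forall t, 0 <= h t) ->
  L2 (fun t => Cof (h t)) -> step_approx (fun t => Cof (\1_Q t * h t)).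
Proof.
move=> h0 lh; have [mh _] := L2_cmeas lh.
have mh' : measurable_fun setT (EFin \o h) by exact/measurable_EFinP.
have h0' t : setT t -> (0 <= (EFin \o h) t)%E by rewrite lee_fin.
pose f := nnsfun_approx measurableT mh'.
have mQf k : cmeas (fun t => Cof (\1_Q t * f k t)).
  by apply: cmeas_Cof; apply: measurable_funM => //; exact: measurable_indic.
have mQh : cmeas (fun t => Cof (\1_Q t * h t)).
  by apply: cmeas_Cof; apply: measurable_funM => //; exact: measurable_indic.
apply: step_approx_lim => // e e0.
pose u k t := Cof (\1_Q t * h t) - Cof (\1_Q t * f k t).
have uE k t : abs2 (u k t) = \1_Q t * (h t - f k t) ^+ 2.
  rewrite /u /Cof /abs2 !CCE subrr expr0n addr0 -mulrBr exprMn indicE.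
  by case: (t \in Q); rewrite ?expr1n ?expr0n.
have cf t : f ^~ t @ \oo --> h t.
  have /fine_cvgP[] := cvg_nnsfun_approx measurableT mh' h0' (x := t) Logic.I.
  by move=> _.
have fh k t : 0 <= f k t <= h t.
  apply/andP; split; first exact: fun_ge0.
  apply: (nd_le_lim (f := f ^~ t)) (cf t) => i j ij.
  exact/lefP/nd_nnsfun_approx.
have [k Hk] : exists k, (nrm2 (u k) < e%:E)%E.
  apply: (nrm2_dct (G := fun t => Cof (h t))) => //.
  - by move=> k; apply: cmeasB.
  - move=> k t; rewrite uE /abs2 /Cof !CCE expr0n addr0.
    have /andP[f0 fk] := fh k t.
    apply: (@le_trans _ _ ((h t - f k t) ^+ 2)).
      by rewrite ler_piMl ?sqr_ge0//.
    by rewrite lerXn2r ?nnegrE ?subr_ge0// gerBl.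
  - move=> t; under eq_fun do rewrite uE.
    exact: cvg_mul_sqrB0.
exists (fun t => Cof (\1_Q t * f k t)); split => //.
exact: step_approx_sfun.
Qed.

Lemma step_dense (h : 'cV[RR]_n -> CC) : L2 h -> (forall t, ~ Q t -> h t = 0) ->
  step_approx h.
Proof.
move=> lh hQ; have [mr mi] := L2_cmeas lh.
have H (u : 'cV[RR]_n -> RR) : measurable_fun setT u -> (forall t, u t ^+ 2 <= abs2 (h t)) ->
    cmeas (fun t => Cof (\1_Q t * Num.max (u t) 0)) /\
    step_approx (fun t => Cof (\1_Q t * Num.max (u t) 0)).
  move=> mu uh.
  have mu0 : measurable_fun setT (fun t => Num.max (u t) 0) by exact: measurable_maxr.
  split; first by apply: cmeas_Cof; apply: measurable_funM => //; exact: measurable_indic.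
  apply: (step_approx_ge0 (h := fun t => Num.max (u t) 0)).
    by move=> t; rewrite le_max lexx orbT.
  apply: (L2_le _ lh); first exact: cmeas_Cof.
  move=> t; apply: le_trans (uh t); rewrite /abs2 /Cof !CCE expr0n addr0.
  by case: (leP (u t) 0) => //; rewrite expr0n sqr_ge0.
pose r t := ReC (h t); pose i t := ImC (h t).
have rh t : r t ^+ 2 <= abs2 (h t) by rewrite /abs2 lerDl sqr_ge0.
have ih t : i t ^+ 2 <= abs2 (h t) by rewrite /abs2 lerDr sqr_ge0.
have [m1 a1] := H r mr rh.
have [m2 a2] : cmeas (fun t => Cof (\1_Q t * Num.max (- r t) 0)) /\
    step_approx (fun t => Cof (\1_Q t * Num.max (- r t) 0)).
  apply: (H (fun t => - r t)); first exact: (measurableT_comp (@oppr_measurable _ setT) mr).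
  by move=> t; rewrite sqrrN.
have [m3 a3] := H i mi ih.
have [m4 a4] : cmeas (fun t => Cof (\1_Q t * Num.max (- i t) 0)) /\
    step_approx (fun t => Cof (\1_Q t * Num.max (- i t) 0)).
  apply: (H (fun t => - i t)); first exact: (measurableT_comp (@oppr_measurable _ setT) mi).
  by move=> t; rewrite sqrrN.
have E t : h t = (Cof (\1_Q t * Num.max (r t) 0) + (- 1) * Cof (\1_Q t * Num.max (- r t) 0)) +
    Complex 0 1 * (Cof (\1_Q t * Num.max (i t) 0) + (- 1) * Cof (\1_Q t * Num.max (- i t) 0)).
  have [Qt|Qt] := pselect (Q t); last first.
    rewrite hQ// indicE memNset// !mul0r; apply: CC_eqP; rewrite /Cof !CCE; ring.
  rewrite indicE mem_set// !mul1r; apply: CC_eqP; rewrite /Cof !CCE.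
    by rewrite -/(r t) {1}(max0B (r t)); ring.
  by rewrite -/(i t) {1}(max0B (i t)); ring.
rewrite (funext E).
have mc (c : CC) : cmeas (fun _ : 'cV[RR]_n => c) by exact: cmeas_cst.
have mr' := cmeasD m1 (cmeasM (mc (- 1)) m2); have mi' := cmeasD m3 (cmeasM (mc (- 1)) m4).
apply: step_approxD => //.
- exact: (cmeasM (mc (Complex 0 1)) mi').
- by apply: step_approxD => //; [exact: (cmeasM (mc (- 1)) m2)|exact: step_approxZ].
- apply: (step_approxZ (Complex 0 1) mi').
  by apply: step_approxD => //; [exact: (cmeasM (mc (- 1)) m4)|exact: step_approxZ].
Qed.

End step.

(** * A lower bound for the Fourier transform *)

(** An interval with [b < a] is empty, as is the one with [b] raised to [a]; this extends the Gram
    identity to arbitrary endpoints. *)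
Lemma itvC_max a b : itvC a b = itvC a (Num.max a b).
Proof.
apply/funext => t; rewrite /itvC !indicE !mem_setE !in_itv/= le_max.
by case: (ltP a t) => //= at_; rewrite (leNgt t a) at_.
Qed.

Lemma fourier_itv_max a b : fourier_itv a b = fourier_itv a (Num.max a b).
Proof. by apply/funext => v; rewrite /fourier_itv -itvC_max. Qed.

Lemma cint1_gram_itv a b a' b' : cint1 (fun t => itvC a b t * conjC (itvC a' b' t)).
Proof.
have lI u v : L2 (fun x : 'cV[RR]_1 => itvC u v (x ord0 0)).
  apply/L2P; split; first by apply: cint_meas; exact: cint1_itv.
  have [iR _] := cint1_itv u v.
  have i0 (x : 'cV[RR]_1) : 0 <= \1_(`]u, v]%classic) (x ord0 0) :> RR by [].
  by have [_] := (rint_ge0P i0).1 iR; rewrite /nrm2; under eq_fun do rewrite -abs2_indic.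
by apply: L2M_cint => //; exact: L2_conj.
Qed.

Lemma cint1_gram_fourier_itv a b a' b' :
  cint1 (fun v => fourier_itv a b v * conjC (fourier_itv a' b' v)).
Proof.
have ab u v : u <= Num.max u v :> RR by rewrite le_max lexx.
rewrite fourier_itv_max (fourier_itv_max a').
by apply: L2M_cint; [|apply: L2_conj]; exact: L2_fourier_itv.
Qed.

Lemma gram_fourier_itv_any a b a' b' :
  intC1 (fun v => fourier_itv a b v * conjC (fourier_itv a' b' v)) =
  Cof kappa * intC1 (fun t => itvC a b t * conjC (itvC a' b' t)).
Proof.
have ab u v : u <= Num.max u v :> RR by rewrite le_max lexx.
have := gram_fourier_itv (ab a b) (ab a' b').
by rewrite -!fourier_itv_max -!itvC_max.
Qed.

Section boxes.
Context (n : nat).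
Implicit Types (a b : 'I_n -> RR).

Lemma fourierL1_boxC a b w :
  fourierL1 (boxC a b) w = \prod_i fourier_itv (a i) (b i) (w i 0).
Proof.
have [_ <-] := intC_prod (fun i => cint1_fourier_itv (a i) (b i) (w i 0)).
congr intC; apply/funext => t; rewrite boxC_prod big_split/=; congr (_ * _).
rewrite /dotp mulr_sumr -sumrN (big_morph expi expiD (expi0)).
by apply: eq_bigr.
Qed.

(** Both integrands are products of functions of one coordinate, so each coordinate contributes one
    factor [kappa]. *)
Lemma gram_boxC a b a' b' :
  (cint (fun t => boxC a b t * conjC (boxC a' b' t)) /\
  cint (fun w => fourierL1 (boxC a b) w * conjC (fourierL1 (boxC a' b') w))) /\
  intC (fun w => fourierL1 (boxC a b) w * conjC (fourierL1 (boxC a' b') w)) =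
  Cof (kappa ^+ n) * intC (fun t => boxC a b t * conjC (boxC a' b' t)).
Proof.
have conj1 : conjC 1 = 1 by apply: CC_eqP; rewrite !CCE ?oppr0.
have E1 : (fun t : 'cV[RR]_n => boxC a b t * conjC (boxC a' b' t)) =
    (fun t => \prod_i (itvC (a i) (b i) (t i 0) * conjC (itvC (a' i) (b' i) (t i 0)))).
  by apply/funext => t; rewrite !boxC_prod (big_morph conjC conjCM conj1) big_split.
have E2 : (fun w : 'cV[RR]_n => fourierL1 (boxC a b) w * conjC (fourierL1 (boxC a' b') w)) =
    (fun w => \prod_i (fourier_itv (a i) (b i) (w i 0) * conjC (fourier_itv (a' i) (b' i) (w i 0)))).
  by apply/funext => t; rewrite !fourierL1_boxC (big_morph conjC conjCM conj1) big_split.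
have [c1 e1] := intC_prod (fun i => cint1_gram_itv (a i) (b i) (a' i) (b' i)).
have [c2 e2] := intC_prod (fun i => cint1_gram_fourier_itv (a i) (b i) (a' i) (b' i)).
rewrite E1 E2; split => //; rewrite e1 e2.
have -> : Cof (kappa ^+ n) = \prod_(i < n) Cof kappa.
  rewrite -[in LHS](card_ord n) -prodr_const (big_morph Cof (id1 := 1) (op1 := *%R))//.
  by move=> x y; apply: CC_eqP; rewrite /Cof !CCE; ring.
rewrite -big_split/=; apply: eq_bigr => i _.
exact: gram_fourier_itv_any.
Qed.

Lemma L2_of_gram (f : 'cV[RR]_n -> CC) : cmeas f -> cint (fun t => f t * conjC (f t)) -> L2 f.
Proof.
move=> mf [ir _]; apply/L2P; split => //.
have E : (fun t => abs2 (f t)) = ReC \o (fun t => f t * conjC (f t)).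
  by apply/funext => t; rewrite /= !CCE /abs2; ring.
rewrite -E in ir.
by have [_] := (rint_ge0P (fun t => abs2_ge0 (f t))).1 ir.
Qed.

Lemma L2_boxC a b : L2 (boxC a b).
Proof.
by apply: L2_of_gram; [exact: cmeas_boxC|have [[]] := gram_boxC a b a b].
Qed.

Lemma L2_fourierL1_boxC a b : L2 (fourierL1 (boxC a b)).
Proof.
apply: L2_of_gram; last by have [[]] := gram_boxC a b a b.
by apply: cmeas_fourierL1; exact: cmeas_boxC.
Qed.

Lemma cint_boxC a b : cint (boxC a b).
Proof.
have /L2M_cint H := L2_boxC a b; have := H _ (L2_boxC a b).
congr cint; apply/funext => t; rewrite /boxC indicE.
by case: (_ \in _); rewrite /Cof; apply: CC_eqP; rewrite !CCE /=; ring.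
Qed.

Lemma fourierL1_step l w :
  fourierL1 (@step n l) w = \sum_(p <- l) p.1 * fourierL1 (boxC p.2.1 p.2.2) w.
Proof.
have ci p : cint (fun t => boxC p.2.1 p.2.2 t * expi (- (2 * pi * dotp w t)))
  := cint_unimod (cint_boxC p.2.1 p.2.2) (cmeas_fourier_char w) (fun=> abs2_expi _).
rewrite /fourierL1 /step.
under [X in intC X]eq_fun do rewrite mulr_suml.
under [X in intC X]eq_fun do under eq_bigr do rewrite -mulrA.
rewrite intC_sum; last by move=> p; exact: cintZ.
by apply: eq_bigr => p _; rewrite intCZ.
Qed.

Lemma nrm2_fourierL1_step l :
  nrm2 (fourierL1 (@step n l)) = ((kappa ^+ n)%:E * nrm2 (@step n l))%E.
Proof.
rewrite (funext (fourierL1_step l)) [in RHS]/step (nrm2_sum l (fun p => p.1) (u := fun p => boxC p.2.1 p.2.2)); last first.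
  by move=> p; exact: L2_boxC.
rewrite (nrm2_sum l (fun p => p.1) (u := fun p => fourierL1 (boxC p.2.1 p.2.2))); last first.
  by move=> p; exact: L2_fourierL1_boxC.
rewrite -EFinM; congr (_%:E).
have -> r z : r * ReC z = ReC (Cof r * z) by rewrite /Cof !CCE mul0r subr0.
congr ReC; rewrite mulr_sumr; apply: eq_bigr => p _; rewrite mulr_sumr.
by apply: eq_bigr => q _; rewrite (gram_boxC _ _ _ _).2 mulrCA.
Qed.

End boxes.

Lemma cvg_sqr_small (R : realType) (f : R^nat) (a : R) :
  (forall e, 0 < e -> exists N, forall m, (N <= m)%N -> (a - f m) ^+ 2 < e) ->
  f @ \oo --> a.
Proof.
move=> H; apply/cvgrPdist_lt => e e0; have [N HN] := H (e ^+ 2) (exprn_gt0 2 e0).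
exists N => // m /= Nm; have := HN m Nm.
by rewrite -real_normK ?num_real// ltr_pXn2r// nnegrE ltW.
Qed.

Lemma cvg_abs2_small (v : nat -> CC) (l : CC) :
  (forall e : RR, 0 < e -> exists N, forall m, (N <= m)%N -> abs2 (l - v m) < e) ->
  (fun m => abs2 (v m)) @ \oo --> abs2 l.
Proof.
move=> H.
have Hr : (fun m => ReC (v m)) @ \oo --> ReC l.
  apply: cvg_sqr_small => e /H[N HN]; exists N => m /HN; apply: le_lt_trans.
  by rewrite /abs2 !CCE lerDl sqr_ge0.
have Hi : (fun m => ImC (v m)) @ \oo --> ImC l.
  apply: cvg_sqr_small => e /H[N HN]; exists N => m /HN; apply: le_lt_trans.
  by rewrite /abs2 !CCE lerDr sqr_ge0.
have := cvg_abs2B (z := 0) Hr Hi; rewrite subr0.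
by under eq_fun do rewrite subr0.
Qed.

Section plancherel.
Context (n : nat) (M : RR).
Hypothesis M0 : 0 <= M.
Let Q := @cube n M.

Lemma L2_cube_cint (h : 'cV[RR]_n -> CC) : L2 h -> (forall t, ~ Q t -> h t = 0) -> cint h.
Proof.
move=> lh hQ.
have -> : h = (fun t => Cof (\1_Q t) * h t).
  apply/funext => t; have [Qt|Qt] := pselect (Q t); first by rewrite Cof_indic1// mul1r.
  by rewrite Cof_indic0// mul0r hQ.
by apply: L2M_cint => //; apply: L2_indic; [exact: measurable_box|exact: leb_cube_fin].
Qed.

Lemma L2_step l : L2 (@step n l).
Proof. by apply: L2_sum => p; apply: L2Z; exact: L2_boxC. Qed.

Lemma fourierL1B (h k : 'cV[RR]_n -> CC) w : cint h -> cint k ->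
  fourierL1 (fun t => h t - k t) w = fourierL1 h w - fourierL1 k w.
Proof.
move=> ih ik.
have H (f : 'cV[RR]_n -> CC) : cint f -> cint (fun t => f t * expi (- (2 * pi * dotp w t))).
  by move=> jf; apply: cint_unimod => //; [exact: cmeas_fourier_char|move=> x; exact: abs2_expi].
rewrite /fourierL1 -[X in _ + X]mulN1r -intCZ; last exact: H.
rewrite -intCD; [|exact: H|by apply: cintZ; exact: H].
by congr intC; apply/funext => t; ring.
Qed.

(** The converse estimate, used to control the transform of the error in a step approximation. It
    holds for step functions and passes to [g] by pointwise convergence of the transforms and
    Fatou's lemma. *)
Lemma nrm2_fourierL1_le (g : 'cV[RR]_n -> CC) (e : RR) : 0 < e ->
  L2 g -> (forall t, ~ Q t -> g t = 0) -> (nrm2 g < e%:E)%E ->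
  (nrm2 (fourierL1 g) <= (4 * kappa ^+ n * e)%:E)%E.
Proof.
move=> e0 lg gQ ge; have mg := L2_cmeas lg.
(* The bound by [e] keeps the norms of the approximants below [4 * e]; the bound by [1 / (m + 1)]
   makes them converge. *)
pose d (m : nat) : RR := Num.min e (m.+1%:R)^-1.
have d0 m : 0 < d m by rewrite lt_min e0 /= invr_gt0 ltr0n.
pose l m := s2val (cid2 (step_dense M0 lg gQ (d0 m))).
have lQ m t : ~ Q t -> step (l m) t = 0 by rewrite /l; case: cid2 => //= x Hx _; exact: Hx.
have ld m : (nrm2 (fun t => g t - step (l m) t)%R < (d m)%:E)%E by rewrite /l; case: cid2.
have ls m : L2 (step (l m)) := L2_step (l m).
have cg := L2_cube_cint lg gQ.
have cs m := L2_cube_cint (ls m) (lQ m).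
(* Cut off to [Q], the character lies in L2. Since [g] and the step functions vanish off [Q], their
   transforms at [w] are pairings with it. *)
have lQe w : L2 (fun t => Cof (\1_Q t) * expi (- (2 * pi * dotp w t))).
  under eq_fun do rewrite mulrC.
  apply: L2_unimod; [|exact: cmeas_fourier_char|by move=> x; exact: abs2_expi].
  by apply: L2_indic; [exact: measurable_box|exact: leb_cube_fin].
apply: (nrm2_fatou (u := fun m => fourierL1 (step (l m))) (N := 0)).
- by move=> m; apply: cmeas_fourierL1; exact: cmeas_step.
- exact: cmeas_fourierL1.
- move=> w; apply: cvg_abs2_small => r r0.
  have [del del0 Hdel] := intC_small (lQe w) r0.
  exists (Num.bound del^-1) => m Nm.
  have lB : L2 (fun t => g t - step (l m) t) by exact: L2B.
  have := Hdel _ lB; rewrite -fourierL1B//.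
  rewrite /fourierL1.
  under [X in _ -> abs2 (intC X) < _]eq_fun => t.
    rewrite (_ : _ * _ = (g t - step (l m) t) * (Cof (\1_Q t) * expi (- (2 * pi * dotp w t)))).
      over.
    have [Qt|Qt] := pselect (Q t); first by rewrite Cof_indic1// mul1r.
    by rewrite gQ// lQ// subrr !mul0r.
  apply; apply: (lt_trans (ld m)); rewrite lte_fin /d gt_min; apply/orP; right.
  rewrite invf_plt ?posrE//; apply: (lt_le_trans (archi_boundP _)).
    by rewrite invr_ge0 ltW.
  by rewrite ler_nat (leq_trans Nm).
- move=> m _; rewrite nrm2_fourierL1_step.
  have E : step (l m) = (fun t => g t + - (g t - step (l m) t)).
    by apply/funext => t; rewrite opprB addrC subrK.
  have [r Er re] := nrm2_ltP ge; have [s Es se] := nrm2_ltP (ld m).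
  have mB : cmeas (fun t => g t - step (l m) t) by apply: cmeasB => //; exact: cmeas_step.
  have : (nrm2 (step (l m)) <= (4 * e)%:E)%E.
    rewrite E; apply: (le_trans (nrm2D mg (cmeasN mB))).
    rewrite nrm2N Er Es -!EFinM -EFinD lee_fin.
    have : s < e by apply: (lt_le_trans se); rewrite /d ge_min lexx.
    lra.
  rewrite (L2_nrm2 (ls m)) -EFinM !lee_fin => H.
  by rewrite (mulrC 4) -mulrA ler_pM2l// exprn_gt0// kappa_gt0.
Qed.

Lemma nrm2_le_fourierL1 (h : 'cV[RR]_n -> CC) : L2 h -> (forall t, ~ Q t -> h t = 0) ->
  (nrm2 h <= (4 * (kappa ^+ n)^-1)%:E * nrm2 (fourierL1 h))%E.
Proof.
move=> lh hQ; have mh := L2_cmeas lh; have ch := L2_cube_cint lh hQ.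
have k0 : 0 < kappa ^+ n by rewrite exprn_gt0// kappa_gt0.
have mF := cmeas_fourierL1 mh.
have [Ffin|] := ltP (nrm2 (fourierL1 h)) +oo%E; last first.
  by rewrite leye_eq => /eqP ->; rewrite gt0_muley ?leey// lte_fin mulr_gt0// invr_gt0.
(* The total error is [2 * 8 + 2 = 18] times this amount: 8 from the step function, doubled, and 2
   from the difference. *)
apply/lee_addgt0Pr => e e0; have e18 : 0 < e / 18 by rewrite divr_gt0.
have [l lQ hl] := step_dense M0 lh hQ e18.
have ls := L2_step l; have cs := L2_cube_cint ls lQ.
have lB : L2 (fun t => h t - step l t) by exact: L2B.
have BQ t : ~ Q t -> h t - step l t = 0 by move=> Qt; rewrite hQ// lQ// subrr.
have FB := nrm2_fourierL1_le e18 lB BQ hl.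
have mFB : cmeas (fourierL1 (fun t => h t - step l t)) by apply: cmeas_fourierL1; exact: L2_cmeas.
have lFB : L2 (fourierL1 (fun t => h t - step l t)).
  by apply/L2P; split => //; apply: (le_lt_trans FB); rewrite ltry.
have lF : L2 (fourierL1 h) by apply/L2P.
have E1 : h = (fun t => step l t + (h t - step l t)) by apply/funext => t; rewrite addrC subrK.
have E2 : fourierL1 (step l) = (fun w => fourierL1 h w + - fourierL1 (fun t => h t - step l t) w).
  by apply/funext => w; rewrite fourierL1B// opprB addrC subrK.
have H1 := nrm2D (L2_cmeas ls) (L2_cmeas lB); rewrite -E1 in H1.
have H2 := nrm2D mF (cmeasN mFB); rewrite -E2 nrm2N nrm2_fourierL1_step in H2.
move: H1 H2 hl FB; rewrite (L2_nrm2 lh) (L2_nrm2 lB) (L2_nrm2 lFB) (L2_nrm2 lF) (L2_nrm2 ls).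
set x := fine (nrm2 h); set y := fine (nrm2 (fourierL1 h)); set s := fine (nrm2 (step l)).
set u := fine (nrm2 (fun t => h t - step l t)); set v := fine _.
rewrite -!EFinM -!EFinD !lee_fin !lte_fin => H1 H2 H3 H4.
have H5 : s <= 2 * (kappa ^+ n)^-1 * y + 8 * (e / 18).
  rewrite -(ler_pM2l k0); apply: (le_trans H2).
  rewrite mulrDr (_ : kappa ^+ n * (2 * (kappa ^+ n)^-1 * y) = 2 * y); last first.
    by field; rewrite gt_eqF.
  by lra.
have H6 : 4 * (kappa ^+ n)^-1 * y = 2 * (2 * (kappa ^+ n)^-1 * y) by ring.
by rewrite H6; lra.
Qed.

End plancherel.

Lemma fourier_lower_bound n : fourier_bounded_below n.
Proof.
have k0 : 0 < kappa ^+ n by rewrite exprn_gt0// kappa_gt0.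
exists (4 * (kappa ^+ n)^-1); first by rewrite mulr_ge0// invr_ge0 ltW.
move=> h N lh hN.
have N0 : 0 <= Num.max N 0 by rewrite le_max lexx orbT.
apply: (nrm2_le_fourierL1 (addr_ge0 N0 ler01) lh) => t Qt.
apply: hN; rewrite ltNge; apply/negP => tN; apply: Qt.
by apply: (nball_sub_cube N0); rewrite /nball /= le_max tN.
Qed.

Theorem theorem3p1 (d : nat) (g : 'cV[RR]_d -> CC) (A : 'M[RR]_d)
    (S : 'M[RR]_(d + d)) (U Uinv : ('cV[RR]_d -> CC) -> ('cV[RR]_d -> CC)) :
  L2 g -> A \in unitmx -> symplectic S -> metaplectic S U Uinv ->
  (* (1) finitely supported coefficients *)
  (forall c : 'cV[int]_d -> CC, c00 c ->
     forall f fx : 'cV[RR]_d -> CC,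
       has_sumL2 c (TSRg A U Uinv g) f ->
       has_sumL2 (fun k => conjC (c k)) (TSRg A U Uinv g) fx ->
       forall (x : 'cV[RR]_d) (k : 'cV[int]_d),
         let z := S *m col_mx x (duallatpt A k) in
         `|STFT g f (usubmx z) (dsubmx z)| = `|STFT g fx (usubmx z) (dsubmx z)|)
  /\
  (* (2) square-summable coefficients, bounded periodization *)
  ((exists Phi : 'cV[RR]_d -> CC,
       is_fourierL2 (Uinv (reflect_op g)) Phi /\
       ess_bdd_on (fundP A) (periodization A Phi)) ->
   forall c : 'cV[int]_d -> CC, ell2 c ->
     (exists f fx : 'cV[RR]_d -> CC,
        has_sumL2 c (TSRg A U Uinv g) f /\
        has_sumL2 (fun k => conjC (c k)) (TSRg A U Uinv g) fx) /\
     forall f fx : 'cV[RR]_d -> CC,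
       has_sumL2 c (TSRg A U Uinv g) f ->
       has_sumL2 (fun k => conjC (c k)) (TSRg A U Uinv g) fx ->
       forall (x : 'cV[RR]_d) (k : 'cV[int]_d),
         let z := S *m col_mx x (duallatpt A k) in
         `|STFT g f (usubmx z) (dsubmx z)| = `|STFT g fx (usubmx z) (dsubmx z)|).
Proof.
move=> lg uA sS mU; split=> [c _ f fx hf hfx x k|[Phi [hPhi bP]] c c2].
  exact: (stft_norm_eq lg uA sS mU x k hf hfx).
split=> [|f fx hf hfx x k]; last exact: (stft_norm_eq lg uA sS mU x k hf hfx).
have c2' : ell2 (fun k => conjC (c k)).
  by rewrite /ell2; under eq_esum do rewrite abs2_conj.
have fbb := fourier_lower_bound d.
have [f hf] := has_sumL2_TSRg lg uA mU fbb hPhi bP c2.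
have [fx hfx] := has_sumL2_TSRg lg uA mU fbb hPhi bP c2'.
by exists f, fx.
Qed.
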